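(* Let $T>0$, $\alpha\in[0,1)$ and $0<\rho\le2$. Given $(u^0,u^1)\in X_D^1\times X_D^{-1}$, there exists $g\in L^2(0,T)$ such that the weak solution $u$ (in the sense defined in the context) of $$u_{tt}+A_D^2u+\rho\tilde A_D^{\alpha}u_t=0,\quad u(0,t)=u(\pi,t)=0,\quad u_{xx}(0,t)=0,\quad u_{xx}(\pi,t)=g(t),$$ $$u(x,0)=u^0(x),\quad u_t(x,0)=u^1(x)$$ on $(0,\pi)\times(0,T)$ satisfies $u(\cdot,T)=u_t(\cdot,T)=0$, and there exists a constant $C$ depending only on $\alpha,\rho,T$ such that $g$ can be chosen with $$\|g\|_{L^2(0,T)}\le C\big(\|u^0\|_{X_D^1}+\|u^1\|_{X_D^{-1}}\big).$$
   Context: $A_D=-\partial_x^2$ is the Dirichlet Laplacian on $(0,\pi)$ (domain $H^2\cap H_0^1$), with eigenvalues $n^2$, $n\ge1$, and orthonormal eigenfunctions $\varphi_n=\sqrt{2/\pi}\sin(nx)$. For $p\in\mathbb R$, $X_D^p$ is the space of (generalized) series $v=\sum_{n\ge1}a_n\varphi_n$ with $\|v\|_{X_D^p}^2=\sum n^{2p}|a_n|^2<\infty$. The operators $A_D^\alpha$ act by $A_D^\alpha\sum a_n\varphi_n=\sum n^{2\alpha}a_n\varphi_n$ (so $A_D^0$ is the identity). The symbol $\langle\cdot,\cdot\rangle$ is the duality pairing of $X_D^p$ and $X_D^{-p}$: $\langle\sum a_n\varphi_n,\sum b_n\varphi_n\rangle=\sum a_nb_n$. For $\alpha\in(0,1)$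 the extended operator is $\tilde A_D^{\alpha}v(x)=\mathrm{PV}\int_0^\pi(v(x)-v(y))J_D(x,y)\,dy+\kappa(x)v(x)$, where $p_D$ is the heat kernel of $A_D$, $J_D(x,y)=\frac{\alpha}{\Gamma(1-\alpha)}\int_0^\infty p_D(t,x,y)t^{-\alpha-1}dt$ and $\kappa(x)=\frac{\alpha}{\Gamma(1-\alpha)}\int_0^\infty\big(1-\int_0^\pi p_D(t,x,y)dy\big)t^{-\alpha-1}dt$; for $\alpha=0$ it is the identity. The initial boundary value problem is formal; its precise meaning is the following weak formulation. Adjoint solutions. For $\tau\in(0,T]$ and $w^0=\sum w_n^0\varphi_n\in X_D^1$, $w^1=\sum w_n^1\varphi_n\in X_D^{-1}$, let $w(x,t)=\sum_{n\ge1}w_n(t)\varphi_n(x)$, $t\in[0,\tau]$, where $w_n''-\rho n^{2\alpha}w_n'+n^4w_n=0$, $w_n(\tau)=w_n^0$, $w_n'(\tau)=w_n^1$. The trace $w_x(\pi,t)=\sum\varphi_n'(\pi)w_n(t)$ is understood as a limit in $L^2(0,\tau)$ of partial sums. Weak solution: $u\in C([0,T];X_D^1)\cap C^1([0,T];X_D^{-1})$ with $u(\cdot,0)=u^0$, $u_t(\cdot,0)=u^1$, such that for every $\tau\in(0,T]$ and all $(w^0,w^1)\in X_D^1\times X_D^{-1}$, $$0=\langle w^1-\rho A_D^\alpha w^0,u(\cdot,\tau)\rangle-\langle w^0,u_t(\cdot,\tau)\rangle-\langle w_t(\cdot,0)-\rho A_D^\alpha w(\cdot,0),u^0\rangle+\langle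 w(\cdot,0),u^1\rangle+\int_0^\tau w_x(\pi,t)g(t)\,dt .$$ For given $u^0,u^1,g$ the weak solution is unique. *)

(* Defs.v *)
From HB Require Import structures.
From mathcomp Require Import all_boot all_order all_algebra.
From mathcomp Require Import all_classical all_reals all_analysis.
Import Order.TTheory GRing.Theory Num.Theory.
Import numFieldNormedType.Exports.

Set Implicit Arguments.
Unset Strict Implicit.
Unset Printing Implicit Defensive.

Local Open Scope classical_set_scope.
Local Open Scope ring_scope.

(* MathComp-Analysis, over an arbitrary [R : realType].

   A generalized series v = sum_(n >= 1) a_n phi_n is represented by its
   coefficient sequence.  Sequences are indexed from 0: [a n] is the coefficient
   of the (n+1)-st eigenfunction, whose A_D-eigenvalue is (n+1)^2. *)

Section SpectralScale.
Context {R : realType}.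
Implicit Types (a b : nat -> R) (p alpha T : R).

Definition mode (n : nat) : R := n.+1%:R.

Definition phi (n : nat) (x : R) : R := Num.sqrt (2 / pi) * sin (mode n * x).

Definition XDterms p a : nat -> R := fun n => mode n `^ (2 * p) * `|a n| ^+ 2.

Definition in_XD p a : Prop := cvgn (series (XDterms p a)).

(* Meaningful only for [a] in X_D^p: [limn] is total. *)
Definition XDnorm p a : R := Num.sqrt (limn (series (XDterms p a))).

Definition AD alpha a : nat -> R := fun n => mode n `^ (2 * alpha) * a n.

Definition pairing a b : R := limn (series (fun n => a n * b n)).

(* v in C([0,T]; X_D^p) *)
Definition XD_continuous p T (v : R -> nat -> R) : Prop :=
  forall t, t \in `[0, T] ->
    in_XD p (v t) /\
    XDnorm p (v s - v t) @[s --> within `[0, T] (nbhs t)] --> (0 : R).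

(* v in C^1([0,T]; X_D^p) with derivative v'; one-sided at t = 0 and t = T *)
Definition XD_C1 p T (v v' : R -> nat -> R) : Prop :=
  [/\ XD_continuous p T v,
      XD_continuous p T v' &
      forall t, t \in `[0, T] ->
        XDnorm p ((s - t)^-1 *: (v s - v t) - v' t)
          @[s --> within `[0, T] t^'] --> (0 : R)].

End SpectralScale.

Section L2.
Context {R : realType}.
Implicit Types (T : R) (g : R -> R).

Definition in_L2 T g : Prop :=
  g \_ `]0, T[ \in Lfun (@lebesgue_measure R) 2%:E.

Definition L2norm T g : \bar R :=
  'N[@lebesgue_measure R]_2%:E [EFin \o (g \_ `]0, T[)].

End L2.

Section WeakSolution.
Context {R : realType}.
Implicit Types (alpha rho T tau : R).

(* w = sum_n w_n(t) phi_n with time derivative dw on [0, tau].  The ODE holds on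
   the open interval and w_n, w_n' are continuous up to the end points, so that
   the terminal values at tau and the values at 0 are the one-sided ones. *)
Definition adjoint_solution alpha rho tau (w0 w1 : nat -> R)
    (w dw : R -> nat -> R) : Prop :=
  forall n : nat,
  [/\ {within `[0, tau], continuous (fun t => w t n)},
      {within `[0, tau], continuous (fun t => dw t n)},
      forall t, t \in `]0, tau[ ->
        [/\ is_derive t 1 (fun s => w s n) (dw t n),
            derivable (fun s => dw s n) t 1 &
            derive1 (fun s => dw s n) t
              - rho * mode n `^ (2 * alpha) * dw t n + mode n ^+ 4 * w t n = 0],
      w tau n = w0 n &
      dw tau n = w1 n].

(* h is the trace w_x(pi, .): the L^2(0, tau)-limit of the partial sums *)
Definition is_trace tau (w : R -> nat -> R) (h : R -> R) : Prop :=
  in_L2 tau h /\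
  L2norm tau (fun t => h t - \sum_(n < N) derive1 (phi n) pi * w t n)
    @[N --> \oo] --> (0 : \bar R)%E.

(* u' is the time derivative u_t, which is determined by u on [0, T]. *)
Definition weak_solution alpha rho T (g : R -> R) (u0 u1 : nat -> R)
    (u u' : R -> nat -> R) : Prop :=
  [/\ XD_continuous 1 T u,
      XD_C1 (-1) T u u',
      u 0 = u0,
      u' 0 = u1 &
      forall tau, 0 < tau <= T ->
      forall w0 w1 : nat -> R, in_XD 1 w0 -> in_XD (-1) w1 ->
      forall w dw, adjoint_solution alpha rho tau w0 w1 w dw ->
      exists2 h : R -> R, is_trace tau w h &
        0 = pairing (w1 - rho *: AD alpha w0) (u tau)
            - pairing w0 (u' tau)
            - pairing (dw 0 - rho *: AD alpha (w 0)) u0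
            + pairing (w 0) u1
            + \int[lebesgue_measure]_(t in `]0, tau[) (h t * g t)].

End WeakSolution.

(* Main.v *)
(* Each mode [n] (with [m = n + 1]) is a damped oscillator with damping
   [r = rho m^(2 alpha) / 2] and frequency [om = sqrt (m^4 - r^2)], and [u]
   vanishes at time [T] iff [g] solves a moment problem against
   [e^(r_j s) cos (om_j (T - s))] and [e^(r_j s) sin (om_j (T - s)) / om_j].

   Because [alpha < 1], the frequencies separate quadratically, so integrals of
   products of modes [n] and [k] with amplitudes of bounded variation are
   O(1 / (1 + (n - k)^2)) (integration by parts); Schur's test then makes all the
   series involved converge in L^2.

   The moment problem is solved by a biorthogonal family: the [n]-th functions
   are [e^(- r_n s)] times a trigonometric factor of frequency [om_n] times a
   window.  The window is the limit of a bump to which one applies, for each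
   [j <> n], operators [f(s) -> a f(s) + b f(s - l) + c f(s - 2 l)] annihilating
   the frequencies [om_n - om_j] and [om_n + om_j]; quadratic separation makes the
   total translation finite, and choosing [l] as a quarter period for all but
   finitely many neighbours [j] makes the coefficients nonnegative, so that the
   windows are bounded in C^1 uniformly in [n].

   A weak solution is tested against single adjoint modes, which determines
   [u(T)] and [u_t(T)]. *)
Require Import Defs.
From HB Require Import structures.
From mathcomp Require Import all_boot all_order all_algebra.
From mathcomp Require Import all_classical all_reals all_analysis.
From mathcomp Require Import measurable_realfun.
From mathcomp Require Import ring lra zify.
Import Order.TTheory GRing.Theory Num.Theory.
Import numFieldNormedType.Exports.

Set Implicit Arguments.
Unset Strict Implicit.
Unset Printing Implicit Defensive.

Local Open Scope classical_set_scope.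
Local Open Scope ring_scope.

(** * Integrals over (0, t) and amplitudes of bounded variation *)

Section Calculus.
Context {R : realType}.
Implicit Types (f g F G : R -> R) (t x : R).

(** For [alpha > 0] the damping rates [r_n] are unbounded, which threatens every uniform bound.
    Three facts make this harmless. The data enter the moments at time [T] with the factor
    [e^(- r_n T)], which cancels the growth of the test functions, so the coefficients of the
    control carry no exponential loss. The windows live in the second half of [[0, T]], where the
    slope [r_n e^(- r_n s)] is at most [1 / s <= 2 / T]. The translations annihilate
    [e^((r_j - r_n) s) cos (w s + phi)] and not only pure oscillations, with coefficients of sum 1
    that are bounded whatever the difference of the rates. Critical damping ([rho = 2], lowest mode)
    has a double characteristic root: the sine moment degenerates to one against [(T - s) e^(r s)].
    Hence the function [sinc], the double annihilation by the other windows, and a separate pair for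
    that mode. The control is only in L^2, so Duhamel integrals are differentiated through uniform
    limits of those with continuous data; dominated convergence over the modes then gives the
    regularity in [X_D^p]. *)

Definition int0 t f : R := \int[lebesgue_measure]_(s in `]0, t[) f s.

Definition C1 F f := (forall x, is_derive x 1 F (f x)) /\ continuous f.

Lemma integrable_cont t f : continuous f ->
  (@lebesgue_measure R).-integrable `]0, t[ (EFin \o f).
Proof.
move=> cf; have : (@lebesgue_measure R).-integrable `[0, t] (EFin \o f).
  apply: continuous_compact_integrable; first exact: segment_compact.
  exact: continuous_subspaceT.
by apply: integrableS => //; exact: subset_itv_oo_cc.
Qed.

Lemma eq_int0 t f g : (forall s, 0 < s < t -> f s = g s) -> int0 t f = int0 t g.
Proof.
by move=> fg; apply: eq_Rintegral => s; rewrite inE /= in_itv /= => /fg.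
Qed.

Lemma int0D t f g : continuous f -> continuous g ->
  int0 t (fun s => f s + g s) = int0 t f + int0 t g.
Proof. by move=> cf cg; rewrite /int0 RintegralD//; exact: integrable_cont. Qed.

Lemma int0B t f g : continuous f -> continuous g ->
  int0 t (fun s => f s - g s) = int0 t f - int0 t g.
Proof. by move=> cf cg; rewrite /int0 RintegralB//; exact: integrable_cont. Qed.

Lemma int0Z t c f : continuous f -> int0 t (fun s => c * f s) = c * int0 t f.
Proof. by move=> cf; rewrite /int0 RintegralZl//; exact: integrable_cont. Qed.

Lemma int0_0 t : int0 t (fun=> 0) = 0.
Proof. by rewrite /int0 Rintegral_cst// mul0r. Qed.

Lemma cont_sum (I : Type) (r : seq I) (P : pred I) (f : I -> R -> R) :
  (forall i, continuous (f i)) -> continuous (fun s => \sum_(i <- r | P i) f i s).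
Proof.
move=> cf s; elim: r => [|i r IH].
  by under eq_fun do rewrite big_nil; exact: cvg_cst.
under eq_fun do rewrite big_cons.
by case: ifP => _ //; apply: cvgD; [exact: cf | exact: IH].
Qed.

Lemma int0_sum t (I : Type) (r : seq I) (P : pred I) (f : I -> R -> R) :
  (forall i, continuous (f i)) ->
  int0 t (fun s => \sum_(i <- r | P i) f i s) = \sum_(i <- r | P i) int0 t (f i).
Proof.
move=> cf; elim: r => [|i r IH].
  by under eq_int0 => s _ do rewrite big_nil; rewrite int0_0 big_nil.
under eq_int0 => s _ do rewrite big_cons.
rewrite big_cons; case: ifP => _ //.
rewrite int0D ?IH//; exact: (@cont_sum I r P f).
Qed.

Lemma le_int0 t f g : continuous f -> continuous g ->
  (forall s, 0 < s < t -> f s <= g s) -> int0 t f <= int0 t g.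
Proof.
by move=> cf cg fg; apply: le_Rintegral => //; exact: integrable_cont.
Qed.

Lemma int0_ge0 t f : (forall s, 0 < s < t -> 0 <= f s) -> 0 <= int0 t f.
Proof.
by move=> f0; apply: Rintegral_ge0 => s /=; rewrite in_itv /= => /f0.
Qed.

Lemma int0_cst t c : 0 <= t -> int0 t (fun=> c) = c * t.
Proof.
move=> t0; rewrite /int0 Rintegral_cst//.
rewrite /= lebesgue_measure_itv/= lte_fin; case: ltgtP t0 => // [t0 _|<- _] /=; by rewrite ?subr0.
Qed.

Lemma cont_norm f : continuous f -> continuous (fun s => `|f s|).
Proof. by move=> cf s; apply: cvg_norm; exact: cf. Qed.

Lemma norm_int0 t f : continuous f -> `|int0 t f| <= int0 t (fun s => `|f s|).
Proof. by move=> cf; apply: le_normr_Rintegral => //; exact: integrable_cont. Qed.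

Lemma norm_int0_le t f M : 0 <= t -> continuous f ->
  (forall s, 0 < s < t -> `|f s| <= M) -> `|int0 t f| <= M * t.
Proof.
move=> t0 cf fM; apply: (le_trans (norm_int0 t cf)).
rewrite -int0_cst//; apply: le_int0 => //; first exact: cont_norm.
exact: cst_continuous.
Qed.

Lemma is_derive_cont f (d : R) x : is_derive x 1 f d -> {for x, continuous f}.
Proof. by move=> []/derivable1_diffP/differentiable_continuous. Qed.

Lemma C1_cont F f : C1 F f -> continuous F.
Proof. by move=> [d _] x; exact: is_derive_cont. Qed.

Lemma ftc2 t F f : 0 <= t -> (forall x, 0 <= x <= t -> is_derive x 1 F (f x)) ->
  continuous f -> int0 t f = F t - F 0.
Proof.
rewrite le_eqVlt => /predU1P[<-|t0] dF cf.
  by rewrite subrr /int0 set_itvoo0 Rintegral_set0.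
rewrite /int0 Rintegral_itv_obnd_cbnd; last exact: integrable_cont.
rewrite Rintegral_itv_bndo_bndc; last first.
  have : (@lebesgue_measure R).-integrable `[0, t] (EFin \o f).
    apply: continuous_compact_integrable; first exact: segment_compact.
    exact: continuous_subspaceT.
  by apply: integrableS => //; apply: subset_itvl; rewrite bnd_simp.
rewrite /Rintegral (@continuous_FTC2 R f F)//.
- exact: continuous_subspaceT.
- split.
  + by move=> x; rewrite in_itv/= => /andP[/ltW x0 /ltW xt]; have [] := dF x; rewrite ?x0.
  + apply: cvg_at_right_filter; apply: (@is_derive_cont _ (f 0)); apply: dF; rewrite lexx; exact: ltW.
  + apply: cvg_at_left_filter; apply: (@is_derive_cont _ (f t)); apply: dF; rewrite lexx andbT; exact: ltW.
- move=> x; rewrite in_itv/= => /andP[/ltW x0 /ltW xt]; have := dF x; rewrite x0 xt => /(_ erefl) ?.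
  by rewrite derive1E; apply: derive_val.
Qed.

(** In the applications [A] lies below 0, so that the derivative is two-sided at 0, as [ftc2]
    requires. *)
Lemma primitive f A : continuous f ->
  exists F, forall x, A < x -> is_derive x 1 F (f x).
Proof.
move=> cf; exists (fun x => \int[@lebesgue_measure R]_(s in `[A, x]) f s) => x x1.
have [] := @continuous_FTC1_closed R f A x (x + 1) _ _ x1 (cf x).
- by rewrite ltrDl.
- apply: continuous_compact_integrable; first exact: segment_compact.
  exact: continuous_subspaceT.
- by move=> d e; apply: DeriveDef => //; rewrite -derive1E.
Qed.

End Calculus.

(** * Derivatives and continuity of the elementary functions involved *)

Section Derivatives.
Context {R : realType}.
Implicit Types (f g F G : R -> R) (t x a b c : R).

Lemma derD F G x a b : is_derive x 1 F a -> is_derive x 1 G b ->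
  is_derive x 1 (fun s => F s + G s) (a + b).
Proof. by move=> dF dG; exact: is_deriveD. Qed.

Lemma derB F G x a b : is_derive x 1 F a -> is_derive x 1 G b ->
  is_derive x 1 (fun s => F s - G s) (a - b).
Proof. by move=> dF dG; exact: is_deriveB. Qed.

Lemma derM F G x a b : is_derive x 1 F a -> is_derive x 1 G b ->
  is_derive x 1 (fun s => F s * G s) (a * G x + F x * b).
Proof.
by move=> dF dG; apply: is_derive_eq; rewrite addrC /GRing.scale /= (mulrC a).
Qed.

Lemma derZ F x c a : is_derive x 1 F a -> is_derive x 1 (fun s => c * F s) (c * a).
Proof. by move=> dF; apply: is_deriveZ. Qed.

Lemma der_cst c x : is_derive x 1 (fun=> c : R) 0.
Proof. exact: is_derive_cst. Qed.

Lemma der_affine a b x : is_derive x 1 (fun s : R => a * s + b) a.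
Proof.
have := derD (derZ a (is_derive_id x (1 : R))) (der_cst b x).
by rewrite mulr1 addr0.
Qed.

Lemma der_comp F G x a b : is_derive (G x) 1 F a -> is_derive x 1 G b ->
  is_derive x 1 (fun s => F (G s)) (a * b).
Proof. by move=> dF dG; exact: is_derive1_comp. Qed.

Lemma der_expR a b x :
  is_derive x 1 (fun s => expR (a * s + b)) (a * expR (a * x + b)).
Proof.
by rewrite mulrC; exact: (@der_comp expR _ _ _ _ (is_derive_expR _) (der_affine a b x)).
Qed.

Lemma der_cos a b x :
  is_derive x 1 (fun s => cos (a * s + b)) (- a * sin (a * x + b)).
Proof.
rewrite mulNr mulrC -mulNr.
by exact: (@der_comp cos _ _ _ _ (is_derive_cos _) (der_affine a b x)).
Qed.

Lemma der_sin a b x :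
  is_derive x 1 (fun s => sin (a * s + b)) (a * cos (a * x + b)).
Proof.
by rewrite mulrC; exact: (@der_comp sin _ _ _ _ (is_derive_sin _) (der_affine a b x)).
Qed.

Lemma is_derive_ext F G x a : (forall s, F s = G s) -> is_derive x 1 F a -> is_derive x 1 G a.
Proof. by move=> /funext ->. Qed.

Lemma contD f g : continuous f -> continuous g -> continuous (fun s => f s + g s).
Proof. by move=> cf cg s; apply: cvgD; [exact: cf|exact: cg]. Qed.

Lemma contB f g : continuous f -> continuous g -> continuous (fun s => f s - g s).
Proof. by move=> cf cg s; apply: cvgB; [exact: cf|exact: cg]. Qed.

Lemma contM f g : continuous f -> continuous g -> continuous (fun s => f s * g s).
Proof. by move=> cf cg s; apply: cvgM; [exact: cf|exact: cg]. Qed.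

Lemma contZ c f : continuous f -> continuous (fun s => c * f s).
Proof. by move=> cf; apply: contM => //; exact: cst_continuous. Qed.

Lemma cont_expR a b : continuous (fun s : R => expR (a * s + b)).
Proof. by move=> s; exact: is_derive_cont (der_expR a b s). Qed.

Lemma cont_cos a b : continuous (fun s : R => cos (a * s + b)).
Proof. by move=> s; exact: is_derive_cont (der_cos a b s). Qed.

Lemma cont_sin a b : continuous (fun s : R => sin (a * s + b)).
Proof. by move=> s; exact: is_derive_cont (der_sin a b s). Qed.

Lemma norm_cos_le1 x : `|cos x| <= 1.
Proof. by rewrite ler_norml cos_geN1 cos_le1. Qed.

Lemma norm_sin_le1 x : `|sin x| <= 1.
Proof. by rewrite ler_norml sin_geN1 sin_le1. Qed.

End Derivatives.

(** * Integrals of oscillating functions *)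

Section Oscillation.
Context {R : realType}.
Implicit Types (f g F G : R -> R) (t x a b M N w : R).

(** One constant bounds both the size and the total variation, the two quantities that an
    integration by parts consumes. *)
Definition BV t M F := exists f, [/\ C1 F f,
  forall s, 0 <= s <= t -> `|F s| <= M & int0 t (fun s => `|f s|) <= M].

Lemma BV_M F t M N : 0 <= t -> M <= N -> BV t M F -> BV t N F.
Proof.
move=> t0 MN [f [C bF bf]]; exists f; split => //.
  by move=> s /bF /le_trans; apply.
exact: le_trans MN.
Qed.

Lemma BV_ge0 F t M : 0 <= t -> BV t M F -> 0 <= M.
Proof. by move=> t0 [f [_ bF _]]; apply: (le_trans _ (bF 0 _)) => //; rewrite lexx. Qed.

Lemma int0_mono t t' f : t <= t' -> continuous f ->
  (forall s, 0 <= f s) -> int0 t f <= int0 t' f.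
Proof.
move=> tt' cf f0; have cf' := cf; move: cf' => /(primitive (- 1))[F dF].
case: (ltP t 0) => t0.
  rewrite /int0 set_itv_ge ?bnd_simp ?Rintegral_set0; last by rewrite -leNgt ltW.
  exact: int0_ge0.
have t'0 := le_trans t0 tt'.
have m1 x : 0 <= x -> -1 < x by apply: lt_le_trans; rewrite ltrN10.
have E u : 0 <= u -> int0 u f = F u - F 0.
  by move=> u0; apply: ftc2 => // x /andP[/m1 + _]; exact: dF.
rewrite !E// lerD2r; apply: (@ger0_derive1_ndecr _ F t t') => //.
- move=> x; rewrite in_itv/= => /andP[tx _]; have := dF x (m1 _ (le_trans t0 (ltW tx))).
  by case.
- move=> x; rewrite in_itv/= => /andP[tx _].
  by have ? := dF x (m1 _ (le_trans t0 (ltW tx))); rewrite derive1E derive_val.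
- apply/subspace_continuousP => x /=; rewrite in_itv/= => /andP[tx _].
  by apply: cvg_within_filter; apply: is_derive_cont (dF x (m1 _ (le_trans t0 tx))).
Qed.

Lemma BV_t F t t' M : t <= t' -> BV t' M F -> BV t M F.
Proof.
move=> tt' [f [[dF cf] bF bf]]; exists f; split => //.
  by move=> s /andP[s0 st]; apply: bF; rewrite s0 (le_trans st).
apply: le_trans bf; apply: int0_mono => //; exact: cont_norm.
Qed.

(** The factor 2 is for the variation: [f G] and [F g] contribute [M N] each. *)
Lemma BV_mul F G t M N : 0 <= t -> BV t M F -> BV t N G ->
  BV t (2 * M * N) (fun s => F s * G s).
Proof.
move=> t0 bvF bvG; have M0 := BV_ge0 t0 bvF; have N0 := BV_ge0 t0 bvG.
move: bvF bvG => [f [[dF cf] bF bf]] [g [[dG cg] bG bg]].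
have cF : continuous F by apply: C1_cont; split; [exact: dF|].
have cG : continuous G by apply: C1_cont; split; [exact: dG|].
exists (fun s => f s * G s + F s * g s); split.
- split; first by move=> x; exact: derM.
  by apply: contD; apply: contM.
- move=> s st; rewrite normrM mulr2n !mulrDl mul1r.
  have h : `|F s| * `|G s| <= M * N by apply: ler_pM => //; [exact: bF|exact: bG].
  by apply: (le_trans h); rewrite lerDl mulr_ge0.
have -> : 2 * M * N = N * M + M * N by ring.
have c1 : continuous (fun s => N * `|f s|) by apply: contZ; exact: cont_norm.
have c2 : continuous (fun s => M * `|g s|) by apply: contZ; exact: cont_norm.
apply: (@le_trans _ _ (int0 t (fun s => N * `|f s| + M * `|g s|))).
  apply: le_int0; [|exact: contD|].
    by apply: cont_norm; apply: contD; apply: contM.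
  move=> s /andP[/ltW s0 /ltW st].
  apply: (le_trans (ler_normD _ _)); rewrite !normrM mulrC lerD//.
    by rewrite ler_wpM2r// bG// s0.
  by rewrite ler_wpM2r// bF// s0.
rewrite int0D// !int0Z; [|exact: cont_norm..].
by rewrite lerD// ler_wpM2l.
Qed.

(** Integration by parts: the two boundary values and the variation of the amplitude cost [M / |w|]
    each, independently of [t]. *)
Lemma osc_bound F t M w a : 0 <= t -> w != 0 -> BV t M F ->
  `|int0 t (fun s => F s * cos (w * s + a))| <= 3 * M / `|w|.
Proof.
move=> t0 w0 bvF; have M0 := BV_ge0 t0 bvF; move: bvF => [f [[dF cf] bF bf]].
have cF : continuous F by apply: C1_cont; split; [exact: dF|].
have cFc : continuous (fun s => F s * cos (w * s + a)) by apply: contM => //; exact: cont_cos.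
have cfs : continuous (fun s => f s * (w^-1 * sin (w * s + a))).
  by apply: contM => //; apply: contZ; exact: cont_sin.
have dH x : 0 <= x <= t -> is_derive x 1 (fun s => F s * (w^-1 * sin (w * s + a)))
    (f x * (w^-1 * sin (w * x + a)) + F x * cos (w * x + a)).
  move=> _; have := derM (dF x) (derZ w^-1 (der_sin w a x)).
  by rewrite (mulrA w^-1) mulVf// mul1r.
have := ftc2 t0 dH (contD cfs cFc); rewrite int0D// => /eqP.
rewrite addrC eq_sym -subr_eq eq_sym => /eqP ->.
have wb y : `|w^-1 * sin y| <= `|w|^-1.
  by rewrite normrM normfV ler_piMr ?invr_ge0// norm_sin_le1.
have Fb s : 0 <= s <= t -> `|F s * (w^-1 * sin (w * s + a))| <= M / `|w|.
  by move=> st; rewrite normrM ler_pM// bF.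
apply: (le_trans (ler_normB _ _)).
have -> : 3 * M / `|w| = M / `|w| + M / `|w| + M / `|w| by ring.
apply: lerD.
  apply: (le_trans (ler_normB _ _)).
  by apply: lerD; apply: Fb; rewrite lexx ?andbT.
apply: (le_trans (norm_int0 t cfs)).
apply: (@le_trans _ _ (int0 t (fun s => `|w|^-1 * `|f s|))).
  apply: le_int0; [exact: cont_norm|by apply: contZ; exact: cont_norm|].
  by move=> s _; rewrite normrM mulrC ler_wpM2r.
rewrite int0Z; last exact: cont_norm.
by rewrite (mulrC M) ler_wpM2l ?invr_ge0.
Qed.

(* [osc t M w f]: on [0, t], f oscillates with frequency w and has an
   amplitude of size and variation at most M. *)
Definition osc t M w f := exists2 F, BV t M F &
  exists a, forall s, f s = F s * cos (w * s + a).

Lemma osc_cont t M w f : osc t M w f -> continuous f.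
Proof.
move=> [F [h [C _ _]] [a fE]]; rewrite (_ : f = fun s => F s * cos (w * s + a)).
  by apply: contM; [exact: C1_cont C|exact: cont_cos].
exact/funext.
Qed.

Lemma osc_M t M N w f : 0 <= t -> M <= N -> osc t M w f -> osc t N w f.
Proof. by move=> t0 MN [F bF fE]; exists F => //; exact: BV_M bF. Qed.

Lemma osc_t t t' M w f : t <= t' -> osc t' M w f -> osc t M w f.
Proof. by move=> tt' [F bF fE]; exists F => //; exact: BV_t bF. Qed.

Lemma osc_ge0 t M w f : 0 <= t -> osc t M w f -> 0 <= M.
Proof. by move=> t0 [F bF _]; exact: BV_ge0 bF. Qed.

Lemma osc_bnd t M w f s : osc t M w f -> 0 <= s <= t -> `|f s| <= M.
Proof.
move=> [F [h [_ bF _]] [a ->]] st; rewrite normrM.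
by apply: (le_trans _ (bF s st)); rewrite ler_piMr// norm_cos_le1.
Qed.

Lemma osc_mul_diag t M N w v f h : 0 <= t -> osc t M w f -> osc t N v h ->
  `|int0 t (fun s => f s * h s)| <= M * N * t.
Proof.
move=> t0 of_ oh; apply: norm_int0_le => //.
  by apply: contM; [exact: osc_cont of_|exact: osc_cont oh].
move=> s /andP[/ltW s0 /ltW st].
by rewrite normrM ler_pM// ?(osc_bnd of_) ?(osc_bnd oh)// s0.
Qed.

Lemma cosMcos x y : cos x * cos y = 2^-1 * (cos (x - y) + cos (x + y)) :> R.
Proof. by rewrite cosB cosD; field. Qed.

(** The product is half the sum of two oscillations of amplitude [2 M N]. For nonnegative
    frequencies [w + v] is at least [|w - v|], so both obey the same bound. *)
Lemma osc_mul t M N w v f h : 0 <= t -> 0 <= w -> 0 <= v -> w != v ->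
  osc t M w f -> osc t N v h ->
  `|int0 t (fun s => f s * h s)| <= 6 * M * N / `|w - v|.
Proof.
move=> t0 w0 v0 wv [F bF [a fE]] [H bH [b hE]].
have bFH := BV_mul t0 bF bH.
have FH0 := BV_ge0 t0 bFH.
set K := 2 * M * N in bFH FH0.
have cFH : continuous (fun s => F s * H s) by case: bFH => ? [] /C1_cont.
have c1 : continuous (fun s => F s * H s * cos ((w - v) * s + (a - b))).
  by apply: contM => //; exact: cont_cos.
have c2 : continuous (fun s => F s * H s * cos ((w + v) * s + (a + b))).
  by apply: contM => //; exact: cont_cos.
have -> : int0 t (fun s => f s * h s) =
  2^-1 * (int0 t (fun s => F s * H s * cos ((w - v) * s + (a - b))) +
          int0 t (fun s => F s * H s * cos ((w + v) * s + (a + b)))).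
  rewrite -int0D// -int0Z; last exact: contD.
  apply: eq_int0 => s _; rewrite fE hE mulrACA cosMcos mulrCA mulrDr.
  by congr (_ * (_ * cos _ + _ * cos _)); ring.
have wv0 : 0 < `|w - v| by rewrite normr_gt0 subr_eq0.
have wvp : `|w - v| <= `|w + v|.
  by rewrite [leRHS]ger0_norm ?addr_ge0// ler_norml; apply/andP; split; lra.
have h1 := osc_bound (a - b) t0 (_ : w - v != 0) bFH.
have h2 := osc_bound (a + b) t0 (_ : w + v != 0) bFH.
rewrite normrM ger0_norm ?invr_ge0//.
rewrite ler_pdivrMl//; apply: (le_trans (ler_normD _ _)).
have -> : 2 * (6 * M * N / `|w - v|) = 3 * K / `|w - v| + 3 * K / `|w - v|.
  by rewrite /K; ring.
apply: lerD; first by apply: h1; rewrite subr_eq0.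
apply: (le_trans (h2 _)).
  by rewrite -normr_gt0; exact: lt_le_trans wvp.
apply: ler_wpM2l; first exact: mulr_ge0.
by rewrite lef_pV2 ?posrE//; exact: lt_le_trans wvp.
Qed.

End Oscillation.

(** * Almost orthogonal series in L^2 *)

Section Weights.
Context {R : realType}.
Implicit Types (a b : nat -> R) (n m p q N : nat).

Definition wt n m : R := (1 + (n%:R - m%:R) ^+ 2)^-1.

Lemma wt_gt0 n m : 0 < wt n m.
Proof. by rewrite invr_gt0 ltr_wpDr// sqr_ge0. Qed.

Lemma wt_ge0 n m : 0 <= wt n m.
Proof. exact/ltW/wt_gt0. Qed.

Lemma wtC n m : wt n m = wt m n.
Proof. by rewrite /wt -sqrrN opprB. Qed.

Lemma wt_nn n : wt n n = 1.
Proof. by rewrite /wt subrr expr0n addr0 invr1. Qed.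

Definition dist n m := ((n - m) + (m - n))%N.

Lemma dist_sqr n m : (n%:R - m%:R) ^+ 2 = (dist n m)%:R ^+ 2 :> R.
Proof.
rewrite /dist; case: (leqP n m) => [nm|/ltnW nm].
  by rewrite (eqP nm) add0n natrB// -sqrrN opprB.
by rewrite (eqP nm) addn0 natrB.
Qed.

(** At most two indices [m], one on each side of [n], share a given distance. *)
Lemma sum_dist (F : nat -> R) (B : R) n N : (forall d, 0 <= F d) ->
  (forall P, \sum_(0 <= d < P) F d <= B) ->
  \sum_(0 <= m < N) F (dist n m) <= B + B.
Proof.
move=> F0 FB.
have h1 : \sum_(0 <= m < N | (m < n)%N) F (n - m)%N <= B.
  apply: le_trans (FB n.+1).
  suff : \sum_(0 <= m < N | (m < n)%N) F (n - m)%N + \sum_(0 <= d < (n - N).+1) F d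
      <= \sum_(0 <= d < n.+1) F d.
    by apply: le_trans; rewrite lerDl sumr_ge0.
  elim: N => [|N IH]; first by rewrite big_geq// add0r subn0.
  apply: le_trans IH; rewrite big_mkcond big_nat_recr//= -big_mkcond/= -addrA lerD2l.
  case: ltnP => Nn.
    by rewrite subnSK// [leRHS]big_nat_recr//= addrC.
  by rewrite add0r (_ : (n - N.+1 = n - N)%N)//; lia.
have h2 : \sum_(0 <= m < N | (n <= m)%N) F (m - n)%N <= B.
  apply: le_trans (FB (N - n)%N); elim: N {h1} => [|N IH]; first by rewrite !big_geq.
  rewrite big_mkcond big_nat_recr//= -big_mkcond/=; case: leqP => nN.
    by rewrite subSn// big_nat_recr//= lerD2r.
  by rewrite addr0; apply: (le_trans IH); rewrite !big_geq//; lia.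
apply: le_trans (lerD h1 h2); rewrite (big_mkcond (fun m => (m < n)%N)).
rewrite (big_mkcond (fun m => (n <= m)%N)) -big_split/= ler_sum// => m _.
rewrite /dist; case: ltnP => nm.
  by rewrite addr0 (eqP (ltnW nm)) addn0.
by rewrite add0r (eqP nm).
Qed.

Lemma sum_invsq P : \sum_(0 <= d < P) (1 + d%:R ^+ 2)^-1 <= 3 :> R.
Proof.
(* The subtracted [2 / Q.+1] drops at each step by more than the new term, which makes the induction
   close. *)
suff H Q : \sum_(0 <= d < Q.+1) (1 + d%:R ^+ 2)^-1 <= 3 - 2 / Q.+1%:R :> R.
  case: P => [|P]; first by rewrite big_geq.
  by apply: (le_trans (H P)); rewrite gerBl.
elim: Q => [|Q IH].
  by rewrite big_nat1 expr0n addr0 invr1; lra.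
rewrite big_nat_recr//=; apply: (le_trans (lerD IH (lexx _))).
have q0 : 0 <= Q%:R :> R by [].
rewrite -!(natr1 Q.+1) -!(natr1 Q); set x := Q%:R in q0 *.
rewrite -addrA lerD2l -subr_ge0.
have -> : - (2 / (x + 1 + 1)) - (- (2 / (x + 1)) + (1 + (x + 1) ^+ 2)^-1) =
  (x ^+ 2 + x + 2 ) / ((x + 1) * (x + 1 + 1) * (1 + (x + 1) ^+ 2)).
  field; rewrite !lt0r_neq0//=; nra.
by rewrite divr_ge0//; nra.
Qed.

Lemma sum_wt n N : \sum_(0 <= m < N) wt n m <= 6.
Proof.
have -> : 6 = 3 + 3 :> R by ring.
under eq_bigr do rewrite /wt dist_sqr.
by apply: (@sum_dist (fun d => (1 + d%:R ^+ 2)^-1)) => [d|P];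
  [rewrite invr_ge0 addr_ge0 ?sqr_ge0 | exact: sum_invsq].
Qed.

Lemma le_sum_nat (F : nat -> R) p q : (forall n, 0 <= F n) ->
  \sum_(p <= n < q) F n <= \sum_(0 <= n < q) F n.
Proof.
move=> F0; case: (leqP p q) => pq.
  by rewrite [leRHS](big_cat_nat (leq0n p) pq)//= lerDr sumr_ge0.
by rewrite big_geq ?sumr_ge0// ltnW.
Qed.

(** [2 a_n a_m <= a_n^2 + a_m^2] and the symmetry of the weight reduce the double sum to row sums,
    which are at most 6. *)
Lemma schur a p q : 
  \sum_(p <= n < q) \sum_(p <= m < q) wt n m * a n * a m <= 6 * \sum_(p <= n < q) a n ^+ 2.
Proof.
have H n : \sum_(p <= m < q) wt n m <= 6.
  by apply: (le_trans (le_sum_nat _ _ _)); [exact: wt_ge0|exact: sum_wt].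
set X := \sum_(p <= n < q) \sum_(p <= m < q) wt n m * (a n) ^+ 2.
have hX : X <= 6 * \sum_(p <= n < q) a n ^+ 2.
  rewrite mulr_sumr; apply: ler_sum => n _.
  by rewrite -mulr_suml ler_wpM2r// sqr_ge0.
suff h : \sum_(p <= n < q) \sum_(p <= m < q) wt n m * a n * a m <= 2^-1 * X + 2^-1 * X.
  by apply: (le_trans h); lra.
have XE : X = \sum_(p <= n < q) \sum_(p <= m < q) wt n m * (a m) ^+ 2.
  by rewrite exchange_big; apply: eq_bigr => n _; apply: eq_bigr => m _; rewrite wtC.
rewrite {2}XE /X !mulr_sumr -big_split/=; apply: ler_sum => n _.
rewrite !mulr_sumr -big_split/=; apply: ler_sum => m _.
have := wt_gt0 n m; set w := wt n m => w0.
by have : 0 <= w * (a n - a m) ^+ 2; [rewrite mulr_ge0 ?sqr_ge0// ltW|nra].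
Qed.

(** Weighted Cauchy-Schwarz by induction; the cross term of the new index [i] is absorbed by
    [sum_j w_j (b_j - b_i)^2 >= 0]. *)
Lemma sum_cauchy (I : Type) (r : seq I) (w b : I -> R) : (forall i, 0 <= w i) ->
  (\sum_(i <- r) w i * b i) ^+ 2 <= (\sum_(i <- r) w i) * (\sum_(i <- r) w i * b i ^+ 2).
Proof.
move=> w0; elim: r => [|i r IH]; first by rewrite !big_nil expr0n mul0r.
rewrite !big_cons; set A := \sum_(j <- r) w j * b j in IH *.
set W := \sum_(j <- r) w j in IH *; set B := \sum_(j <- r) w j * b j ^+ 2 in IH *.
have W0 : 0 <= W by apply: sumr_ge0.
have : 0 <= \sum_(j <- r) w j * (b j - b i) ^+ 2.
  by apply: sumr_ge0 => j _; rewrite mulr_ge0 ?sqr_ge0.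
have -> : \sum_(j <- r) w j * (b j - b i) ^+ 2 = B - 2 * b i * A + b i ^+ 2 * W.
  rewrite /B /A /W !mulr_sumr -sumrN -!big_split/=.
  by apply: eq_bigr => j _; ring.
by have := w0 i; move: (w i) (b i) => u v u0 h; nra.
Qed.

End Weights.

(** * The L^2 norm on (0, t) *)

Section L2theory.
Context {R : realType}.
Local Notation mu := (@lebesgue_measure R).
Implicit Types (f g : R -> R) (t e : R) (G : nat -> R -> R).

Definition sqI t f : \bar R := (\int[mu]_(s in `]0%R, t[) ((f s) ^+ 2)%:E)%E.

Lemma sqI_ge0 t f : (0 <= sqI t f)%E.
Proof. by apply: integral_ge0 => s _; rewrite lee_fin sqr_ge0. Qed.

Lemma L2norm_sqI t f : L2norm t f = (sqI t f `^ 2^-1)%E.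
Proof.
rewrite /L2norm unlock /sqI [in RHS]integral_mkcond; congr (_ `^ _)%E.
apply: eq_integral => x _ /=; rewrite /patch; case: ifP => _.
  by rewrite powR_mulrn ?normr_ge0// real_normK ?num_real.
by rewrite normr0 powR_mulrn// expr0n.
Qed.

Lemma poweR_homo r (x y : \bar R) : 0 <= r -> (0 <= x)%E -> (x <= y)%E ->
  (x `^ r <= y `^ r)%E.
Proof.
move=> r0 x0 xy; apply: gt0_ler_poweR => //; rewrite in_itv/= leey andbT//.
exact: le_trans xy.
Qed.

Lemma L2norm_le t f e : 0 <= e -> (sqI t f <= (e ^+ 2)%:E)%E -> (L2norm t f <= e%:E)%E.
Proof.
move=> e0 h; rewrite L2norm_sqI.
have -> : e%:E = ((e ^+ 2)%:E `^ 2^-1)%E.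
  rewrite poweR_EFin; congr EFin.
  by rewrite -powR_mulrn// -powRrM mulfV ?powRr1// ?pnatr_eq0.
by apply: poweR_homo => //; exact: sqI_ge0.
Qed.

Lemma L2norm_ge t f e : 0 <= e -> (L2norm t f <= e%:E)%E -> (sqI t f <= (e ^+ 2)%:E)%E.
Proof.
move=> e0; rewrite L2norm_sqI => h.
have -> : sqI t f = ((sqI t f `^ 2^-1) `^ 2)%E.
  rewrite -poweRrM mulVf ?pnatr_eq0// poweRe1//; exact: sqI_ge0.
rewrite -(powR_mulrn 2 e0) -poweR_EFin.
by apply: poweR_homo => //; exact: poweR_ge0.
Qed.

Lemma sqI_cont t f : continuous f -> sqI t f = (int0 t (fun s => f s ^+ 2))%:E.
Proof.
move=> cf; rewrite /int0 /Rintegral fineK//.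
apply: integrable_fin_num => //; apply: (@integrable_cont R t (fun s => f s ^+ 2)).
exact: contM.
Qed.

Lemma meas_cont t f : continuous f -> measurable_fun `]0, t[ f.
Proof.
move=> cf; apply: (@measurable_funS _ _ _ _ setT) => //.
exact: continuous_measurable_fun.
Qed.

Lemma meas_restrict t f : measurable_fun `]0, t[ f -> measurable_fun setT (f \_ `]0, t[).
Proof. by move=> mf; apply: (measurable_restrictT f _).1. Qed.

Lemma in_L2_meas t f : in_L2 t f -> measurable_fun `]0, t[ f.
Proof.
by move=> /andP[+ _]; rewrite inE /= => mf; apply/measurable_restrictT.
Qed.

Lemma in_L2P t f : measurable_fun `]0, t[ f -> (sqI t f < +oo)%E -> in_L2 t f.
Proof.
move=> mf foo; apply/andP; split; rewrite inE/=.
  exact: meas_restrict.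
rewrite /finite_norm -/(L2norm t f) L2norm_sqI poweR_lty//.
Qed.

Lemma in_L2_lty t f : in_L2 t f -> (L2norm t f < +oo)%E.
Proof. by move=> /andP[_]; rewrite inE. Qed.

Lemma in_L2_cont t f : continuous f -> in_L2 t f.
Proof. by move=> cf; apply: in_L2P; [exact: meas_cont|rewrite sqI_cont// ltry]. Qed.

Lemma L2norm_ge0 t f : (0 <= L2norm t f)%E.
Proof. exact: Lnorm_ge0. Qed.

(** The real-valued integral is linear only on integrable functions, so integrability of the product
    is delivered together with the bound. *)
Lemma L2norm_cauchy t f g a b : measurable_fun `]0, t[ f -> measurable_fun `]0, t[ g ->
  (L2norm t f <= a%:E)%E -> (L2norm t g <= b%:E)%E ->
  mu.-integrable `]0, t[ (EFin \o (fun s => f s * g s)) /\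
  `|int0 t (fun s => f s * g s)| <= a * b.
Proof.
move=> mf mg fa gb.
have mf' : measurable_fun setT (f \_ `]0, t[) := meas_restrict mf.
have mg' : measurable_fun setT (g \_ `]0, t[) := meas_restrict mg.
have := @hoelder _ _ R mu _ _ 2 2 mf' mg' (ltr0n _ 2) (ltr0n _ 2).
have -> : 2^-1 + 2^-1 = 1 :> R by field.
move=> /(_ erefl); rewrite Lnorm1 -/(L2norm t f) -/(L2norm t g).
have -> : (\int[mu]_x `|(EFin \o ((f \_ `]0, t[) \* (g \_ `]0%R, t[))%R) x| =
  \int[mu]_(x in `]0%R, t[) `|(f x * g x)%:E|)%E.
  rewrite [RHS]integral_mkcond; apply: eq_integral => x _; rewrite /= /patch.
  by case: ifP => _ //; rewrite mul0r normr0.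
move=> h; have hab : (\int[mu]_(x in `]0%R, t[) `|(f x * g x)%:E| <= (a * b)%:E)%E.
  apply: (le_trans h); rewrite EFinM; apply: lee_pmul => //; exact: Lnorm_ge0.
have I : mu.-integrable `]0, t[ (EFin \o (fun s => f s * g s)).
  apply/integrableP; split; last exact: le_lt_trans hab (ltry _).
  by apply/measurable_EFinP; exact: measurable_funM.
split => //; rewrite -lee_fin; apply: le_trans hab.
by rewrite /int0 EFin_normr_Rintegral//; exact: le_abse_integral (measurable_int _ I).
Qed.

Lemma L2norm_triangle t f g a b : measurable_fun `]0, t[ f -> measurable_fun `]0, t[ g ->
  (L2norm t f <= a%:E)%E -> (L2norm t g <= b%:E)%E ->
  (L2norm t (fun s => f s + g s)%R <= (a + b)%:E)%E.
Proof.
move=> mf mg fa gb.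
have mf' : measurable_fun setT (f \_ `]0, t[) := meas_restrict mf.
have mg' : measurable_fun setT (g \_ `]0, t[) := meas_restrict mg.
have h := @minkowski_EFin _ _ R mu _ _ 2 mf' mg' (ler1n _ 2).
rewrite EFinD; apply: (le_trans _ (leeD fa gb)); apply: le_trans h.
rewrite le_eqVlt; apply/orP; left; apply/eqP; apply: eq_Lnorm => x /=.
by rewrite /patch; case: ifP => // _; rewrite addr0.
Qed.

Lemma sqI_t t t' f : t <= t' -> measurable_fun `]0, t'[ f -> (sqI t f <= sqI t' f)%E.
Proof.
move=> tt' mf; apply: ge0_subset_integral => //.
- by apply/measurable_EFinP; exact: measurable_funX.
- by move=> s _; rewrite lee_fin sqr_ge0.
- by apply: subset_itvl; rewrite bnd_simp.
Qed.

Lemma in_L2_t t t' f : t <= t' -> in_L2 t' f -> in_L2 t f.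
Proof.
move=> tt' h; have mf := in_L2_meas h; apply: in_L2P.
  by apply: measurable_funS mf => //; apply: subset_itvl; rewrite bnd_simp.
apply: (le_lt_trans (sqI_t tt' mf)).
have := in_L2_lty h; have := L2norm_ge0 t' f; case E : (L2norm t' f) => [r| |]// r0 _.
by apply: (le_lt_trans _ (ltry (r ^+ 2))); apply: L2norm_ge => //; rewrite E.
Qed.

Lemma L2norm_t t t' f e : t <= t' -> 0 <= e -> measurable_fun `]0, t'[ f ->
  (L2norm t' f <= e%:E)%E -> (L2norm t f <= e%:E)%E.
Proof.
move=> tt' e0 mf h; apply: L2norm_le => //; apply: (le_trans (sqI_t tt' mf)).
exact: L2norm_ge.
Qed.

End L2theory.

(** * Completeness of L^2 *)

Section Completeness.
Context {R : realType}.
Local Notation mu := (@lebesgue_measure R).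
Implicit Types (f g : R -> R) (t e : R) (G : nat -> R -> R).

Lemma meas_sqr t f : measurable_fun `]0, t[ f ->
  measurable_fun `]0, t[ (EFin \o (fun s => f s ^+ 2)).
Proof.
move=> mf; apply/measurable_EFinP.
exact: measurable_funX.
Qed.

Lemma limn_einf_le (u : (\bar R)^nat) x N :
  (forall n, (N <= n)%N -> (u n <= x)%E) -> (limn_einf u <= x)%E.
Proof.
move=> ux; rewrite limn_einf_lim; apply: lime_le; first exact: is_cvg_einfs.
exists N => // n /= Nn; apply: le_trans (ux n Nn).
by apply: ereal_inf_lbound; exists n => /=.
Qed.

Lemma geo4_lty : (\sum_(0 <= k <oo) (4^-1 ^+ k : R)%:E < +oo)%E.
Proof.
apply: (@le_lt_trans _ _ 2%:E); last exact: ltry.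
apply: lime_le.
  by apply: is_cvg_nneseries => n _ _; rewrite lee_fin exprn_ge0// invr_ge0.
near=> n; rewrite sumEFin lee_fin.
suff : \sum_(0 <= k < n) (4^-1 ^+ k : R) <= 2 - 2 * (4^-1 : R) ^+ n.
  by move=> /le_trans; apply; rewrite gerBl mulr_ge0// exprn_ge0// invr_ge0.
elim: (n) => [|m IH]; first by rewrite big_geq// expr0; lra.
rewrite big_nat_recr//= exprS.
have : 0 <= (4^-1 : R) ^+ m by rewrite exprn_ge0// invr_ge0.
move: IH; set x := (4^-1 : R) ^+ m; set y := \sum_(_ <= _ < _) _; lra.
Unshelve. all: by end_near.
Qed.

(** Young's inequality [|d| <= 2^-k + 2^k d^2] makes the increments absolutely summable. *)
Lemma cvg_rapid (h : nat -> R) :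
  (\sum_(0 <= k <oo) (2 ^+ k * (h k.+1 - h k) ^+ 2)%:E < +oo)%E -> cvgn h.
Proof.
move=> hoo.
have h0 k : 0 <= 2 ^+ k * (h k.+1 - h k) ^+ 2 by rewrite mulr_ge0 ?sqr_ge0 ?exprn_ge0.
have c1 : cvgn (series (fun k => 2 ^+ k * (h k.+1 - h k) ^+ 2)).
  exact: nnseries_is_cvg.
have c2 : cvgn (series (geometric (1 : R) 2^-1)).
  by apply: is_cvg_geometric_series; rewrite ger0_norm ?invr_ge0// invf_lt1// ltr1n.
have c3 : cvgn [normed series (telescope h)].
  pose v n := 1 * 2^-1 ^+ n + 2 ^+ n * (h n.+1 - h n) ^+ 2.
  apply: (@series_le_cvg R _ v) => [n|n|n|]; rewrite /v ?mul1r.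
  - exact: normr_ge0.
  - by rewrite addr_ge0// exprn_ge0// invr_ge0.
  - rewrite [leLHS]/= /telescope exprVn; set d := h n.+1 - h n; set p := 2 ^+ n.
    have p0 : 0 < p by rewrite exprn_gt0.
    rewrite -(@real_normK _ d) ?num_real//; move: `|d| (normr_ge0 d) => {}d d0.
    rewrite -(ler_pM2l p0) mulrDr mulfV ?gt_eqF// -subr_ge0.
    suff : 0 <= (p * d - 2^-1) ^+ 2 + 3 / 4 by congr (0 <= _); field.
    by rewrite addr_ge0 ?sqr_ge0.
  - by have := is_cvgD c2 c1; rewrite -seriesD; apply.
have := normed_cvg c3; rewrite telescopeK => c4.
have -> : h = (fun n => h n - h 0%N) + cst (h 0%N).
  by apply/funext => n; rewrite fctE subrK.
by apply: is_cvgD => //; exact: is_cvg_cst.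
Qed.

(** Riesz-Fischer: a rapid subsequence converges almost everywhere, and Fatou's lemma bounds the
    distance from its limit to every late [G n]. *)
Lemma L2_complete t G : (forall n, continuous (G n)) ->
  (forall e, 0 < e -> exists N0, forall n m, (N0 <= n)%N -> (N0 <= m)%N ->
     int0 t (fun s => (G n s - G m s) ^+ 2) <= e) ->
  exists2 g, in_L2 t g & forall e, 0 < e -> exists N0, forall n, (N0 <= n)%N ->
     (L2norm t (fun s => g s - G n s)%R <= e%:E)%E.
Proof.
move=> cG cau.
(* After multiplication by the weight [2^k] of [cvg_rapid] the rate [8^-k] leaves the summable
   [4^-k]. *)
have [N HN] : {N : nat -> nat & forall k n m, (N k <= n)%N -> (N k <= m)%N ->
     int0 t (fun s => (G n s - G m s) ^+ 2) <= 8^-1 ^+ k}.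
  apply: (@choice _ _ (fun k N => forall n m, (N <= n)%N -> (N <= m)%N ->
     int0 t (fun s => (G n s - G m s) ^+ 2) <= 8^-1 ^+ k)) => k.
  by apply: cau; rewrite exprn_gt0.
(* The sum makes [M k] dominate every [N k'] with [k' <= k]; the added [k] makes it unbounded, so
   that late terms of the subsequence are late terms of [G]. *)
pose M k := (\sum_(0 <= i < k.+1) N i + k)%N.
have MN k k' : (k <= k')%N -> (N k <= M k')%N.
  move=> kk'; apply: leq_trans (leq_addr _ _).
  by rewrite (big_cat_nat (leq0n k) (leqW kk'))//= (@big_ltn _ _ _ k) ?ltnS// addnCA leq_addr.
have cB n m : continuous (fun s => G n s - G m s) by exact: contB.
have cS n m : continuous (fun s => (G n s - G m s) ^+ 2) by move=> *; exact: contM.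
pose H k := G (M k).
pose D2 k s := 2 ^+ k * (H k.+1 s - H k s) ^+ 2.
have cD2 k : continuous (D2 k) := contZ (cS (M k.+1) (M k)).
have D20 k s : 0 <= D2 k s by rewrite mulr_ge0 ?sqr_ge0 ?exprn_ge0.
have mD2 k : measurable_fun `]0, t[ (EFin \o D2 k).
  by apply/measurable_EFinP; exact: meas_cont.
have ID2 k : (\int[mu]_(s in `]0%R, t[) (D2 k s)%:E <= (4^-1 ^+ k)%:E)%E.
  have -> : (\int[mu]_(s in `]0%R, t[) (D2 k s)%:E = (int0 t (D2 k))%:E)%E.
    rewrite /int0 /Rintegral fineK//; apply: integrable_fin_num => //.
    exact: (@integrable_cont R t (D2 k)).
  rewrite lee_fin (int0Z t _ (cS (M k.+1) (M k))).
  have -> : 4^-1 = 2 * 8^-1 :> R by field.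
  rewrite exprMn ler_wpM2l ?exprn_ge0//; apply: HN; apply: MN => //.
pose S s := (\sum_(0 <= k <oo) (D2 k s)%:E)%E.
have mS : measurable_fun `]0, t[ S.
  apply: (@emeasurable_fun_cvg _ _ R _ (fun n s => \sum_(0 <= k < n) (D2 k s)%:E)%E).
    move=> m /=; rewrite (_ : (fun s => _) = EFin \o (fun s => \sum_(0 <= k < m) D2 k s)).
      apply/measurable_EFinP; apply: meas_cont; exact: cont_sum.
    by apply/funext => s /=; rewrite sumEFin.
  move=> s _; apply: (@is_cvg_nneseries R (fun k => (D2 k s)%:E)) => i _ _.
  by rewrite lee_fin.
have S0 s : (0 <= S s)%E by apply: nneseries_ge0 => i _ _; rewrite lee_fin.
have iS : mu.-integrable `]0, t[ S.
  apply/integrableP; split => //.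
  under eq_integral => s _ do rewrite gee0_abs//.
  rewrite integral_nneseries//; last by move=> i s _; rewrite lee_fin.
  apply: le_lt_trans geo4_lty; apply: lee_nneseries => i *; last exact: ID2.
  by apply: integral_ge0 => s _; rewrite lee_fin.
have [A [mA A0 nA]] : \forall x \ae mu, `]0, t[%classic x -> S x \is a fin_num.
  exact: integrable_ae.
pose B := `]0, t[%classic `\` A.
have mB : measurable B by exact: measurableD.
have cH s : B s -> cvgn (H ^~ s).
  move=> [Ds As]; apply: cvg_rapid.
  have : S s \is a fin_num by apply: contrapT => h; apply: As; apply: nA => /(_ Ds).
  by rewrite fin_numE => /andP[_]; rewrite -ltey.
(* On the null set [A] and outside the interval the limit gets the value 0. *)
pose g := (fun s => limn (H ^~ s)) \_ B.
have BD : B `<=` `]0, t[ by move=> s [].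
have mH k : measurable_fun B (H k).
  by apply: (measurable_funS _ BD) => //; exact: (meas_cont (cG (M k))).
have mg : measurable_fun `]0, t[ g.
  apply/measurable_restrict => //; rewrite setIidr//.
  apply: (@measurable_fun_cvg _ _ R _ H) => [m|s Bs]; first exact: mH.
  exact: cH.
have key n e : 0 <= e -> (exists N0, forall k, (N0 <= k)%N -> int0 t (fun s => (H k s - G n s) ^+ 2) <= e) ->
    (sqI t (fun s => g s - G n s)%R <= e%:E)%E.
  move=> e0 [N0 HN0].
  have mgG : measurable_fun `]0, t[ (EFin \o (fun s => (g s - G n s) ^+ 2)).
    by apply: meas_sqr; apply: measurable_funB => //; exact: meas_cont.
  rewrite /sqI (ge0_negligible_integral mA)//; last by move=> s _; rewrite lee_fin sqr_ge0.
  apply: (@le_trans _ _ (\int[mu]_(s in B) limn_einf (fun k => ((H k s - G n s) ^+ 2)%:E))%E).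
    rewrite le_eqVlt; apply/orP; left; apply/eqP; apply: eq_integral => s /[1!inE] Bs.
    rewrite /g patchE ifT; last by rewrite inE.
    apply/esym; apply: (cvg_limn_einf_sup _).1; apply: cvg_EFin; first by apply: nearW.
    have h : (H k s - G n s @[k --> \oo] --> limn (H^~ s) - G n s).
      by apply: cvgB; [exact: cH|exact: cvg_cst].
    exact: (cvgM h h).
  apply: (le_trans (@fatou _ _ R mu B mB (fun k s => ((H k s - G n s) ^+ 2)%:E) _ _)).
  - move=> k; apply: (measurable_funS _ BD) => //; apply: meas_sqr; exact: (meas_cont (cB (M k) n)).
  - by move=> k s _; rewrite lee_fin sqr_ge0.
  apply: (@limn_einf_le _ _ N0) => k Nk; apply: (@le_trans _ _ (sqI t (fun s => H k s - G n s))).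
    apply: ge0_subset_integral => //; first by apply: meas_sqr; exact: (meas_cont (cB (M k) n)).
    by move=> s _; rewrite lee_fin sqr_ge0.
  by rewrite (sqI_cont t (cB (M k) n)) lee_fin HN0.
have key2 e : 0 < e -> exists N0, forall n, (N0 <= n)%N ->
     (L2norm t (fun s => g s - G n s)%R <= e%:E)%E.
  move=> e0; have [N1 HN1] := cau (e ^+ 2) (exprn_gt0 _ e0); exists N1 => n Nn.
  apply: L2norm_le; first exact: ltW.
  apply: key; first by rewrite sqr_ge0.
  exists N1 => k Nk; apply: HN1 => //; apply: (leq_trans Nk).
  by rewrite /M leq_addl.
exists g => //.
have [N1 HN1] := key2 1 ltr01.
apply: in_L2P => //.
pose c := Num.sqrt (int0 t (fun s => G N1 s ^+ 2)).
have c0 : 0 <= c by exact: sqrtr_ge0.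
have Gc : (L2norm t (G N1) <= c%:E)%E.
  apply: L2norm_le => //; rewrite sqI_cont// lee_fin sqr_sqrtr//.
  by apply: int0_ge0 => s _; rewrite sqr_ge0.
have mgG : measurable_fun `]0, t[ (fun s => g s - G N1 s).
  by apply: measurable_funB => //; exact: meas_cont.
have := L2norm_triangle mgG (meas_cont (cG N1)) (HN1 N1 (leqnn _)) Gc.
under [X in L2norm t X]eq_fun do rewrite subrK.
move=> /(L2norm_ge (addr_ge0 ler01 c0)) /le_lt_trans; apply; exact: ltry.
Qed.

End Completeness.

(** * Convergence of series whose Gram matrix decays off the diagonal *)

Section SeriesL2.
Context {R : realType}.
Implicit Types (b : nat -> R) (t K B e : R) (psi : nat -> R -> R).

Lemma sum_cvg b B : (forall n, 0 <= b n) ->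
  (forall N, \sum_(0 <= n < N) b n <= B) -> cvgn (series b).
Proof.
move=> b0 bB; apply: nondecreasing_is_cvgn.
  apply/nondecreasing_seqP => n; rewrite /series/= big_nat_recr//= lerDl//.
by exists B => _ [n _ <-]; exact: bB.
Qed.

Lemma sum_tail b B : (forall n, 0 <= b n) ->
  (forall N, \sum_(0 <= n < N) b n <= B) ->
  forall e, 0 < e -> exists N0, forall p q, (N0 <= p)%N -> \sum_(p <= n < q) b n <= e.
Proof.
move=> b0 bB e e0.
have cb := sum_cvg b0 bB.
have nd : nondecreasing_seq (series b).
  apply/nondecreasing_seqP => n; rewrite /series/= big_nat_recr//= lerDl//.
have := cb; move/cvgrPdist_le => /(_ _ e0)[N0 _ H]; exists N0 => p q Np.
have [pq|qp] := leqP p q; last by rewrite big_geq ?ltW// ltnW.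
have := H p Np; have := nondecreasing_cvgn_le nd cb q.
have : series b q = series b p + \sum_(p <= n < q) b n.
  by rewrite /series/= (big_cat_nat (leq0n p) pq).
rewrite ler_norml; lra.
Qed.

Lemma int0_sqr_le t K b psi p q : (forall n, continuous (psi n)) -> 0 <= K ->
  (forall n, 0 <= b n) ->
  (forall n m, `|int0 t (fun s => psi n s * psi m s)| <= K * wt n m * b n * b m) ->
  int0 t (fun s => (\sum_(p <= n < q) psi n s) ^+ 2) <= 6 * K * \sum_(p <= n < q) b n ^+ 2.
Proof.
move=> cpsi K0 b0 H.
have -> : int0 t (fun s => (\sum_(p <= n < q) psi n s) ^+ 2) =
    \sum_(p <= n < q) \sum_(p <= m < q) int0 t (fun s => psi n s * psi m s).
  under eq_int0 => s _ do rewrite expr2 mulr_suml.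
  under eq_int0 => s _ do under eq_bigr do rewrite mulr_sumr.
  rewrite int0_sum; last by move=> n; apply: cont_sum => m; exact: contM.
  by apply: eq_bigr => n _; rewrite int0_sum// => m; exact: contM.
apply: (@le_trans _ _ (K * \sum_(p <= n < q) \sum_(p <= m < q) wt n m * b n * b m)).
  rewrite mulr_sumr; apply: ler_sum => n _; rewrite mulr_sumr; apply: ler_sum => m _.
  by apply: (le_trans (ler_norm _)); rewrite !mulrA.
by rewrite [6 * K]mulrC -mulrA ler_wpM2l// schur.
Qed.

Lemma L2_limit_le t g (c : R) : 0 <= c -> (forall e, 0 < e -> (L2norm t g <= (c + e)%:E)%E) ->
  (L2norm t g <= c%:E)%E.
Proof. by move=> c0 H; apply/lee_addgt0Pr => e e0; rewrite -EFinD H. Qed.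

(** [int0_sqr_le] on a block of indices gives the Cauchy property, and on an initial segment the
    norm bound, which the limit inherits up to an arbitrary [e]. *)
Lemma series_L2 t K B b psi : (forall n, continuous (psi n)) -> 0 <= K ->
  (forall n, 0 <= b n) ->
  (forall n m, `|int0 t (fun s => psi n s * psi m s)| <= K * wt n m * b n * b m) ->
  (forall N, \sum_(0 <= n < N) b n ^+ 2 <= B) ->
  exists g, [/\ in_L2 t g,
    forall e, 0 < e -> exists N0, forall N, (N0 <= N)%N ->
      (L2norm t (fun s => g s - \sum_(0 <= n < N) psi n s)%R <= e%:E)%E &
    (L2norm t g <= (Num.sqrt (6 * K * B))%:E)%E].
Proof.
move=> cpsi K0 b0 H bB.
pose G N s := \sum_(0 <= n < N) psi n s.
have cG N : continuous (G N) by exact: cont_sum.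
have b20 n : 0 <= b n ^+ 2 by rewrite sqr_ge0.
have [] := @L2_complete R t G cG.
  move=> e e0.
  have K1 : 0 < 6 * K + 1 by rewrite ltr_wpDl// mulr_ge0.
  have [N0 HN0] := sum_tail b20 bB (divr_gt0 e0 K1).
  have aux n m : (N0 <= n)%N -> (n <= m)%N -> int0 t (fun s => (G m s - G n s) ^+ 2) <= e.
    move=> Nn nm; have := @int0_sqr_le t K b psi n m cpsi K0 b0 H.
    have -> : (fun s => (G m s - G n s) ^+ 2) = (fun s => (\sum_(n <= i < m) psi i s) ^+ 2).
      apply/funext => s; congr (_ ^+ 2); rewrite /G (big_cat_nat (leq0n n) nm)/=.
      by rewrite addrAC subrr add0r.
    move=> /le_trans; apply; apply: (@le_trans _ _ (6 * K * (e / (6 * K + 1)))).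
      by rewrite ler_wpM2l ?mulr_ge0// HN0.
    rewrite mulrCA ger_pMr// ler_pdivrMr// mul1r; lra.
  exists N0 => n m Nn Nm; case: (leqP n m) => nm; last exact/aux/ltnW.
  by under eq_int0 => s _ do rewrite -sqrrN opprB; exact: aux.
move=> g L2g Hg; exists g; split => //.
apply: L2_limit_le; first exact: sqrtr_ge0.
move=> e e0; have [N0 /(_ N0 (leqnn _)) HN0] := Hg e e0.
have mgG : measurable_fun `]0, t[ (fun s => g s - G N0 s).
  apply: measurable_funB; first exact: in_L2_meas.
  exact: (meas_cont (cG N0)).
have Gc : (L2norm t (G N0) <= (Num.sqrt (6 * K * B))%:E)%E.
  have h : int0 t (fun s => G N0 s ^+ 2) <= 6 * K * B.
    apply: (le_trans (@int0_sqr_le t K b psi 0 N0 cpsi K0 b0 H)).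
    by rewrite ler_wpM2l ?mulr_ge0.
  apply: L2norm_le; first exact: sqrtr_ge0.
  rewrite sqI_cont// lee_fin sqr_sqrtr//.
  by apply: le_trans h; apply: int0_ge0 => s _; rewrite sqr_ge0.
have := L2norm_triangle mgG (meas_cont (cG N0)) HN0 Gc.
by under [X in L2norm t X]eq_fun do rewrite subrK; rewrite addrC.
Qed.

Lemma in_L2_norm t g : in_L2 t g -> exists2 c : R, 0 <= c & L2norm t g = c%:E.
Proof.
move=> /in_L2_lty; have := L2norm_ge0 t g; case: (L2norm t g) => [r| |]// r0 _.
by exists r.
Qed.

Lemma in_L2_mul t g k : in_L2 t g -> in_L2 t k ->
  (@lebesgue_measure R).-integrable `]0, t[ (EFin \o (fun s => k s * g s)).
Proof.
move=> L2g L2k; have [a _ ag] := in_L2_norm L2g; have [b _ bk] := in_L2_norm L2k.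
have := @L2norm_cauchy R t k g b a (in_L2_meas L2k) (in_L2_meas L2g).
by rewrite ag bk => /(_ (lexx _) (lexx _))[].
Qed.

Lemma int0_mul_lim t g k (G : nat -> R -> R) : in_L2 t g -> in_L2 t k ->
  (forall n, in_L2 t (G n)) ->
  (forall e, 0 < e -> exists N0, forall N, (N0 <= N)%N ->
      (L2norm t (fun s => g s - G N s)%R <= e%:E)%E) ->
  int0 t (fun s => k s * G N s) @[N --> \oo] --> int0 t (fun s => k s * g s).
Proof.
move=> L2g L2k L2G H; have [b b0 bk] := in_L2_norm L2k.
apply/cvgrPdist_le => e e0.
have b1 : 0 < b + 1 by rewrite ltr_wpDl.
have [N0 HN0] := H _ (divr_gt0 e0 b1); exists N0 => // N /= /HN0 {}HN0.
have mgG : measurable_fun `]0, t[ (fun s => g s - G N s).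
  by apply: measurable_funB; exact: in_L2_meas.
have := L2norm_cauchy (in_L2_meas L2k) mgG (_ : L2norm t k <= b%:E)%E HN0.
rewrite bk lexx => /(_ isT)[_].
rewrite /int0 -RintegralB//; try exact: in_L2_mul.
under eq_Rintegral do rewrite mulrBr.
move=> /le_trans; apply; rewrite mulrCA ger_pMr// ler_pdivrMr// mul1r; lra.
Qed.

End SeriesL2.

(** * The damped modes *)

Section OneMode.
Context {R : realType}.
Implicit Types (r w s t x : R).

(** [sin (w s) / w] with its limit at [w = 0]: the lowest mode is critically damped, of frequency 0,
    when [rho = 2]. *)
Definition sinc w s : R := if w == 0 then s else sin (w * s) / w.

Lemma sinc0 w : sinc w 0 = 0.
Proof. by rewrite /sinc mulr0 sin0 mul0r if_same. Qed.

Lemma der_sinc w x : is_derive x 1 (sinc w) (cos (w * x)).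
Proof.
rewrite /sinc; case: eqP => [->|/eqP w0].
  by rewrite mul0r cos0; exact: is_derive_id.
have := derZ w^-1 (der_sin w 0 x); rewrite !addr0 mulrA mulVf// mul1r.
by apply: is_derive_ext => s; rewrite addr0 mulrC.
Qed.

Lemma sin_sinc w s : sin (w * s) = w * sinc w s.
Proof.
rewrite /sinc; case: eqP => [->|/eqP w0]; first by rewrite !mul0r sin0.
by rewrite mulrCA mulfV// mulr1.
Qed.

Lemma der_cos_sinc w x : is_derive x 1 (fun s => cos (w * s)) (- w ^+ 2 * sinc w x).
Proof.
have := der_cos w 0 x; rewrite addr0 sin_sinc mulrA mulNr -expr2 -mulNr.
by apply: is_derive_ext => s; rewrite addr0.
Qed.

Lemma sincD w s t : sinc w (s + t) = sinc w s * cos (w * t) + cos (w * s) * sinc w t.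
Proof.
rewrite /sinc; case: eqP => [->|/eqP w0]; first by rewrite !mul0r cos0 mulr1 mul1r.
by rewrite mulrDr sinD; field.
Qed.

Lemma cos_sincD w s t :
  cos (w * (s + t)) = cos (w * s) * cos (w * t) - w ^+ 2 * sinc w s * sinc w t.
Proof. by rewrite mulrDr cosD !sin_sinc; ring. Qed.

Lemma cont_sinc w : continuous (sinc w).
Proof. by move=> x; exact: is_derive_cont (der_sinc w x). Qed.

Lemma cont_coslin w : continuous (fun s => cos (w * s)).
Proof. by move=> x; exact: is_derive_cont (der_cos_sinc w x). Qed.

Lemma sinc_le w s : 0 <= s -> `|sinc w s| <= s.
Proof.
move=> s0; have := @ftc2 R s (sinc w) (fun x => cos (w * x)) s0.
move=> /(_ (fun x _ => der_sinc w x) (@cont_coslin w)); rewrite sinc0 subr0 => <-.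
rewrite -[leRHS]mul1r; apply: norm_int0_le => //; first exact: cont_coslin.
by move=> x _; exact: norm_cos_le1.
Qed.

(* [SS] and [CC + r SS] are the fundamental solutions at 0 of
   [y'' + 2 r y' + (r^2 + w^2) y = 0], also when [w = 0]. *)
Definition CC r w s := expR (- r * s) * cos (w * s).
Definition SS r w s := expR (- r * s) * sinc w s.

Lemma der_exp r x : is_derive x 1 (fun s => expR (r * s)) (r * expR (r * x)).
Proof.
have := der_expR r 0 x; rewrite addr0.
by apply: is_derive_ext => s; rewrite addr0.
Qed.

Lemma der_CC r w x : is_derive x 1 (CC r w) (- r * CC r w x - w ^+ 2 * SS r w x).
Proof.
have := derM (der_exp (- r) x) (der_cos_sinc w x).
by rewrite /CC /SS => h; apply: is_derive_eq; ring.
Qed.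

Lemma der_SS r w x : is_derive x 1 (SS r w) (CC r w x - r * SS r w x).
Proof.
have := derM (der_exp (- r) x) (der_sinc w x).
by rewrite /CC /SS => h; apply: is_derive_eq; ring.
Qed.

Lemma cont_CC r w : continuous (CC r w).
Proof. by move=> x; exact: is_derive_cont (der_CC r w x). Qed.

Lemma cont_SS r w : continuous (SS r w).
Proof. by move=> x; exact: is_derive_cont (der_SS r w x). Qed.

Lemma CC0 r w : CC r w 0 = 1.
Proof. by rewrite /CC !mulr0 expR0 cos0 mulr1. Qed.

Lemma SS0 r w : SS r w 0 = 0.
Proof. by rewrite /SS sinc0 mulr0. Qed.

(** The addition formulas separate [t] from [s] in the kernels [SS (t - s)] and [CC (t - s)];
    convolutions then reduce to primitives. *)
Lemma SSD r w s t : SS r w (s + t) = SS r w s * CC r w t + CC r w s * SS r w t.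
Proof. by rewrite /SS /CC sincD (mulrDr (- r)) expRD; ring. Qed.

Lemma CCD r w s t : CC r w (s + t) = CC r w s * CC r w t - w ^+ 2 * SS r w s * SS r w t.
Proof. by rewrite /SS /CC cos_sincD (mulrDr (- r)) expRD; ring. Qed.

Lemma CC_le1 r w s : 0 <= r -> 0 <= s -> `|CC r w s| <= 1.
Proof.
move=> r0 s0; rewrite /CC normrM ger0_norm ?expR_ge0// mulr_ile1 ?expR_ge0 ?norm_cos_le1//.
by rewrite expR_le1 mulNr oppr_le0 mulr_ge0.
Qed.

Lemma expR_mulN_le1 r s : 0 <= r -> 0 <= s -> expR (- r * s) <= 1.
Proof. by move=> r0 s0; rewrite expR_le1 mulNr oppr_le0 mulr_ge0. Qed.

End OneMode.

(** * Damping rates and separation of the frequencies *)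

Section Modes.
Context {R : realType}.
Variables (alpha rho : R).
Hypotheses (alpha_ge0 : 0 <= alpha) (alpha_lt1 : alpha < 1).
Hypotheses (rho_gt0 : 0 < rho) (rho_le2 : rho <= 2).
Implicit Types (n j : nat).

Definition rr n : R := rho * mode n `^ (2 * alpha) / 2.
Definition om n : R := Num.sqrt (mode n ^+ 4 - rr n ^+ 2).

Lemma mode_ge1 n : 1 <= mode n :> R.
Proof. by rewrite /mode ler1n. Qed.

Lemma mode_gt0 n : 0 < mode n :> R.
Proof. exact: lt_le_trans (mode_ge1 n). Qed.

Lemma mode_ge0 n : 0 <= mode n :> R.
Proof. exact/ltW/mode_gt0. Qed.

Lemma powR_mode2 n : mode n `^ (2 * alpha) = (mode n ^+ 2) `^ alpha :> R.
Proof. by rewrite powRrM powR_mulrn// mode_ge0. Qed.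

Lemma rr_ge0 n : 0 <= rr n.
Proof. by rewrite /rr divr_ge0// mulr_ge0 ?powR_ge0// ltW. Qed.

Lemma powR_mode_le n : mode n `^ (2 * alpha) <= mode n ^+ 2 :> R.
Proof.
rewrite powR_mode2; apply: ler1_powR; last exact: ltW.
by rewrite exprn_ege1// mode_ge1.
Qed.

Lemma rr_le n : rr n <= mode n ^+ 2.
Proof.
have h := powR_mode_le n; have h0 := powR_ge0 (mode n : R) (2 * alpha).
rewrite /rr; move: h h0; set x := _ `^ _; set y := _ ^+ 2 => h h0.
rewrite ler_pdivrMr//; apply: (le_trans (ler_wpM2r h0 rho_le2)).
by rewrite mulrC ler_wpM2r.
Qed.

Lemma om_ge0 n : 0 <= om n.
Proof. exact: sqrtr_ge0. Qed.

Lemma om2 n : om n ^+ 2 = mode n ^+ 4 - rr n ^+ 2.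
Proof.
rewrite sqr_sqrtr// subr_ge0 (_ : 4 = 2 * 2)%N// exprM.
by rewrite lerXn2r// ?nnegrE ?rr_ge0 ?rr_le// sqr_ge0.
Qed.

Lemma om_le n : om n <= mode n ^+ 2.
Proof.
rewrite -(@ler_pXn2r _ 2)// ?nnegrE ?om_ge0 ?sqr_ge0//.
by rewrite om2 -exprM gerBl sqr_ge0.
Qed.

Lemma rr2 n : rr n ^+ 2 = rho ^+ 2 / 4 * (mode n ^+ 4) `^ alpha.
Proof.
rewrite /rr powR_mode2 (_ : mode n ^+ 4 = mode n ^+ 2 * mode n ^+ 2); last by ring.
by rewrite powRM ?sqr_ge0//; field.
Qed.

(** With [E = x^alpha] and [u = ln x], the bound [e^v >= 1 + v] at [- alpha u] and at
    [(1 - alpha) u] gives [E (1 - alpha u) <= 1] and [E (1 + (1 - alpha) u) <= x]. Weighted with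
    [1 - alpha] and [alpha], their sum is free of [u]. *)
Lemma powR_Bernoulli (x : R) : 1 <= x -> x `^ alpha <= 1 + alpha * (x - 1).
Proof.
move=> x1; have x0 : 0 < x by exact: lt_le_trans x1.
have -> : x `^ alpha = expR (alpha * ln x) by rewrite /powR gt_eqF.
have -> : x = expR (ln x) by rewrite lnK.
rewrite expRK; set u := ln x; set E := expR (alpha * u).
have E0 : 0 < E by exact: expR_gt0.
have h1 : E * (1 - alpha * u) <= 1.
  have := expR_ge1Dx (- (alpha * u)); rewrite expRN -/E => h.
  by rewrite mulrC -ler_pdivlMr// mul1r.
have h2 : E * (1 + (1 - alpha) * u) <= expR u.
  have -> : expR u = E * expR ((1 - alpha) * u) by rewrite -expRD -mulrDl subrKC mul1r.
  by rewrite ler_pM2l// expR_ge1Dx.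
have a1 : 0 <= 1 - alpha by rewrite subr_ge0 ltW.
have := lerD (ler_wpM2l alpha_ge0 h2) (ler_wpM2l a1 h1).
move=> h; rewrite -subr_ge0 in h; rewrite -subr_ge0; move: h; congr (0 <= _); ring.
Qed.

(** Bernoulli's inequality at [a / b], scaled back with [b^alpha <= b], which is where [1 <= b]
    enters. *)
Lemma powR_sub (a b : R) : 1 <= b -> b <= a -> a `^ alpha - b `^ alpha <= alpha * (a - b).
Proof.
move=> b1 ba; have b0 : 0 < b by exact: lt_le_trans b1.
have bb : b `^ alpha <= b by apply: ler1_powR => //; exact: ltW.
have aE : a = b * (a / b) by rewrite mulrCA mulfV ?mulr1// gt_eqF.
have q1 : 1 <= a / b by rewrite ler_pdivlMr// mul1r.
have -> : a `^ alpha = b `^ alpha * (a / b) `^ alpha.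
  by rewrite -powRM// ?ltW// ?(lt_le_trans ltr01 q1)// -aE.
have h := powR_Bernoulli q1.
have p0 := powR_ge0 b alpha.
have h2 : b `^ alpha * (a / b) `^ alpha <= b `^ alpha * (1 + alpha * (a / b - 1)).
  by rewrite ler_wpM2l.
have h3 : b `^ alpha * (alpha * (a / b - 1)) <= b * (alpha * (a / b - 1)).
  by rewrite ler_wpM2r// mulr_ge0// subr_ge0.
have h4 : b * (alpha * (a / b - 1)) = alpha * (a - b) by rewrite {2}aE; ring.
lra.
Qed.

Lemma mode_le n j : (j <= n)%N -> mode j <= mode n :> R.
Proof. by move=> jn; rewrite /mode ler_nat ltnS. Qed.

(** [om^2 = m^4 - r^2] and [r^2 = (rho^2 / 4) (m^4)^alpha] with [rho^2 / 4 <= 1], so the squared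
    frequencies separate by at least [1 - alpha] times the gap of the [m^4]. Division by
    [om_n + om_j <= m_n^2 + m_j^2] leaves the gap of the squares. *)
Lemma om_gap2 n j : (j <= n)%N ->
  (1 - alpha) * (mode n ^+ 2 - mode j ^+ 2) <= om n - om j.
Proof.
move=> jn; have mj := mode_ge1 j; have mn := mode_le jn.
have m0 := mode_ge0 j; have n0 := mode_ge0 n.
have j4 : 1 <= mode j ^+ 4 :> R by rewrite exprn_ege1.
have n4 : mode j ^+ 4 <= mode n ^+ 4 :> R by rewrite lerXn2r.
have n2 : mode j ^+ 2 <= mode n ^+ 2 :> R by rewrite lerXn2r.
have h := powR_sub j4 n4.
have r2 : rr n ^+ 2 - rr j ^+ 2 <= alpha * (mode n ^+ 4 - mode j ^+ 4).
  rewrite !rr2 -mulrBr.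
  have r4 : rho ^+ 2 / 4 <= 1.
    have : rho ^+ 2 <= 2 ^+ 2 by rewrite lerXn2r ?nnegrE// ltW.
    lra.
  have r0 : 0 <= rho ^+ 2 / 4 by rewrite divr_ge0 ?sqr_ge0.
  apply: (@le_trans _ _ (rho ^+ 2 / 4 * (alpha * (mode n ^+ 4 - mode j ^+ 4)))).
    by rewrite ler_wpM2l.
  by rewrite ler_piMl// mulr_ge0// subr_ge0.
have S : (1 - alpha) * (mode n ^+ 4 - mode j ^+ 4) <= (om n - om j) * (om n + om j).
  by have := om2 n; have := om2 j; move: r2; rewrite -subr_sqr; lra.
have ub : om n + om j <= mode n ^+ 2 + mode j ^+ 2 by rewrite lerD ?om_le.
have sp : 0 < mode n ^+ 2 + mode j ^+ 2 :> R by rewrite addr_gt0 ?exprn_gt0 ?mode_gt0.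
have a1 : 0 <= (1 - alpha) * (mode n ^+ 2 - mode j ^+ 2).
  by rewrite mulr_ge0 ?subr_ge0// ltW.
rewrite -(ler_pM2r sp); move: S.
have -> : mode n ^+ 4 - mode j ^+ 4 = (mode n ^+ 2 - mode j ^+ 2) * (mode n ^+ 2 + mode j ^+ 2) :> R by ring.
rewrite mulrA; set X := (1 - alpha) * _ in a1 *; set P := _ + mode j ^+ 2 in sp ub *.
set Q := om n + om j in ub *; set Y := om n - om j.
have Q0 : 0 <= Q by rewrite addr_ge0 ?om_ge0.
move=> S; have XP : 0 <= X * P by rewrite mulr_ge0// ltW.
(* Replacing [Q] by its upper bound [P] requires the sign of [Y]. If [Y] were negative, [om j] and
   hence [Q] would be positive, and [Y Q] negative. *)
have Y0 : 0 <= Y.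
  rewrite leNgt; apply/negP => Yn.
  have Q1 : 0 < Q by rewrite /Q; have := om_ge0 n; move: Yn; rewrite /Y; lra.
  have : Y * Q < 0 by rewrite (pmulr_llt0 _ Q1).
  lra.
by apply: (le_trans S); rewrite ler_wpM2l.
Qed.

End Modes.

(** * The modes as oscillating functions *)

Section ModeOscillation.
Context {R : realType}.
Variables (T alpha rho : R).
Hypotheses (T_gt0 : 0 < T) (alpha_ge0 : 0 <= alpha) (alpha_lt1 : alpha < 1).
Hypotheses (rho_gt0 : 0 < rho) (rho_le2 : rho <= 2).
Implicit Types (n m j : nat) (t s M N : R).
Local Notation rr := (rr alpha rho).
Local Notation om := (om alpha rho).

(* The lowest mode, whose frequency vanishes when rho = 2, is treated as
   non-oscillating. *)
Definition Om n : R := if n == 0%N then 0 else om n.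

Lemma Om_ge0 n : 0 <= Om n.
Proof. by rewrite /Om; case: ifP => // _; exact: om_ge0. Qed.

Lemma mode_sqr_gap n j : (j <= n)%N ->
  (n%:R - j%:R) ^+ 2 <= mode n ^+ 2 - mode j ^+ 2 :> R.
Proof.
move=> jn; have : j%:R <= n%:R :> R by rewrite ler_nat.
have : 0 <= j%:R :> R by [].
by rewrite /mode -!natr1; move: n%:R j%:R => x y; nra.
Qed.

Lemma om_gap_le n j : (j <= n)%N -> (1 - alpha) * (n%:R - j%:R) ^+ 2 <= om n - om j.
Proof.
move=> jn; have a1 : 0 <= 1 - alpha by rewrite subr_ge0 ltW.
apply: (le_trans (ler_wpM2l a1 (mode_sqr_gap jn))); exact: om_gap2.
Qed.

Lemma om_gap n j : (1 - alpha) * (n%:R - j%:R) ^+ 2 <= `|om n - om j|.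
Proof.
case: (leqP j n) => [|/ltnW] jn.
  by apply: (le_trans (om_gap_le jn)); rewrite ler_norm.
by rewrite distrC -sqrrN opprB; apply: (le_trans (om_gap_le jn)); rewrite ler_norm.
Qed.

Lemma Om_gap_le n j : (j < n)%N -> (1 - alpha) * (n%:R - j%:R) ^+ 2 <= Om n - Om j.
Proof.
move=> jn; apply: (le_trans (om_gap_le (ltnW jn))).
rewrite /Om gtn_eqF ?(leq_ltn_trans _ jn)//; case: eqP => [->|//].
by rewrite subr0 gerBl om_ge0.
Qed.

Lemma Om_gap n j : n != j -> (1 - alpha) * (n%:R - j%:R) ^+ 2 <= `|Om n - Om j|.
Proof.
case: (ltngtP j n) => // jn _.
  by apply: (le_trans (Om_gap_le jn)); rewrite ler_norm.
by rewrite distrC -sqrrN opprB; apply: (le_trans (Om_gap_le jn)); rewrite ler_norm.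
Qed.

(** [T] serves the diagonal, where no oscillation is left. Off it, [12 = 6 * 2]: 6 from [osc_mul],
    and [1 / D <= 2 / (1 + D)] for a squared distance [D >= 1]. *)
Definition gramK : R := T + 12 / (1 - alpha).

Lemma gramK_ge0 : 0 <= gramK.
Proof. by rewrite addr_ge0 ?divr_ge0// ?subr_ge0 ltW. Qed.

Lemma osc_gram t M N n m f h : 0 <= t <= T -> osc t M (Om n) f -> osc t N (Om m) h ->
  `|int0 t (fun s => f s * h s)| <= gramK * wt n m * M * N.
Proof.
move=> /andP[t0 tT] of_ oh; have M0 := osc_ge0 t0 of_; have N0 := osc_ge0 t0 oh.
have MN : 0 <= M * N by rewrite mulr_ge0.
have a1 : 0 < 1 - alpha by rewrite subr_gt0.
case: (eqVneq n m) => [nm|nm].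
  apply: (le_trans (osc_mul_diag t0 of_ oh)).
  rewrite nm wt_nn mulr1 -[leRHS]mulrA [leRHS]mulrC ler_wpM2l//.
  by rewrite /gramK (le_trans tT)// lerDl divr_ge0// ltW.
have d1 : 1 <= (n%:R - m%:R) ^+ 2 :> R.
  rewrite dist_sqr exprn_ege1// ler1n /dist; move: nm; lia.
have gap := Om_gap nm.
set D := (n%:R - m%:R) ^+ 2 in d1 gap *.
have D0 : 0 < D by exact: lt_le_trans d1.
have gap0 : 0 < `|Om n - Om m| by apply: lt_le_trans gap; rewrite mulr_gt0.
have neq : Om n != Om m by rewrite -subr_eq0 -normr_gt0.
apply: (le_trans (osc_mul t0 (Om_ge0 n) (Om_ge0 m) neq of_ oh)).
apply: (@le_trans _ _ (6 * M * N / ((1 - alpha) * D))).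
  apply: ler_wpM2l; first by rewrite -mulrA mulr_ge0.
  by rewrite lef_pV2 ?posrE// mulr_gt0.
rewrite /gramK /wt -/D.
have -> : (T + 12 / (1 - alpha)) / (1 + D) * M * N =
   (M * N) * ((T + 12 / (1 - alpha)) / (1 + D)) by ring.
have -> : 6 * M * N / ((1 - alpha) * D) = (M * N) * (6 / (1 - alpha) / D).
  by rewrite invfM; ring.
rewrite ler_wpM2l// ler_pdivlMr ?addr_gt0//.
apply: (@le_trans _ _ (12 / (1 - alpha))); last by rewrite lerDr ltW.
have -> : 12 / (1 - alpha) = 6 / (1 - alpha) * 2 by ring.
rewrite -[leLHS]mulrA; apply: ler_wpM2l; first by rewrite divr_ge0// ltW.
by rewrite mulrC ler_pdivrMr//; lra.
Qed.

Lemma der_rev F (d t s : R) : is_derive (t - s) 1 F d ->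
  is_derive s 1 (fun u => F (t - u)) (- d).
Proof.
move=> dF; have h := derB (der_cst t s) (is_derive_id s (1 : R)).
by have := @der_comp R F (fun u => t - u) s d (0 - 1) dF h; rewrite sub0r mulrN1.
Qed.

Lemma cont_rev (f : R -> R) t : continuous f -> continuous (fun s => f (t - s)).
Proof.
move=> cf s; apply: continuous_comp; last exact: cf.
by apply: cvgB; [exact: cvg_cst | exact: cvg_id].
Qed.

(** Nondecreasing with values in [[0, 1]], hence of variation at most 1 however large the rate
    [r]. *)
Lemma BV_exp r t : 0 <= r -> 0 <= t -> BV t 1 (fun s => expR (r * s + - (r * t))).
Proof.
move=> r0 t0; exists (fun s => r * expR (r * s + - (r * t))).
have c : continuous (fun s => r * expR (r * s + - (r * t))).
  by apply: contZ; exact: cont_expR.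
split; [split => //; move=> x; exact: der_expR | |].
  move=> s /andP[s0 st]; rewrite ger0_norm ?expR_ge0// expR_le1 -mulrBr.
  by rewrite mulr_ge0_le0// subr_le0.
under eq_int0 => s _ do rewrite ger0_norm ?mulr_ge0 ?expR_ge0//.
rewrite (ftc2 t0 (fun x _ => der_expR r (- (r * t)) x) c).
by rewrite subrr expR0 gerBl expR_ge0.
Qed.

Lemma BV_scale t M c F : 0 <= t -> BV t M F -> BV t (`|c| * M) (fun s => c * F s).
Proof.
move=> t0 [f [[dF cf] bF bf]]; exists (fun s => c * f s); split.
- by split; [move=> x; exact: derZ | exact: contZ].
- by move=> s st; rewrite normrM ler_wpM2l// bF.
- under eq_int0 => s _ do rewrite normrM.
  by rewrite int0Z ?ler_wpM2l//; exact: cont_norm.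
Qed.

Lemma BV_C1 t A F f : 0 <= t <= T -> 0 <= A -> C1 F f ->
  (forall s, 0 <= s <= t -> `|F s| <= A) ->
  (forall s, 0 <= s <= t -> `|f s| <= A) -> BV t (A + A * T) F.
Proof.
move=> /andP[t0 tT] A0 CF bF bf; exists f; split => //.
  by move=> s /bF /le_trans; apply; rewrite lerDl mulr_ge0// ltW.
apply: (@le_trans _ _ (A * t)).
  apply: (le_trans (ler_norm _)); apply: norm_int0_le => //.
    by apply: cont_norm; case: CF.
  by move=> s /andP[/ltW s0 /ltW st]; rewrite normr_id bf// s0.
by rewrite (@le_trans _ _ (A * T))// ?ler_wpM2l// lerDr.
Qed.

(** A common bound: [2 / (1 - alpha)] dominates [m^2 / om] above the lowest mode, and the remaining
    terms dominate the lowest mode, estimated by its C^1 norm. *)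
Definition modeM : R := 2 / (1 - alpha) + 3 + 3 * T + (1 + 2 * T) * T.

(** The gap to the lowest mode is at least [(1 - alpha) (m^2 - 1)], and [m^2 - 1 >= m^2 / 2] for
    [m >= 2]. *)
Lemma om_lower n : (0 < n)%N -> mode n ^+ 2 / om n <= 2 / (1 - alpha) /\ 0 < om n.
Proof.
move=> n0; have a1 : 0 < 1 - alpha by rewrite subr_gt0.
have h : (1 - alpha) * (mode n ^+ 2 - mode 0 ^+ 2) <= om n - om 0 by exact: om_gap2.
have o0 := om_ge0 alpha rho 0.
have m2 : 2 <= mode n :> R by rewrite /mode ler_nat.
have m1 : mode 0 = 1 :> R by [].
rewrite m1 expr1n in h.
have h2 : (1 - alpha) * (mode n ^+ 2 / 2) <= om n.
  apply: (@le_trans _ _ ((1 - alpha) * (mode n ^+ 2 - 1))).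
    by rewrite ler_pM2l//; move: m2; move: (mode n : R) => x; nra.
  by move: h o0; lra.
have mp : 0 < mode n ^+ 2 / 2 :> R by rewrite divr_gt0// exprn_gt0// mode_gt0.
have omp : 0 < om n by apply: lt_le_trans h2; rewrite mulr_gt0.
split => //; rewrite ler_pdivrMr// mulrAC ler_pdivlMr//; move: h2; lra.
Qed.

Lemma SS_le r w s : 0 <= r -> 0 <= s -> `|SS r w s| <= s.
Proof.
move=> r0 s0; rewrite /SS normrM ger0_norm ?expR_ge0//.
rewrite -[leRHS]mul1r ler_pM ?expR_ge0//; last exact: sinc_le.
exact: expR_mulN_le1.
Qed.

Lemma normB_le (x c y d a b : R) : 0 <= x <= 1 -> 0 <= y <= 1 ->
  `|c| <= a -> `|d| <= b -> `|x * c - y * d| <= a + b.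
Proof.
move=> /andP[x0 x1] /andP[y0 y1] ca db.
apply: (le_trans (ler_normB _ _)); rewrite !normrM (ger0_norm x0) (ger0_norm y0).
by rewrite -[a]mul1r -[b]mul1r; apply: lerD; apply: ler_pM.
Qed.

Lemma mode0_le n : n = 0%N -> rr n <= 1 /\ om n <= 1.
Proof.
move=> ->; have := rr_le alpha_lt1 rho_le2 0; have := om_le alpha_lt1 rho_gt0 rho_le2 0.
by rewrite /mode expr1n.
Qed.

(** As a function of [s] the damping factor is an increasing exponential, of variation at most 1.
    The lowest mode, with rate and frequency at most 1, is taken whole as an amplitude of frequency
    0. *)
Lemma osc_CC n t : 0 <= t <= T ->
  osc t modeM (Om n) (fun s => CC (rr n) (om n) (t - s)).
Proof.
move=> /[dup] tT /andP[t0 tT'].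
have a1 : 0 < 1 - alpha by rewrite subr_gt0.
have T0 := ltW T_gt0.
have aM : 0 <= 2 / (1 - alpha) by rewrite divr_ge0 ?ltW.
have r0 := rr_ge0 alpha rho_gt0 n.
case: (posnP n) => [n0|n0]; last first.
  exists (fun s => expR (rr n * s + - (rr n * t))).
    apply: BV_M (BV_exp r0 t0) => //; rewrite /modeM.
    have : 0 <= (1 + 2 * T) * T by rewrite mulr_ge0// addr_ge0// mulr_ge0.
    lra.
  exists (- (om n * t)) => s; rewrite /Om gtn_eqF// /CC.
  congr (expR _ * _); first by ring.
  by rewrite -cosN; congr (cos _); ring.
exists (fun s => CC (rr n) (om n) (t - s)); last first.
  by exists 0 => s; rewrite /Om n0 eqxx mul0r addr0 cos0 mulr1.
have [rle ole] := mode0_le n0.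
rewrite (_ : modeM = (1 + T) + (1 + T) * T + (2 / (1 - alpha) + 2 + 2 * T + T * T)); last first.
  by rewrite /modeM; ring.
have A0 : 0 <= 1 + T by rewrite addr_ge0.
apply: (BV_M (M := (1 + T) + (1 + T) * T)) => //.
  by rewrite lerDl !addr_ge0// mulr_ge0.
apply: (BV_C1 (f := fun s => - (- rr n * CC (rr n) (om n) (t - s) - om n ^+ 2 * SS (rr n) (om n) (t - s)))) => //.
- split; first by move=> x; apply: der_rev; exact: der_CC.
  move=> x; apply: cvgN; move: x; apply: contB.
    by apply: contZ; apply: cont_rev; exact: cont_CC.
  by apply: contZ; apply: cont_rev; exact: cont_SS.
- move=> s /andP[s0 st]; apply: (@le_trans _ _ 1); last by rewrite lerDl.
  by apply: CC_le1 => //; rewrite subr_ge0.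
- move=> s /andP[s0 st]; have ts0 : 0 <= t - s by rewrite subr_ge0.
  have tsT : t - s <= T by lra.
  rewrite mulNr -opprD opprK; have := @normB_le (rr n) (CC (rr n) (om n) (t - s))
    (om n ^+ 2) (- SS (rr n) (om n) (t - s)) 1 T.
  rewrite mulrN opprK normrN; apply; rewrite ?r0 ?sqr_ge0//.
  - by rewrite exprn_ile1// om_ge0.
  - exact: CC_le1.
  - exact: le_trans (SS_le _ r0 ts0) tsT.
Qed.

(** The factor [m^2] is the largest that the division by [om] in [sinc] can absorb. *)
Lemma osc_SS n t : 0 <= t <= T ->
  osc t modeM (Om n) (fun s => mode n ^+ 2 * SS (rr n) (om n) (t - s)).
Proof.
move=> /[dup] tT /andP[t0 tT'].
have a1 : 0 < 1 - alpha by rewrite subr_gt0.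
have T0 := ltW T_gt0.
have aM : 0 <= 2 / (1 - alpha) by rewrite divr_ge0 ?ltW.
have r0 := rr_ge0 alpha rho_gt0 n.
case: (posnP n) => [n0|n0]; last first.
  have [ml o0] := om_lower n0.
  exists (fun s => mode n ^+ 2 / om n * expR (rr n * s + - (rr n * t))).
    apply: BV_M (BV_scale (mode n ^+ 2 / om n) t0 (BV_exp r0 t0)) => //.
    rewrite mulr1 ger0_norm; last by rewrite divr_ge0 ?sqr_ge0// ltW.
    apply: (le_trans ml); rewrite /modeM -!addrA lerDl !addr_ge0// ?mulr_ge0//.
    by rewrite addr_ge0// mulr_ge0.
  exists (pi / 2 - om n * t) => s; rewrite /Om gtn_eqF// /SS /sinc gt_eqF//.
  rewrite -cosBpihalf -cosN.
  have -> : - rr n * (t - s) = rr n * s + - (rr n * t) by ring.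
  have -> : - (om n * (t - s) - pi / 2) = om n * s + (pi / 2 - om n * t) by ring.
  by ring.
exists (fun s => mode n ^+ 2 * SS (rr n) (om n) (t - s)); last first.
  by exists 0 => s; rewrite /Om n0 eqxx mul0r addr0 cos0 mulr1.
have [rle ole] := mode0_le n0.
have -> : mode n ^+ 2 = 1 :> R by rewrite n0 /mode expr1n.
rewrite (_ : modeM = (1 + T) + (1 + T) * T + (2 / (1 - alpha) + 2 + 2 * T + T * T)); last first.
  by rewrite /modeM; ring.
have A0 : 0 <= 1 + T by rewrite addr_ge0.
apply: (BV_M (M := (1 + T) + (1 + T) * T)) => //.
  by rewrite lerDl !addr_ge0// mulr_ge0.
apply: (@BV_C1 _ _ _ (fun s => 1 * - (CC (rr n) (om n) (t - s) - rr n * SS (rr n) (om n) (t - s))) tT A0).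
- split; first by move=> x; apply: derZ; apply: der_rev; exact: der_SS.
  apply: contZ => x; apply: cvgN; move: x; apply: contB.
    by apply: cont_rev; exact: cont_CC.
  by apply: contZ; apply: cont_rev; exact: cont_SS.
- move=> s /andP[s0 st]; have ts0 : 0 <= t - s by rewrite subr_ge0.
  rewrite mul1r; apply: (le_trans (SS_le _ r0 ts0)); lra.
- move=> s /andP[s0 st]; have ts0 : 0 <= t - s by rewrite subr_ge0.
  have tsT : t - s <= T by lra.
  rewrite mul1r normrN -[CC _ _ _]mul1r; apply: normB_le; rewrite ?ler01 ?lexx ?r0//.
    exact: CC_le1.
  exact: le_trans (SS_le _ r0 ts0) tsT.
Qed.

End ModeOscillation.

(** * Annihilating oscillations by translations *)

Section Translations.
Context {R : realType}.
Implicit Types (f g F : R -> R) (s u t T h b l A B M x w phi : R).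

Lemma lipschitz_cont A f : (forall s u, `|f s - f u| <= A * `|s - u|) -> continuous f.
Proof.
move=> L s; apply/cvgrPdist_le => e e0; near=> u.
have A1 : 0 < `|A| + 1 by rewrite ltr_wpDl.
apply: (le_trans (L s u)).
apply: (@le_trans _ _ ((`|A| + 1) * (e / (`|A| + 1)))); last by rewrite mulrCA mulfV ?mulr1 ?gt_eqF.
apply: (@le_trans _ _ ((`|A| + 1) * `|s - u|)).
  by rewrite ler_wpM2r// (le_trans (ler_norm _))// lerDl.
rewrite ler_pM2l//; near: u; apply: cvgr_dist_le; first exact: cvg_id.
by rewrite divr_gt0.
Unshelve. all: by end_near.
Qed.

Lemma deriv_quad f s d A :
  (forall u, `|f u - f s - (u - s) * d| <= A * (u - s) ^+ 2) -> is_derive s 1 f d.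
Proof.
move=> H; apply/is_derive1_caratheodory.
exists (fun u => if u == s then d else (f u - f s) / (u - s)); split.
- move=> z; case: eqP => [->|/eqP zs]; first by rewrite !subrr mulr0.
  by rewrite divfK// subr_eq0.
- apply/cvgrPdist_le => e e0; near=> u; rewrite eqxx; case: eqP => [|/eqP us].
    by rewrite subrr normr0 ltW.
  have us0 : 0 < `|u - s| by rewrite normr_gt0 subr_eq0.
  rewrite distrC -(ler_pM2r us0) -normrM mulrBl divfK ?subr_eq0//.
  rewrite (mulrC d); apply: (le_trans (H u)).
  have : `|u - s| <= e / (`|A| + 1).
    by rewrite distrC; near: u; apply: cvgr_dist_le; [exact: cvg_id | rewrite divr_gt0// ltr_wpDl].
  have A1 : 0 < `|A| + 1 by rewrite ltr_wpDl.
  rewrite ler_pdivlMr// -[(u - s) ^+ 2]real_normK ?num_real//; move: us0 (ler_norm A).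
  move: `|u - s| `|A| => v B v0 AB h.
  rewrite expr2 mulrA ler_pM2r//; apply: le_trans h.
  by rewrite mulrC ler_pM2l// (le_trans AB)// lerDl.
- by rewrite eqxx.
Unshelve. all: by end_near.
Qed.

Lemma int0_gt0 T f a b : continuous f -> (forall s, 0 <= f s) -> 0 <= a -> a < b -> b <= T ->
  (forall s, a < s < b -> 0 < f s) -> 0 < int0 T f.
Proof.
move=> cf f0 a0 ab bT fab; have [F dF] := primitive (-1) cf.
have m1 x : 0 <= x -> -1 < x by apply: lt_le_trans; rewrite ltrN10.
have T0 : 0 <= T by apply: le_trans bT; apply: le_trans a0 _; exact: ltW.
have -> : int0 T f = F T - F 0.
  by apply: ftc2 => // x /andP[/m1 + _]; exact: dF.
have mono x y : 0 <= x -> x <= y -> F x <= F y.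
  move=> x0 xy; have [||c _] := @MVT_segment R F f x y xy.
  - by move=> z; rewrite in_itv/= => /andP[/ltW xz _]; apply: dF; apply: m1; exact: le_trans xz.
  - apply/subspace_continuousP => z /=; rewrite in_itv/= => /andP[xz _].
    by apply: cvg_within_filter; apply: is_derive_cont (dF z (m1 _ (le_trans x0 xz))).
  by move=> h; rewrite -subr_ge0 h mulr_ge0// subr_ge0.
have [||c] := @MVT R F f a b ab.
- by move=> z; rewrite in_itv/= => /andP[/ltW xz _]; apply: dF; apply: m1; exact: le_trans xz.
- apply/subspace_continuousP => z /=; rewrite in_itv/= => /andP[xz _].
  by apply: cvg_within_filter; apply: is_derive_cont (dF z (m1 _ (le_trans a0 xz))).
rewrite in_itv/= => /fab fc h.
have : 0 < F b - F a by rewrite h mulr_gt0// subr_gt0.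
have := mono 0 a (lexx _) a0; have := mono b T (le_trans a0 (ltW ab)) bT; lra.
Qed.

Definition supp h b f := forall s, s <= h \/ b <= s -> f s = 0.

Lemma supp_le h b b' f : b <= b' -> supp h b f -> supp h b' f.
Proof.
move=> bb' H s [sh|bs]; apply: H; [by left|right; exact: le_trans bs].
Qed.

Lemma cont_shift g (k : R) : continuous g -> continuous (fun s => g (s + k)).
Proof.
by move=> cg s; apply: continuous_comp; [apply: cvgD; [exact: cvg_id|exact: cvg_cst]|exact: cg].
Qed.

(** The translated support stays inside [[0, T]], so no mass is lost: a primitive of
    [f s * g (s + l)] is constant off the support, which absorbs the shift of the end points. *)
Lemma int0_shift T h b l f g : 0 <= h -> h <= T -> 0 <= l -> b + l <= T -> supp h b f ->
  continuous f -> continuous g ->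
  int0 T (fun s => f (s - l) * g s) = int0 T (fun s => f s * g (s + l)).
Proof.
move=> h0 hT l0 bT sf cf cg; have T0 := le_trans h0 hT.
have cgl := cont_shift (k := l) cg; have cfl := cont_shift (k := - l) cf.
have c1 := contM cf cgl; have c2 := contM cfl cg.
have [F dF] := primitive (- l - 1) c1.
have dG x : - 1 < x -> is_derive x 1 (fun s => F (s - l)) (f (x - l) * g x).
  move=> x0; have hd := derB (is_derive_id x (1 : R)) (der_cst l x).
  have xl : - l - 1 < x - l by lra.
  have := @der_comp R F (fun u => u - l) x _ _ (dF (x - l) xl) hd.
  by rewrite subrK subr0 mulr1.
have -> : int0 T (fun s => f (s - l) * g s) = F (T - l) - F (0 - l).
  by apply: (ftc2 (F := fun s => F (s - l))) => // x /andP[x0 _]; apply: dG; lra.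
have -> : int0 T (fun s => f s * g (s + l)) = F T - F 0.
  by apply: ftc2 => // x /andP[x0 _]; apply: dF; lra.
have const x y : - l - 1 < x -> x <= y -> (forall z, x <= z <= y -> f z = 0) -> F x = F y.
  move=> x0 xy fz; have [||c] := @MVT_segment R F (fun s => f s * g (s + l)) x y xy.
  - by move=> z; rewrite in_itv/= => /andP[xz _]; apply: dF; lra.
  - apply/subspace_continuousP => z /=; rewrite in_itv/= => /andP[xz _].
    by apply: cvg_within_filter; apply: is_derive_cont (dF z (lt_le_trans x0 xz)).
  by rewrite in_itv/= => /fz -> /eqP; rewrite !mul0r subr_eq0 => /eqP.
congr (_ - _).
  apply: const; [lra|lra|] => z /andP[z1 _]; apply: sf; right; lra.
rewrite sub0r; apply: const; [lra|lra|] => z /andP[_ z1]; apply: sf; left; lra.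
Qed.

(* [f] is of class C^1 with Lipschitz derivative [f'], in a form that passes to
   pointwise limits. *)
Record nice A f f' : Prop := Nice {
  nice_bnd : forall s, `|f s| <= A;
  nice_bnd' : forall s, `|f' s| <= A;
  nice_lip : forall s u, `|f s - f u| <= A * `|s - u|;
  nice_lip' : forall s u, `|f' s - f' u| <= A * `|s - u|;
  nice_quad : forall s u, `|f u - f s - (u - s) * f' s| <= A * (u - s) ^+ 2 }.

Lemma nice_cont A f f' : nice A f f' -> continuous f.
Proof. by move=> [_ _ + _ _]; exact: lipschitz_cont. Qed.

Lemma nice_C1 A f f' : nice A f f' -> C1 f f'.
Proof.
move=> [_ _ _ h4 h5]; split; last exact: lipschitz_cont h4.
by move=> x; apply: (@deriv_quad f x (f' x) A) => u; exact: h5.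
Qed.

Definition op3 (a b c l : R) f s : R := a * f s + b * f (s - l) + c * f (s - 2 * l).

Lemma norm_lin3 (a b c X Y Z B : R) : `|X| <= B -> `|Y| <= B -> `|Z| <= B ->
  `|a * X + b * Y + c * Z| <= (`|a| + `|b| + `|c|) * B.
Proof.
move=> XB YB ZB; rewrite !mulrDl; apply: (le_trans (ler_normD _ _)).
apply: lerD; last by rewrite normrM ler_wpM2l.
by apply: (le_trans (ler_normD _ _)); apply: lerD; rewrite normrM ler_wpM2l.
Qed.

Lemma nice_op3 (a b c l : R) A f f' : nice A f f' ->
  nice ((`|a| + `|b| + `|c|) * A) (op3 a b c l f) (op3 a b c l f').
Proof.
move=> [h1 h2 h3 h4 h5]; split => [s|s|s u|s u|s u]; rewrite /op3.
- exact: norm_lin3.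
- exact: norm_lin3.
- have -> : a * f s + b * f (s - l) + c * f (s - 2 * l) - (a * f u + b * f (u - l) + c * f (u - 2 * l)) =
    a * (f s - f u) + b * (f (s - l) - f (u - l)) + c * (f (s - 2 * l) - f (u - 2 * l)) by ring.
  rewrite -mulrA; apply: norm_lin3 => //.
    by apply: (le_trans (h3 _ _)); rewrite (_ : s - l - (u - l) = s - u)//; ring.
  by apply: (le_trans (h3 _ _)); rewrite (_ : s - 2 * l - (u - 2 * l) = s - u)//; ring.
- have -> : a * f' s + b * f' (s - l) + c * f' (s - 2 * l) - (a * f' u + b * f' (u - l) + c * f' (u - 2 * l)) =
    a * (f' s - f' u) + b * (f' (s - l) - f' (u - l)) + c * (f' (s - 2 * l) - f' (u - 2 * l)) by ring.
  rewrite -mulrA; apply: norm_lin3 => //.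
    by apply: (le_trans (h4 _ _)); rewrite (_ : s - l - (u - l) = s - u)//; ring.
  by apply: (le_trans (h4 _ _)); rewrite (_ : s - 2 * l - (u - 2 * l) = s - u)//; ring.
- have -> : a * f u + b * f (u - l) + c * f (u - 2 * l) - (a * f s + b * f (s - l) + c * f (s - 2 * l))
     - (u - s) * (a * f' s + b * f' (s - l) + c * f' (s - 2 * l)) =
    a * (f u - f s - (u - s) * f' s) + b * (f (u - l) - f (s - l) - (u - s) * f' (s - l))
    + c * (f (u - 2 * l) - f (s - 2 * l) - (u - s) * f' (s - 2 * l)) by ring.
  rewrite -mulrA; apply: norm_lin3 => //.
    by have := h5 (s - l) (u - l); rewrite (_ : u - l - (s - l) = u - s)//; ring.
  by have := h5 (s - 2 * l) (u - 2 * l); rewrite (_ : u - 2 * l - (s - 2 * l) = u - s)//; ring.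
Qed.

Lemma supp_op3 h b (a1 a2 a3 l : R) f : 0 <= l -> supp h b f ->
  supp h (b + 2 * l) (op3 a1 a2 a3 l f).
Proof.
move=> l0 sf s [sh|bs]; rewrite /op3 !sf ?mulr0 ?addr0//; (try by left; lra); by right; lra.
Qed.

(** Coefficients of sum 1 reproduce constants, so [f] moves only by its Lipschitz constant times the
    translation length. This is what lets infinitely many operators be composed. *)
Lemma op3_close (a1 a2 a3 l : R) A f s : 0 <= l -> 0 <= A ->
  (forall s u, `|f s - f u| <= A * `|s - u|) -> a1 + a2 + a3 = 1 ->
  `|op3 a1 a2 a3 l f s - f s| <= (`|a1| + `|a2| + `|a3|) * A * (2 * l).
Proof.
move=> l0 A0 h3 a1E.
have -> : op3 a1 a2 a3 l f s - f s =
  a1 * 0 + a2 * (f (s - l) - f s) + a3 * (f (s - 2 * l) - f s).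
  by rewrite /op3 -[X in _ - X]mul1r -a1E; ring.
rewrite -mulrA; apply: norm_lin3.
- by rewrite normr0 !mulr_ge0.
- apply: (le_trans (h3 _ _)); rewrite ler_wpM2l// (_ : s - l - s = - l); last by ring.
  rewrite normrN ger0_norm//; lra.
- apply: (le_trans (h3 _ _)); rewrite ler_wpM2l// (_ : s - 2 * l - s = - (2 * l)); last by ring.
  by rewrite normrN ger0_norm// mulr_ge0.
Qed.

(** The adjoint operator translates the test function the other way; annihilating a test function
    there annihilates its integral against the window. *)
Lemma int0_op3 T h b (a1 a2 a3 l : R) f g : 0 <= h -> h <= T -> 0 <= l -> b + 2 * l <= T ->
  supp h b f -> continuous f -> continuous g ->
  int0 T (fun s => op3 a1 a2 a3 l f s * g s) =
  int0 T (fun s => f s * (a1 * g s + a2 * g (s + l) + a3 * g (s + 2 * l))).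
Proof.
move=> h0 hT l0 bT sf cf cg; have ll : 0 <= 2 * l by rewrite mulr_ge0.
have bl : b + l <= T by lra.
have cD k := cont_shift (k := k) cg; have cS k := cont_shift (k := - k) cf.
have i1 := contM cf cg; have i2 := contM (cS l) cg; have i3 := contM (cS (2 * l)) cg.
have j2 := contM cf (cD l); have j3 := contM cf (cD (2 * l)).
have lin3 (u v w : R -> R) : continuous u -> continuous v -> continuous w ->
    a1 * int0 T u + a2 * int0 T v + a3 * int0 T w =
    int0 T (fun s => a1 * u s + a2 * v s + a3 * w s).
  move=> cu cv cw; have ku := contZ (c := a1) cu; have kv := contZ (c := a2) cv; have kw := contZ (c := a3) cw.
  have kuv := contD ku kv.
  by rewrite int0D// int0D// !int0Z.
transitivity (a1 * int0 T (fun s => f s * g s) + a2 * int0 T (fun s => f (s - l) * g s)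
   + a3 * int0 T (fun s => f (s - 2 * l) * g s)).
  by rewrite lin3//; apply: eq_int0 => s _; rewrite /op3; ring.
rewrite (int0_shift h0 hT l0 bl sf cf cg) (int0_shift h0 hT ll bT sf cf cg).
by rewrite lin3//; apply: eq_int0 => s _; ring.
Qed.

End Translations.

(** * Annihilation of damped oscillations *)

Section Kill.
Context {R : realType}.
Implicit Types (f g F : R -> R) (s u t T h b l A B M x w phi th : R).

Lemma int0_lin3 T (a1 a2 a3 : R) (u v w : R -> R) :
  continuous u -> continuous v -> continuous w ->
  int0 T (fun s => a1 * u s + a2 * v s + a3 * w s) =
  a1 * int0 T u + a2 * int0 T v + a3 * int0 T w.
Proof.
move=> cu cv cw; have ku := contZ (c := a1) cu; have kv := contZ (c := a2) cv.
have kw := contZ (c := a3) cw; have kuv := contD ku kv.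
by rewrite int0D// int0D// !int0Z.
Qed.

Definition expcos x w phi s : R := expR (x * s) * cos (w * s + phi).

Lemma cont_expcos x w phi : continuous (expcos x w phi).
Proof.
apply: contM; last exact: cont_cos.
by move=> s; exact: is_derive_cont (der_exp x s).
Qed.

Lemma expcosD x w phi s l :
  expcos x w phi (s + l) = expR (x * l) * expcos x w (w * l + phi) s.
Proof.
rewrite /expcos mulrDr expRD mulrA (mulrC (expR (x * l))); congr (_ * cos _); ring.
Qed.

(** All phases at once: a translation of [expcos] changes its phase, so only the statement for every
    [phi] is stable under [op3]. *)
Definition kill T x w f := forall phi, int0 T (fun s => f s * expcos x w phi s) = 0.
(** The extra factor [s] comes from the second solution at a double characteristic root; it occurs
    when integrating against the critically damped mode. *)
Definition kill2 T x w f := forall phi, int0 T (fun s => f s * (s * expcos x w phi s)) = 0.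

Section Op.
Variables (T h b l a1 a2 a3 : R) (f : R -> R).
Hypotheses (h0 : 0 <= h) (hT : h <= T) (l0 : 0 <= l) (bT : b + 2 * l <= T).
Hypotheses (sf : supp h b f) (cf : continuous f).

Lemma kill_op3 x w : kill T x w f -> kill T x w (op3 a1 a2 a3 l f).
Proof.
move=> kf phi; rewrite (int0_op3 a1 a2 a3 h0 hT l0 bT sf cf (@cont_expcos x w phi)).
have cfe p : continuous (fun s => f s * expcos x w p s).
  by apply: contM => //; exact: cont_expcos.
transitivity (int0 T (fun s => a1 * (f s * expcos x w phi s) +
   (a2 * expR (x * l)) * (f s * expcos x w (w * l + phi) s) +
   (a3 * expR (x * (2 * l))) * (f s * expcos x w (w * (2 * l) + phi) s))).
  by apply: eq_int0 => s _; rewrite !expcosD; ring.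
by rewrite int0_lin3// !kf !mulr0 !addr0.
Qed.

Lemma cont_id_expcos x w phi : continuous (fun s => s * expcos x w phi s).
Proof. by apply: contM; [move=> ?; exact: cvg_id | exact: cont_expcos]. Qed.

(** Translating [s * expcos] produces additional multiples of [expcos] with factors [l] and [2 l],
    which the simple annihilation removes. *)
Lemma kill2_op3_gen x w phi :
  kill T x w f ->
  int0 T (fun s => op3 a1 a2 a3 l f s * (s * expcos x w phi s)) =
  int0 T (fun s => f s * (s * (a1 * expcos x w phi s + a2 * expcos x w phi (s + l)
     + a3 * expcos x w phi (s + 2 * l)))).
Proof.
move=> kf; rewrite (int0_op3 a1 a2 a3 h0 hT l0 bT sf cf (@cont_id_expcos x w phi)).
have cfe p : continuous (fun s => f s * expcos x w p s).
  by apply: contM => //; exact: cont_expcos.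
have cfs : continuous (fun s => f s * (s * (a1 * expcos x w phi s + a2 * expcos x w phi (s + l)
     + a3 * expcos x w phi (s + 2 * l)))).
  apply: contM => //; apply: contM; first by move=> ?; exact: cvg_id.
  have cD k := cont_shift (k := k) (@cont_expcos x w phi).
  by apply: contD; [apply: contD|]; apply: contZ => //; exact: cont_expcos.
transitivity (int0 T (fun s =>
   1 * (f s * (s * (a1 * expcos x w phi s + a2 * expcos x w phi (s + l)
     + a3 * expcos x w phi (s + 2 * l)))) +
   (a2 * l * expR (x * l)) * (f s * expcos x w (w * l + phi) s) +
   (a3 * (2 * l) * expR (x * (2 * l))) * (f s * expcos x w (w * (2 * l) + phi) s))).
  by apply: eq_int0 => s _; rewrite !expcosD; ring.
by rewrite int0_lin3// !kf !mulr0 !addr0 mul1r.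
Qed.

Lemma kill2_op3 x w : kill T x w f -> kill2 T x w f -> kill2 T x w (op3 a1 a2 a3 l f).
Proof.
move=> kf kf2 phi; rewrite kill2_op3_gen//.
have cfe p : continuous (fun s => f s * (s * expcos x w p s)).
  by apply: contM => //; exact: cont_id_expcos.
transitivity (int0 T (fun s => a1 * (f s * (s * expcos x w phi s)) +
   (a2 * expR (x * l)) * (f s * (s * expcos x w (w * l + phi) s)) +
   (a3 * expR (x * (2 * l))) * (f s * (s * expcos x w (w * (2 * l) + phi) s)))).
  by apply: eq_int0 => s _; rewrite !expcosD; ring.
by rewrite int0_lin3// !kf2 !mulr0 !addr0.
Qed.

Lemma kill_gain x w : (forall phi s, a1 * expcos x w phi s + a2 * expcos x w phi (s + l)
     + a3 * expcos x w phi (s + 2 * l) = 0) -> kill T x w (op3 a1 a2 a3 l f).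
Proof.
move=> H phi; rewrite (int0_op3 a1 a2 a3 h0 hT l0 bT sf cf (@cont_expcos x w phi)).
by under eq_int0 => s _ do rewrite H mulr0; rewrite int0_0.
Qed.

(** Annihilating the same frequency a second time makes the zero double. *)
Lemma kill2_gain x w : (forall phi s, a1 * expcos x w phi s + a2 * expcos x w phi (s + l)
     + a3 * expcos x w phi (s + 2 * l) = 0) -> kill T x w f ->
  kill2 T x w (op3 a1 a2 a3 l f).
Proof.
move=> H kf phi; rewrite kill2_op3_gen//.
by under eq_int0 => s _ do rewrite H !mulr0; rewrite int0_0.
Qed.

Lemma mass_op3 : a1 + a2 + a3 = 1 -> int0 T (op3 a1 a2 a3 l f) = int0 T f.
Proof.
move=> a1E; have := int0_op3 a1 a2 a3 h0 hT l0 bT sf cf (@cst_continuous R R 1).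
under eq_int0 => s _ do rewrite mulr1.
by under [in RHS]eq_int0 => s _ do rewrite !mulr1 a1E mulr1.
Qed.

End Op.
End Kill.

Lemma cvg_telescope {R : realType} (u v : nat -> R) (B : R) : (forall n, 0 <= v n) ->
  (forall N, \sum_(0 <= n < N) v n <= B) -> (forall n, `|u n.+1 - u n| <= v n) -> cvgn u.
Proof.
move=> v0 vB uv; have cv := sum_cvg v0 vB.
have c3 : cvgn [normed series (telescope u)].
  apply: (@series_le_cvg R _ v) => [n|//|n|//]; first exact: normr_ge0.
  exact: uv.
have := normed_cvg c3; rewrite telescopeK => c4.
have -> : u = (fun n => u n - u 0%N) + cst (u 0%N).
  by apply/funext => n; rewrite fctE subrK.
by apply: is_cvgD => //; exact: is_cvg_cst.
Qed.

(** * Infinite composition of the operators *)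

Section Limit.
Context {R : realType}.
Implicit Types (f g : R -> R) (s : R).
Variables (T h b L A P : R) (a1 a2 a3 l : nat -> R) (y y' : R -> R).
Hypotheses (h0 : 0 <= h) (hT : h <= T) (l0 : forall i, 0 <= l i).
Hypotheses (aE : forall i, a1 i + a2 i + a3 i = 1).
Hypotheses (lL : forall N, \sum_(0 <= i < N) 2 * l i <= L) (bT : b + L <= T).
Hypotheses (ny : nice A y y') (sy : supp h b y).
Hypothesis aP : forall N, \prod_(0 <= i < N) (`|a1 i| + `|a2 i| + `|a3 i|) <= P.

Fixpoint Phi f i := match i with 0%N => f | i.+1 => op3 (a1 i) (a2 i) (a3 i) (l i) (Phi f i) end.

Let A0 : 0 <= A.
Proof. by case: ny => h1 _ _ _ _; exact: le_trans (normr_ge0 _) (h1 0). Qed.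

Let kap0 i : 0 <= `|a1 i| + `|a2 i| + `|a3 i|.
Proof. by rewrite !addr_ge0. Qed.

Lemma nice_Phi N :
  nice ((\prod_(0 <= i < N) (`|a1 i| + `|a2 i| + `|a3 i|)) * A) (Phi y N) (Phi y' N).
Proof.
elim: N => [|N IH]; first by rewrite big_geq// mul1r.
by rewrite big_nat_recr//= [X in X * A]mulrC -mulrA; exact: nice_op3.
Qed.

Lemma supp_Phi_eq N : supp h (b + \sum_(0 <= i < N) 2 * l i) (Phi y N).
Proof.
elim: N => [|N IH]; first by rewrite big_geq// addr0.
by rewrite big_nat_recr//= addrA; exact: supp_op3.
Qed.

Lemma supp_Phi N : supp h (b + L) (Phi y N).
Proof. by apply: (supp_le _ (@supp_Phi_eq N)); rewrite lerD2l. Qed.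

Lemma Phi_room N : b + \sum_(0 <= i < N) 2 * l i + 2 * l N <= T.
Proof. by apply: le_trans bT; rewrite -addrA lerD2l; have := lL N.+1; rewrite big_nat_recr. Qed.

Lemma nice_PhiP N : nice (P * A) (Phi y N) (Phi y' N).
Proof.
have PA : (\prod_(0 <= i < N) (`|a1 i| + `|a2 i| + `|a3 i|)) * A <= P * A by rewrite ler_wpM2r.
case: (@nice_Phi N) => h1 h2 h3 h4 h5; split => *.
- exact: le_trans (h1 _) PA.
- exact: le_trans (h2 _) PA.
- by apply: (le_trans (h3 _ _)); rewrite ler_wpM2r.
- by apply: (le_trans (h4 _ _)); rewrite ler_wpM2r.
- by apply: (le_trans (h5 _ _)); rewrite ler_wpM2r// sqr_ge0.
Qed.

Lemma cont_Phi N : continuous (Phi y N).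
Proof. exact: nice_cont (@nice_Phi N). Qed.

Let PA0 : 0 <= P * A.
Proof. by rewrite mulr_ge0//; apply: le_trans (aP 0); rewrite big_geq. Qed.

Lemma Phi_lip f : (forall s u, `|f s - f u| <= A * `|s - u|) ->
  forall N s u, `|Phi f N s - Phi f N u| <=
    (\prod_(0 <= i < N) (`|a1 i| + `|a2 i| + `|a3 i|)) * A * `|s - u|.
Proof.
move=> lf; elim=> [s u|N IH s u]; first by rewrite big_geq// mul1r.
rewrite big_nat_recr//= [X in X * A]mulrC -2!mulrA.
have -> : op3 (a1 N) (a2 N) (a3 N) (l N) (Phi f N) s - op3 (a1 N) (a2 N) (a3 N) (l N) (Phi f N) u =
  a1 N * (Phi f N s - Phi f N u) + a2 N * (Phi f N (s - l N) - Phi f N (u - l N))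
  + a3 N * (Phi f N (s - 2 * l N) - Phi f N (u - 2 * l N)) by rewrite /op3; ring.
apply: norm_lin3; rewrite mulrA.
- exact: IH.
- by apply: (le_trans (IH _ _)); rewrite (_ : s - l N - (u - l N) = s - u)//; ring.
- by apply: (le_trans (IH _ _)); rewrite (_ : s - 2 * l N - (u - 2 * l N) = s - u)//; ring.
Qed.

Lemma Phi_step f : (forall s u, `|f s - f u| <= A * `|s - u|) ->
  forall N s, `|Phi f N.+1 s - Phi f N s| <= P * A * (2 * l N).
Proof.
move=> lf N s; have p0 : 0 <= (\prod_(0 <= i < N) (`|a1 i| + `|a2 i| + `|a3 i|)) * A.
  by rewrite mulr_ge0// prodr_ge0.
apply: (le_trans (op3_close s (l0 N) p0 (Phi_lip lf N) (aE N))).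
rewrite ler_wpM2r ?mulr_ge0//.
by rewrite mulrA ler_wpM2r// mulrC; have := aP N.+1; rewrite big_nat_recr.
Qed.

Let ll0 i : 0 <= 2 * l i.
Proof. by rewrite mulr_ge0. Qed.

Lemma Phi_diff f : (forall s u, `|f s - f u| <= A * `|s - u|) ->
  forall N M s, (N <= M)%N -> `|Phi f M s - Phi f N s| <= P * A * \sum_(N <= i < M) 2 * l i.
Proof.
move=> lf N; elim=> [|M IH] s.
  by rewrite leqn0 => /eqP->; rewrite subrr normr0 big_geq// mulr0.
rewrite leq_eqVlt ltnS => /predU1P[<-|NM].
  by rewrite subrr normr0 big_geq// mulr0.
rewrite big_nat_recr//= mulrDr -(subrK (Phi f M s) (op3 _ _ _ _ _ _)) -addrA addrC.
by apply: (le_trans (ler_normD _ _)); rewrite lerD ?IH// (Phi_step lf).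
Qed.

Lemma Phi_cauchy f : (forall s u, `|f s - f u| <= A * `|s - u|) ->
  forall e : R, 0 < e -> exists N0, forall N M s, (N0 <= N)%N -> (N <= M)%N ->
    `|Phi f M s - Phi f N s| <= e.
Proof.
move=> lf e e0; have P1 : 0 < P * A + 1 by rewrite ltr_wpDl.
have [N0 HN0] := sum_tail ll0 lL (divr_gt0 e0 P1).
exists N0 => N M s N0N NM; apply: (le_trans (Phi_diff lf s NM)).
apply: (@le_trans _ _ (P * A * (e / (P * A + 1)))); first by rewrite ler_wpM2l// HN0.
by rewrite mulrCA ger_pMr// ler_pdivrMr// mul1r lerDl.
Qed.

Lemma Phi_cvg f : (forall s u, `|f s - f u| <= A * `|s - u|) ->
  exists2 F : R -> R, (forall s, Phi f N s @[N --> \oo] --> F s) &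
   (forall e : R, 0 < e -> exists N0, forall N s, (N0 <= N)%N -> `|F s - Phi f N s| <= e).
Proof.
move=> lf; have C s : cvgn (fun N => Phi f N s).
  apply: (@cvg_telescope _ _ (fun i => P * A * (2 * l i)) (P * A * L)).
  - by move=> n; rewrite mulr_ge0.
  - by move=> N; rewrite -mulr_sumr ler_wpM2l.
  - by move=> N; exact: Phi_step.
exists (fun s => limn (fun N => Phi f N s)) => // e e0.
have [N0 HN0] := Phi_cauchy lf e0; exists N0 => N s NN.
have ch : `|Phi f M s - Phi f N s| @[M --> \oo] --> `|limn (fun N => Phi f N s) - Phi f N s|.
  by apply: cvg_norm; apply: cvgB; [exact: C|exact: cvg_cst].
rewrite -(cvg_lim _ ch)//; apply: limr_le; first by apply/cvg_ex; eexists; exact: ch.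
by exists N => // M /= NM; exact: HN0.
Qed.

(** The translation lengths are summable and the norms stay below [P * A], so the iterates of [y]
    and of [y'] converge uniformly. The quadratic remainder in [nice] keeps the second limit the
    derivative of the first. *)
Lemma Phi_limit : exists f f', [/\ nice (P * A) f f', supp h (b + L) f &
  forall g, continuous g ->
    int0 T (fun s => Phi y N s * g s) @[N --> \oo] --> int0 T (fun s => f s * g s)].
Proof.
case: (ny) => _ _ l1 l2 _.
have [f cf uf] := Phi_cvg l1; have [f' cf' uf'] := Phi_cvg l2.
have nP := nice_PhiP.
have le_lim (u : nat -> R) (v B : R) : (forall n, `|u n| <= B) -> u n @[n --> \oo] --> v -> `|v| <= B.
  move=> uB uv; have ch : `|u n| @[n --> \oo] --> `|v| by exact: cvg_norm.
  rewrite -(cvg_lim _ ch)//.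
  by apply: limr_le; [apply/cvg_ex; eexists; exact: ch | exact: nearW].
have nf : nice (P * A) f f'.
  split=> [s|s|s u|s u|s u].
  - by apply: le_lim (cf s) => n; case: (nP n).
  - by apply: le_lim (cf' s) => n; case: (nP n).
  - by apply: (@le_lim (fun n => Phi y n s - Phi y n u)); [move=> n; case: (nP n)|apply: cvgB].
  - by apply: (@le_lim (fun n => Phi y' n s - Phi y' n u)); [move=> n; case: (nP n)|apply: cvgB].
  - apply: (@le_lim (fun n => Phi y n u - Phi y n s - (u - s) * Phi y' n s)).
      by move=> n; case: (nP n).
    by apply: cvgB; [apply: cvgB|apply: cvgMr].
exists f, f'; split => //.
  move=> s sh; have : (fun N => Phi y N s) = cst 0 by apply/funext => N; exact: supp_Phi sh.
  by have := cf s => /[swap] ->; move/(cvg_lim (@Rhausdorff R)) => <-; exact: lim_cst.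
move=> g cg; apply/cvgrPdist_le => e e0.
have T0 : 0 <= T := le_trans h0 hT.
set I := int0 T (fun s => `|g s|).
have I0 : 0 <= I by apply: int0_ge0.
have I1 : 0 < I + 1 by rewrite ltr_wpDl.
have [N0 HN0] := uf _ (divr_gt0 e0 I1).
exists N0 => // N /= NN; have cfc := nice_cont nf; have cp : continuous (Phi y N) by exact: cont_Phi.
have cfg := contM cfc cg; have cpg := contM cp cg.
rewrite -int0B//; apply: (le_trans (norm_int0 _ _)); first exact: contB.
apply: (@le_trans _ _ (int0 T (fun s => e / (I + 1) * `|g s|))).
  apply: le_int0; [by apply: cont_norm; exact: contB|by apply: contZ; exact: cont_norm|].
  by move=> s _; rewrite -mulrBl normrM ler_wpM2r// HN0.
rewrite int0Z; last exact: cont_norm.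
by rewrite mulrAC ler_pdivrMr// ler_pM2l// lerDl.
Qed.

End Limit.

(** * A bump of class C^1 with Lipschitz derivative *)

Section Bump.
Context {R : realType}.
Implicit Types (s u z : R).

Let clamp z : R := Num.min 1 (Num.max 0 z).

Let clamp01 z : 0 <= clamp z <= 1.
Proof. by rewrite /clamp; case: (lerP 0 z) => h; case: (lerP 1 _) => h2; lra. Qed.

Let clampE z : [\/ z <= 0 /\ clamp z = 0, 1 <= z /\ clamp z = 1 | 0 <= z <= 1 /\ clamp z = z].
Proof.
rewrite /clamp; case: (lerP 0 z) => h; last first.
  by apply: Or31; rewrite ltW// min_r.
case: (lerP 1 z) => h2; first by apply: Or32.
by apply: Or33; rewrite ltW// h.
Qed.

(** Double zeros at 0 and 1: composed with [clamp], the polynomial remains of class C^1 with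
    Lipschitz derivative. *)
Let g z : R := z ^+ 2 * (1 - z) ^+ 2.
Let g' z : R := 2 * z * (1 - z) * (1 - 2 * z).

Let clamp_lip s u : `|clamp s - clamp u| <= `|s - u|.
Proof.
rewrite ler_norml; have := ler_norm (s - u); have := ler_norm (u - s); rewrite distrC.
by case: (clampE s) => -[h1 ->]; case: (clampE u) => -[h2 ->] *; apply/andP; split; lra.
Qed.

Let normM_le (d c x e : R) : `|c| <= x -> `|d| <= e -> `|d * c| <= x * e.
Proof. by move=> cx de; rewrite normrM mulrC ler_pM. Qed.

(** [39 = 13 + 26]: the Taylor remainder between the clamped points, plus the change of the linear
    term caused by clamping, which is quadratically small because [g'] vanishes at 0 and 1. *)
Lemma nice_bump01 : nice 39 (fun z => g (clamp z)) (fun z => g' (clamp z)).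
Proof.
have b (c : R) x y : -x <= c -> c <= x -> 0 <= x -> x <= y -> `|c| <= y.
  by move=> *; rewrite ler_norml; apply/andP; split; lra.
split => [s|s|s u|s u|s u].
- have /andP[a0 a1] := clamp01 s; move: (clamp s) a0 a1 => a a0 a1.
  by rewrite /g ger0_norm ?mulr_ge0 ?sqr_ge0//; nra.
- have /andP[a0 a1] := clamp01 s; move: (clamp s) a0 a1 => a a0 a1.
  rewrite /g' ler_norml; have h1 : 0 <= a * (1 - a) by rewrite mulr_ge0// subr_ge0.
  have h2 : a * (1 - a) <= 1 by nra.
  by rewrite -(mulrA 2); apply/andP; split; nra.
- have := clamp_lip s u; have /andP[a0 a1] := clamp01 s; have /andP[b0 b1] := clamp01 u.
  move: (clamp s) (clamp u) a0 a1 b0 b1 => a c a0 a1 c0 c1 L.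
  have -> : g a - g c = (a - c) * ((a + c) - 2 * (a ^+ 2 + a * c + c ^+ 2)
     + (a ^+ 3 + a ^+ 2 * c + a * c ^+ 2 + c ^+ 3)) by rewrite /g; ring.
  apply: normM_le => //.
  have e1 : 0 <= a ^+ 2 + a * c + c ^+ 2 <= 3 by apply/andP; split; nra.
  have e2 : 0 <= a ^+ 3 + a ^+ 2 * c + a * c ^+ 2 + c ^+ 3 <= 4.
    have -> : a ^+ 3 + a ^+ 2 * c + a * c ^+ 2 + c ^+ 3 = (a + c) * (a ^+ 2 + c ^+ 2) by ring.
    have : 0 <= a ^+ 2 + c ^+ 2 <= 2 by apply/andP; split; nra.
    move: (a ^+ 2 + c ^+ 2) => q /andP[q0 q1]; apply/andP; split; nra.
  by apply: (@b _ 39) => //; lra.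
- have := clamp_lip s u; have /andP[a0 a1] := clamp01 s; have /andP[b0 b1] := clamp01 u.
  move: (clamp s) (clamp u) a0 a1 b0 b1 => a c a0 a1 c0 c1 L.
  have -> : g' a - g' c = (a - c) * (2 - 6 * (a + c) + 4 * (a ^+ 2 + a * c + c ^+ 2)).
    by rewrite /g'; ring.
  apply: normM_le => //.
  have e1 : 0 <= a ^+ 2 + a * c + c ^+ 2 <= 3 by apply/andP; split; nra.
  by apply: (@b _ 39) => //; lra.
have key : `|g (clamp u) - g (clamp s) - (clamp u - clamp s) * g' (clamp s)| <= 13 * (u - s) ^+ 2.
  have := clamp_lip u s; have /andP[a0 a1] := clamp01 s; have /andP[b0 b1] := clamp01 u.
  move: (clamp s) (clamp u) a0 a1 b0 b1 => a c a0 a1 c0 c1 L.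
  have -> : g c - g a - (c - a) * g' a = (c - a) ^+ 2 * (1 - 2 * (2 * a + c) +
     (3 * a ^+ 2 + 2 * a * c + c ^+ 2)) by rewrite /g /g'; ring.
  apply: normM_le; last first.
    by rewrite ger0_norm ?sqr_ge0// -(real_normK (num_real (c - a))) -(real_normK (num_real (u - s))) lerXn2r.
  have e1 : 0 <= 3 * a ^+ 2 + 2 * a * c + c ^+ 2 <= 6 by apply/andP; split; nra.
  by apply: (@b _ 13) => //; lra.
have key2 : `|(clamp u - clamp s - (u - s)) * g' (clamp s)| <= 26 * (u - s) ^+ 2.
  have g'1 : g' 1 = 0 by rewrite /g' subrr mulr0 mul0r.
  have g'0 : g' 0 = 0 by rewrite /g' mulr0 !mul0r.
  have p : 0 <= 26 * (u - s) ^+ 2 by rewrite mulr_ge0 ?sqr_ge0.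
  case: (clampE s) => -[hs ->]; rewrite ?g'0 ?g'1 ?mulr0 ?normr0//.
  case: (clampE u) => -[hu ->].
  - rewrite /g'; have -> : (0 - s - (u - s)) * (2 * s * (1 - s) * (1 - 2 * s)) =
      (- u * s) * (2 * (1 - s) * (1 - 2 * s)) by ring.
    apply: normM_le; last by rewrite ler_norml; apply/andP; split; nra.
    by apply: (@b _ 26) => //; nra.
  - rewrite /g'; have -> : (1 - s - (u - s)) * (2 * s * (1 - s) * (1 - 2 * s)) =
      ((1 - u) * (1 - s)) * (2 * s * (1 - 2 * s)) by ring.
    apply: normM_le; last by rewrite ler_norml; apply/andP; split; nra.
    by apply: (@b _ 26) => //; nra.
  - by rewrite subrr mul0r normr0.
have -> : g (clamp u) - g (clamp s) - (u - s) * g' (clamp s) =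
  (g (clamp u) - g (clamp s) - (clamp u - clamp s) * g' (clamp s)) +
  (clamp u - clamp s - (u - s)) * g' (clamp s) by ring.
apply: (le_trans (ler_normD _ _)); apply: (le_trans (lerD key key2)).
by rewrite -mulrDl ler_wpM2r ?sqr_ge0//; lra.
Qed.

Lemma nice_affine (A c d : R) f f' : 1 <= c -> nice A f f' ->
  nice (c ^+ 2 * A) (fun s => f (c * (s - d))) (fun s => c * f' (c * (s - d))).
Proof.
move=> c1 [h1 h2 h3 h4 h5]; have c0 : 0 <= c by lra.
have A0 : 0 <= A by exact: le_trans (normr_ge0 _) (h1 0).
have cc : c <= c ^+ 2 by nra.
have cc1 : 1 <= c ^+ 2 by nra.
have e s u : `|c * (s - d) - c * (u - d)| = c * `|s - u|.
  by rewrite -mulrBr opprB addrA subrK normrM ger0_norm.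
split => [s|s|s u|s u|s u].
- by apply: (le_trans (h1 _)); rewrite ler_peMl.
- rewrite normrM ger0_norm//; apply: (le_trans (ler_wpM2l c0 (h2 _))).
  by rewrite ler_wpM2r.
- apply: (le_trans (h3 _ _)); rewrite e mulrA [A * c]mulrC.
  by rewrite ler_wpM2r// ler_wpM2r.
- rewrite -mulrBr normrM ger0_norm//.
  apply: (le_trans (ler_wpM2l c0 (h4 _ _))); rewrite e.
  by rewrite le_eqVlt; apply/orP; left; apply/eqP; ring.
- have := h5 (c * (s - d)) (c * (u - d)).
  have -> : c * (u - d) - c * (s - d) = c * (u - s) by ring.
  have -> : A * (c * (u - s)) ^+ 2 = c ^+ 2 * A * (u - s) ^+ 2 by ring.
  by rewrite (mulrCA (u - s) c) mulrA.
Qed.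

Lemma nice_scale (A c : R) f f' : nice A f f' ->
  nice (`|c| * A) (fun s => c * f s) (fun s => c * f' s).
Proof.
move=> [h1 h2 h3 h4 h5]; split => [s|s|s u|s u|s u].
- by rewrite normrM ler_wpM2l.
- by rewrite normrM ler_wpM2l.
- by rewrite -mulrBr normrM -mulrA ler_wpM2l.
- by rewrite -mulrBr normrM -mulrA ler_wpM2l.
- by rewrite mulrCA -!mulrBr normrM -mulrA ler_wpM2l.
Qed.

Lemma bump_exists (T h d : R) : 0 <= h -> 0 < d -> h + d <= T ->
  exists A y y', [/\ nice A y y', supp h (h + d) y & int0 T y = 1].
Proof.
(* [c >= 1] is what [nice_affine] asks for, and [c >= 1 / d] squeezes the support into a length at
   most [d]. *)
move=> h0 d0 hd; pose c := Num.max 1 d^-1.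
have c1 : 1 <= c by rewrite le_max lexx.
have cd : 1 <= c * d by rewrite -[leLHS](mulVf (lt0r_neq0 d0)) ler_pM2r// le_max lexx orbT.
have c0 : 0 < c by exact: lt_le_trans c1.
pose y0 s := g (clamp (c * (s - h))).
have ny0 := nice_affine h c1 nice_bump01.
have g1 : g 1 = 0 by rewrite /g subrr expr0n mulr0.
have g0 : g 0 = 0 by rewrite /g expr0n mul0r.
have sy0 : supp h (h + d) y0.
  move=> s [sh|hs]; rewrite /y0.
    have z0 : c * (s - h) <= 0 by rewrite pmulr_rle0// subr_le0.
    by case: (clampE (c * (s - h))) => -[hz ->] //; rewrite (_ : c * (s - h) = 0)//; lra.
  have z1 : 1 <= c * (s - h) by apply: (le_trans cd); rewrite ler_pM2l//; lra.
  by case: (clampE (c * (s - h))) => -[hz ->] //; rewrite (_ : c * (s - h) = 1)//; lra.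
have I0 : 0 < int0 T y0.
  apply: (@int0_gt0 _ _ _ h (h + c^-1)) => //.
  - exact: nice_cont ny0.
  - by move=> s; rewrite mulr_ge0 ?sqr_ge0.
  - by rewrite ltrDl invr_gt0.
  - apply: le_trans hd; rewrite lerD2l -[leLHS]mul1r ler_pdivrMr//.
    by rewrite mulrC.
  move=> s /andP[hs sh]; rewrite /y0.
  have z0 : 0 < c * (s - h) by rewrite mulr_gt0// subr_gt0.
  have z1 : c * (s - h) < 1 by rewrite mulrC -ltr_pdivlMr// mul1r; lra.
  case: (clampE (c * (s - h))) => -[hz ->]; try lra.
  by rewrite mulr_gt0// exprn_gt0// subr_gt0.
exists (`|(int0 T y0)^-1| * (c ^+ 2 * 39)), (fun s => (int0 T y0)^-1 * y0 s).
exists (fun s => (int0 T y0)^-1 * (c * g' (clamp (c * (s - h))))); split.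
- exact: nice_scale ny0.
- by move=> s /sy0 ->; rewrite mulr0.
- rewrite int0Z ?mulVf ?gt_eqF//; exact: nice_cont ny0.
Qed.

End Bump.

(** * The three-term operators *)

Section Notch.
Context {R : realType}.
Implicit Types (x w th l s phi : R).

(** [|1 - e^(x l + i th)|^2]. It is the sum of the raw coefficients [E^2], [- 2 E cos th], [1] with
    [E = e^(x l)], hence the divisor that normalises them. *)
Definition notchD x th l : R := 1 - 2 * expR (x * l) * cos th + expR (x * l) ^+ 2.

Lemma notchD_ge x th l : -1 <= cos th ->
  (1 - cos th) / 2 * (1 + expR (x * l)) ^+ 2 <= notchD x th l.
Proof.
rewrite /notchD; move: (expR (x * l)) (cos th) => E c hc; rewrite -subr_ge0.
have -> : 1 - 2 * E * c + E ^+ 2 - (1 - c) / 2 * (1 + E) ^+ 2 = (1 + c) / 2 * (1 - E) ^+ 2.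
  by field.
by rewrite mulr_ge0 ?sqr_ge0// divr_ge0//; lra.
Qed.

Lemma notchD_gt0 x th l : cos th < 1 -> 0 < notchD x th l.
Proof.
move=> c1; apply: lt_le_trans (notchD_ge x l (cos_geN1 th)).
by rewrite mulr_gt0 ?divr_gt0 ?subr_gt0// exprn_gt0// addr_gt0 ?expR_gt0.
Qed.

(** Along translations by [l], [expcos] satisfies the recurrence with characteristic roots
    [E e^(i th)] and [E e^(- i th)], that is, with polynomial [z^2 - 2 E cos th z + E^2]. *)
Lemma notch_ann x w th s phi : w != 0 ->
  let l := th / w in
  expR (x * l) ^+ 2 / notchD x th l * expcos x w phi s
  + - (2 * expR (x * l) * cos th) / notchD x th l * expcos x w phi (s + l)
  + 1 / notchD x th l * expcos x w phi (s + 2 * l) = 0.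
Proof.
move=> w0 l; rewrite !expcosD /expcos.
have wl : w * l = th by rewrite mulrCA mulfV ?mulr1.
have -> : w * s + (w * l + phi) = (w * s + phi) + th by rewrite wl; ring.
have -> : w * s + (w * (2 * l) + phi) = (w * s + phi) + th + th by rewrite -wl; ring.
have -> : x * (2 * l) = x * l + x * l by ring.
rewrite expRD; set E := expR (x * l); set Z := expR (x * s); set a := w * s + phi.
set D := notchD x th l.
have -> : cos (a + th + th) = 2 * cos th * cos (a + th) - cos a.
  have := cosD (a + th) th; have := cosB (a + th) th; rewrite addrK; lra.
by ring.
Qed.

Lemma notch_sum x th l : cos th < 1 ->
  expR (x * l) ^+ 2 / notchD x th l + - (2 * expR (x * l) * cos th) / notchD x th l
  + 1 / notchD x th l = 1.
Proof.
move=> c1; have D0 := notchD_gt0 x l c1.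
by rewrite -!mulrDl -[RHS](mulfV (lt0r_neq0 D0)) /notchD; congr (_ / _); ring.
Qed.

(** For [cos th >= 0] the absolute coefficients sum to at most [(1 + E)^2 / D], and [notchD_ge]
    cancels [(1 + E)^2]: the bound sees the angle but not the difference [x] of the rates. *)
Lemma notch_norm x th l : 0 <= cos th < 1 ->
  `|expR (x * l) ^+ 2 / notchD x th l| + `|- (2 * expR (x * l) * cos th) / notchD x th l|
  + `|1 / notchD x th l| <= 2 / (1 - cos th).
Proof.
move=> /andP[c0 c1]; have D0 := notchD_gt0 x l c1; have E0 := expR_gt0 (x * l).
have := notchD_ge x l (cos_geN1 th).
move: D0 E0; move: (notchD x th l) (expR (x * l)) (cos th) c0 c1 => D E g c0 c1 D0 E0 H.
have D1 := ltW D0; have E1 := ltW E0; have g1 : 0 <= 1 - g by rewrite subr_ge0 ltW.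
have g0 : 0 <= 2 * E * g by rewrite !mulr_ge0.
rewrite mulNr normrN !ger0_norm ?divr_ge0 ?sqr_ge0// -!mulrDl.
rewrite ler_pdivrMr// [leRHS]mulrAC ler_pdivlMr ?subr_gt0//.
have : (1 - g) * (1 + E) ^+ 2 <= 2 * D by lra.
apply: le_trans; rewrite mulrC ler_wpM2l//; nra.
Qed.

Lemma notch_norm1 x th l : cos th = 0 ->
  `|expR (x * l) ^+ 2 / notchD x th l| + `|- (2 * expR (x * l) * cos th) / notchD x th l|
  + `|1 / notchD x th l| = 1.
Proof.
move=> c0; have c1 : cos th < 1 by rewrite c0.
have D0 := notchD_gt0 x l c1; have := notch_sum x l c1.
have D1 := ltW D0; rewrite c0 mulr0 oppr0 mul0r normr0 !addr0 !ger0_norm ?divr_ge0 ?sqr_ge0//.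
Qed.

End Notch.

Lemma dist_gt0 (n j : nat) : j != n -> (0 < dist n j)%N.
Proof. by rewrite /dist => jn; lia. Qed.

(** * Angles and lengths of the translations for one window *)

Section Window.
Context {R : realType}.
Variables (T alpha rho : R).
Hypotheses (T_gt0 : 0 < T) (alpha_ge0 : 0 <= alpha) (alpha_lt1 : alpha < 1).
Hypotheses (rho_gt0 : 0 < rho) (rho_le2 : rho <= 2).
Implicit Types (n m j i : nat).
Local Notation rr := (rr alpha rho).
Local Notation om := (om alpha rho).
Local Notation c := (1 - alpha).

Let c0 : 0 < c. Proof. by rewrite subr_gt0. Qed.

(** A positive lower bound for all nonvanishing frequencies: above the lowest mode the gap gives at
    least [c], and [om 0] counts only if it is not 0. *)
Definition omin : R := Num.min c (if om 0 == 0 then c else om 0).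

Lemma omin_gt0 : 0 < omin.
Proof.
rewrite /omin lt_min c0/=; case: eqP => // /eqP o0.
by rewrite lt_neqAle eq_sym o0 om_ge0.
Qed.

Lemma omin_le n : om n != 0 -> omin <= om n.
Proof.
case: (posnP n) => [->|n0] on.
  by rewrite /omin (negPf on) ge_min lexx orbT.
apply: (@le_trans _ _ c); first by rewrite /omin ge_min lexx.
have h := om_gap_le alpha_ge0 alpha_lt1 rho_gt0 rho_le2 (leq0n n).
have o0 := om_ge0 alpha rho 0.
apply: (@le_trans _ _ (om n - om 0)); last by rewrite gerBl.
apply: le_trans h; rewrite subr0; apply: ler_peMr; first exact: ltW.
by rewrite exprn_ege1// ler1n.
Qed.

Variables (n K : nat) (th0 : R).
Hypotheses (th0_gt0 : 0 < th0) (th0_le1 : th0 <= 1).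

(* Step [i] annihilates [om_j - om_n] (i even) or [om_j + om_n] (i odd), where
   [j = i./2], by translations of length [kl i]; a vanishing frequency is
   skipped.  With the angle [pi / 2] the middle coefficient vanishes and the
   other two are positive, so only the [j] near [n] increase norms. *)
Definition kw i : R := if odd i then om i./2 + om n else `|om i./2 - om n|.
Definition kx i : R := rr i./2 - rr n.
(** Near [n] a quarter period may exceed the time available. The small angle [th0] shortens the
    translation at the price of a norm factor [kap0], paid a bounded number of times. *)
Definition kth i : R := if (dist n i./2 <= K)%N then th0 else pi / 2.
Definition kl i : R := if kw i == 0 then 0 else kth i / kw i.
Definition ka1 i : R := if kw i == 0 then 1 else
  expR (kx i * kl i) ^+ 2 / notchD (kx i) (kth i) (kl i).
Definition ka2 i : R := if kw i == 0 then 0 else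
  - (2 * expR (kx i * kl i) * cos (kth i)) / notchD (kx i) (kth i) (kl i).
Definition ka3 i : R := if kw i == 0 then 0 else 1 / notchD (kx i) (kth i) (kl i).

Let pi2_gt1 : 1 <= pi / 2 :> R. Proof. exact: pihalf_ge1. Qed.

Let cth0 : 0 <= cos th0 < 1.
Proof.
apply/andP; split.
  by apply: cos_ge0_pihalf; apply/andP; split; [have := th0_gt0|]; move: pi2_gt1 th0_le1; lra.
rewrite -cos0 ltr_cos ?in_itv/=//; apply/andP; split=> //; try exact: ltW.
  by rewrite pi_ge0.
by move: pi2_gt1 th0_le1; lra.
Qed.

Lemma kth_gt0 i : 0 < kth i.
Proof. by rewrite /kth; case: ifP => // _; exact: lt_le_trans pi2_gt1. Qed.

Lemma kcos i : 0 <= cos (kth i) < 1.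
Proof. by rewrite /kth; case: ifP => // _; rewrite cos_pihalf lexx ltr01. Qed.

Lemma kw_ge0 i : 0 <= kw i.
Proof. by rewrite /kw; case: ifP => // _; rewrite addr_ge0 ?om_ge0. Qed.

Lemma kl_ge0 i : 0 <= kl i.
Proof. by rewrite /kl; case: ifP => // _; rewrite divr_ge0 ?kw_ge0// ltW// kth_gt0. Qed.

Lemma ksum i : ka1 i + ka2 i + ka3 i = 1.
Proof.
rewrite /ka1 /ka2 /ka3; case: ifP => [_|_]; first by rewrite !addr0.
by apply: notch_sum; case/andP: (kcos i).
Qed.

Definition kap i : R := `|ka1 i| + `|ka2 i| + `|ka3 i|.
Definition kap0 : R := 2 / (1 - cos th0).

Lemma kap0_ge1 : 1 <= kap0.
Proof.
by case/andP: cth0 => h0 h1; rewrite /kap0 ler_pdivlMr ?subr_gt0// mul1r; lra.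
Qed.

Lemma kap_le i : kap i <= kap0 ^+ (dist n i./2 <= K)%N.
Proof.
rewrite /kap /ka1 /ka2 /ka3; case: ifP => _.
  by rewrite normr0 !addr0 normr1; exact: exprn_ege1 kap0_ge1.
have := kcos i; have := @notch_norm R (kx i) (kth i) (kl i).
have := @notch_norm1 R (kx i) (kth i) (kl i).
rewrite /kth; case: ifP => _; first by move=> _ /[apply].
by rewrite cos_pihalf => -> // _ _; rewrite expr0.
Qed.

Lemma kap_ge0 i : 0 <= kap i.
Proof. by rewrite /kap !addr_ge0. Qed.

Lemma sum_half (F : nat -> R) N : (forall d, 0 <= F d) ->
  \sum_(0 <= i < N) F i./2 <= 2 * \sum_(0 <= j < N) F j.
Proof.
move=> F0; have -> : 2 * \sum_(0 <= j < N) F j = \sum_(0 <= i < N.*2) F i./2.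
  elim: N => [|N IH]; first by rewrite !big_geq// mulr0.
  rewrite doubleS !big_nat_recr//= mulrDr IH uphalf_double doubleK.
  by rewrite -addrA; congr (_ + _); ring.
have NN : (N <= N.*2)%N by rewrite -addnn leq_addr.
by rewrite [leRHS](big_cat_nat (leq0n N) NN)//= lerDl sumr_ge0.
Qed.

Lemma sum_half_dist (F : nat -> R) B N : (forall d, 0 <= F d) ->
  (forall P, \sum_(0 <= d < P) F d <= B) ->
  \sum_(0 <= i < N) F (dist n i./2) <= 4 * B.
Proof.
move=> F0 FB; apply: (le_trans (sum_half N (fun d => F0 (dist n d)))).
have := sum_dist n N F0 FB; lra.
Qed.

(** A factor may exceed 1 only within distance [K] of [n]: at most two [j] for each of the [K + 1]
    distances, and two steps for each [j]. *)
Lemma kap_prod N : \prod_(0 <= i < N) kap i <= kap0 ^+ (4 * K.+1).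
Proof.
apply: (@le_trans _ _ (kap0 ^+ (\sum_(0 <= i < N) (dist n i./2 <= K)%N))).
  rewrite expr_sum; apply: ler_prod => i _; rewrite kap_ge0/=; exact: kap_le.
apply: ler_weXn2l kap0_ge1 _ _ _.
rewrite -(ler_nat R) natr_sum natrM.
apply: (@sum_half_dist (fun d => (d <= K)%N%:R)) => // P.
elim: P => [|P IH]; first by rewrite big_geq.
have : \sum_(0 <= d < P.+1) (d <= K)%N%:R <= (minn P.+1 K.+1)%:R :> R.
  clear IH; elim: P => [|P IH]; first by rewrite big_nat1 leq0n ler_nat leq_min.
  rewrite big_nat_recr//=; apply: (le_trans (lerD IH (lexx _))).
  rewrite -natrD ler_nat; case: leqP; lia.
by move=> /le_trans; apply; rewrite ler_nat geq_minr.
Qed.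

(** [2 / c] serves distinct modes, whose gap is at least [c]; [omin^-1] serves the frequency
    [2 om_n] of mode [n] against itself. *)
Definition kC : R := 2 / c + omin^-1.

(** A bound for [2 * kl] by distance. For far modes it is [pi] over a gap of at least [c d^2],
    combined with [1 / d^2 <= 2 / (1 + d^2)]. *)
Definition kG (d : nat) : R :=
  if (d <= K)%N then th0 * kC else 2 * pi / c * (1 + d%:R ^+ 2)^-1.

Lemma kG_ge0 d : 0 <= kG d.
Proof.
have o0 := ltW omin_gt0; have c1 := ltW c0; have t0 := ltW th0_gt0.
rewrite /kG /kC; case: ifP => _.
  by rewrite mulr_ge0// addr_ge0 ?divr_ge0 ?invr_ge0.
have p0 := pi_ge0 R.
by apply: mulr_ge0; [rewrite divr_ge0// mulr_ge0 | rewrite invr_ge0 addr_ge0// sqr_ge0].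
Qed.

Lemma kw_lower i : i./2 != n -> c * (dist n i./2)%:R ^+ 2 <= kw i.
Proof.
move=> jn; rewrite -dist_sqr.
have h := om_gap alpha_ge0 alpha_lt1 rho_gt0 rho_le2 n i./2.
apply: (le_trans h); rewrite distrC /kw; case: ifP => // _.
have := om_ge0 alpha rho n; have := om_ge0 alpha rho i./2.
by rewrite ler_norml; move=> *; apply/andP; split; lra.
Qed.

Lemma kw_gt0 i : i./2 != n -> 0 < kw i.
Proof.
move=> jn; apply: lt_le_trans (kw_lower jn); rewrite mulr_gt0// exprn_gt0//.
by rewrite ltr0n dist_gt0.
Qed.

(** For [j = n] the difference frequency vanishes and is skipped, so only [2 om_n] is left; for
    [j != n] both frequencies are at least [c d^2]. *)
Lemma kl_le i : 2 * kl i <= kG (dist n i./2).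
Proof.
have t0 := ltW th0_gt0; have c1 := ltW c0; have o0 := ltW omin_gt0.
rewrite /kl; case: eqP => [_|/eqP w0]; first by rewrite mulr0 kG_ge0.
case: (eqVneq i./2 n) => [jn|jn].
  have d0 : dist n i./2 = 0%N by rewrite jn /dist subnn.
  rewrite /kG /kth d0 leq0n; have wE : kw i = 2 * om n.
    move: w0; rewrite /kw jn; case: ifP => _; last by rewrite subrr normr0 eqxx.
    by move=> _; ring.
  have on : om n != 0 by apply: contraNneq w0 => o; rewrite wE o mulr0.
  have -> : 2 * (th0 / kw i) = th0 * (om n)^-1 by rewrite wE; field.
  apply: ler_wpM2l => //.
  rewrite /kC (@le_trans _ _ omin^-1)// ?lerDr ?divr_ge0//.
  rewrite lef_pV2 ?posrE ?omin_gt0 ?omin_le//.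
  exact: lt_le_trans omin_gt0 (omin_le on).
have D1 : 1 <= (dist n i./2)%:R ^+ 2 :> R by rewrite exprn_ege1// ler1n dist_gt0.
have W := kw_lower jn.
set D := (dist n i./2)%:R ^+ 2 in D1 W.
have D0 : 0 < D by exact: lt_le_trans D1.
have cD : 0 < c * D by rewrite mulr_gt0.
have k0 := ltW (kth_gt0 i).
have h : 2 * (kth i / kw i) <= 2 * (kth i / (c * D)).
  rewrite ler_pM2l// ler_wpM2l// lef_pV2 ?posrE//; exact: lt_le_trans W.
apply: (le_trans h); rewrite /kG -/D.
case: ifP => dK.
  rewrite /kth dK mulrCA ler_wpM2l// /kC (@le_trans _ _ (2 / c))// ?lerDl ?invr_ge0//.
  by rewrite ler_pM2l// lef_pV2 ?posrE// ler_peMr.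
have D2 : (D)^-1 <= 2 * (1 + D)^-1.
  by rewrite -[leLHS]mul1r ler_pdivrMr// mulrAC ler_pdivlMr ?addr_gt0//; lra.
rewrite /kth dK invfM.
have -> : 2 * (pi / 2 * (c^-1 * D^-1)) = pi / c * D^-1 by field; rewrite !lt0r_neq0.
have -> : 2 * pi / c * (1 + D)^-1 = pi / c * (2 * (1 + D)^-1) by ring.
by rewrite ler_wpM2l// divr_ge0// pi_ge0.
Qed.

Hypothesis tailK : forall P, \sum_(K.+1 <= d < P) (1 + d%:R ^+ 2)^-1 <= T / 64 / (2 * pi / c).
Hypothesis th0K : K.+1%:R * (th0 * kC) <= T / 64.

(** Near and far modes get [T / 64] each; the multiplicity 4 in [sum_half_dist] then makes the total
    translation [T / 8]. *)
Lemma kG_sum P : \sum_(0 <= d < P) kG d <= T / 32.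
Proof.
apply: (@le_trans _ _ (\sum_(0 <= d < K.+1 + P) kG d)).
  have PP : (P <= K.+1 + P)%N by rewrite leq_addl.
  by rewrite [leRHS](big_cat_nat (leq0n P) PP)//= lerDl sumr_ge0// => d _; exact: kG_ge0.
rewrite (big_cat_nat (leq0n K.+1) (leq_addr P K.+1))//=.
have -> : T / 32 = T / 64 + T / 64 by field.
apply: lerD.
  apply: le_trans th0K; rewrite (eq_big_nat _ _ (F2 := fun=> th0 * kC)).
    by rewrite sumr_const_nat subn0 mulr_natl.
  by move=> d /andP[_ dK]; rewrite /kG -ltnS dK.
rewrite (eq_big_nat _ _ (F2 := fun d => 2 * pi / c * (1 + d%:R ^+ 2)^-1)); last first.
  by move=> d /andP[Kd _]; rewrite /kG leqNgt Kd.
have p0 : 0 < 2 * pi / c by rewrite divr_gt0// mulr_gt0// pi_gt0.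
by rewrite -mulr_sumr mulrC -ler_pdivlMr.
Qed.

Lemma kl_sum N : \sum_(0 <= i < N) 2 * kl i <= T / 8.
Proof.
apply: (@le_trans _ _ (\sum_(0 <= i < N) kG (dist n i./2))).
  by apply: ler_sum => i _; exact: kl_le.
apply: (le_trans (sum_half_dist N kG_ge0 kG_sum)); lra.
Qed.

End Window.

(** * Existence of the windows *)

Section WindowExists.
Context {R : realType}.
Variables (T alpha rho : R).
Hypotheses (T_gt0 : 0 < T) (alpha_ge0 : 0 <= alpha) (alpha_lt1 : alpha < 1).
Hypotheses (rho_gt0 : 0 < rho) (rho_le2 : rho <= 2).
Implicit Types (n m j i : nat).
Local Notation rr := (rr alpha rho).
Local Notation om := (om alpha rho).

(** [K] is fixed by the tail of the series of [1 / (1 + d^2)]; only then is the angle chosen, small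
    enough for the [K + 1] near distances. Neither depends on a mode. *)
Lemma window_params : exists K th0, [/\ 0 < th0, th0 <= 1,
  forall P, \sum_(K.+1 <= d < P) (1 + d%:R ^+ 2)^-1 <= T / 64 / (2 * pi / (1 - alpha)) &
  K.+1%:R * (th0 * kC alpha rho) <= T / 64].
Proof.
have c0 : 0 < 1 - alpha by rewrite subr_gt0.
have e0 : 0 < T / 64 / (2 * pi / (1 - alpha)).
  by rewrite divr_gt0 ?divr_gt0// mulr_gt0// pi_gt0.
have b0 d : 0 <= (1 + d%:R ^+ 2)^-1 :> R by rewrite invr_ge0 addr_ge0// sqr_ge0.
have [K HK] := sum_tail b0 sum_invsq e0.
have o0 := omin_gt0 rho alpha_lt1.
have k0 : 0 < kC alpha rho by rewrite /kC addr_gt0 ?divr_gt0 ?invr_gt0.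
have q0 : 0 < T / 64 / (K.+1%:R * kC alpha rho) by rewrite !divr_gt0// mulr_gt0.
exists K, (Num.min 1 (T / 64 / (K.+1%:R * kC alpha rho))); split.
- by rewrite lt_min ltr01.
- by rewrite ge_min lexx.
- by move=> P; apply: HK.
- rewrite mulrCA -ler_pdivlMr; last by rewrite mulr_gt0.
  by rewrite ge_min lexx orbT.
Qed.

(** The bump, [K] and [th0] are chosen before [n], whence a bound [A] uniform in [n]. The last
    clause concerns a critically damped mode [j], whose second solution carries a factor [T - s]. *)
Lemma window_exists : exists2 A : R, 0 <= A & forall n, exists f f' : R -> R,
  [/\ nice A f f' /\ supp (T / 2) (3 / 4 * T) f, int0 T f = 1,
    forall j, j != n -> kill T (rr j - rr n) `|om j - om n| f /\
                        kill T (rr j - rr n) (om j + om n) f,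
    om n != 0 -> kill T 0 (2 * om n) f &
    forall j, j != n -> om j = 0 -> kill2 T (rr j - rr n) (om n) f].
Proof.
have [K [th0 [th0p th01 tailK th0K]]] := window_params.
have h0 : 0 <= T / 2 by rewrite divr_ge0// ltW.
have T0 := T_gt0; have hT : T / 2 <= T by lra.
(* The bump takes up [[T / 2, 5 T / 8]] and the translations add at most [T / 8], which ends at
   [3 T / 4]. *)
have [A [y [y' [ny sy y1]]]] : exists A y y', [/\ nice A y y', supp (T / 2) (T / 2 + T / 8) y & int0 T y = 1].
  by apply: bump_exists => //; lra.
have bT : T / 2 + T / 8 + T / 8 <= T by lra.
have A0 : 0 <= A by case: ny => b *; exact: le_trans (normr_ge0 _) (b 0).
exists (kap0 th0 ^+ (4 * K.+1) * A).
  by rewrite mulr_ge0// exprn_ge0// (le_trans ler01)// kap0_ge1.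
move=> n; set a1 := ka1 alpha rho n K th0; set a2 := ka2 alpha rho n K th0.
set a3 := ka3 alpha rho n K th0; set l := kl alpha rho n K th0.
have l0 i : 0 <= l i by exact: kl_ge0.
have aE i : a1 i + a2 i + a3 i = 1 by exact: ksum.
have lL N : \sum_(0 <= i < N) 2 * l i <= T / 8 by exact: kl_sum.
have aP N : \prod_(0 <= i < N) (`|a1 i| + `|a2 i| + `|a3 i|) <= kap0 th0 ^+ (4 * K.+1).
  exact: kap_prod.
have [f [f' [nf sf lf]]] := Phi_limit h0 hT l0 aE lL ny sy aP.
pose U N := Phi a1 a2 a3 l y N.
have sU N : supp (T / 2) (T / 2 + T / 8 + \sum_(0 <= i < N) 2 * l i) (U N) by exact: supp_Phi_eq.
have cU N : continuous (U N) := nice_cont (nice_Phi a1 a2 a3 l ny N).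
have room N : T / 2 + T / 8 + \sum_(0 <= i < N) 2 * l i + 2 * l N <= T by exact: Phi_room lL bT N.
have ann i : kw alpha rho n i != 0 -> forall phi s,
    a1 i * expcos (kx alpha rho n i) (kw alpha rho n i) phi s +
    a2 i * expcos (kx alpha rho n i) (kw alpha rho n i) phi (s + l i) +
    a3 i * expcos (kx alpha rho n i) (kw alpha rho n i) phi (s + 2 * l i) = 0.
  move=> w0 phi s; rewrite /a1 /a2 /a3 /l /ka1 /ka2 /ka3 /kl (negPf w0).
  exact: notch_ann.
have killS x w N : kill T x w (U N) -> kill T x w (U N.+1).
  exact: (kill_op3 (a1 N) (a2 N) (a3 N) h0 hT (l0 N) (room N) (sU N) (@cU N)).
(* An annihilation gained at step [i] survives all later steps, so it also holds in the limit. *)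
have killU i N : kw alpha rho n i != 0 -> (i < N)%N ->
    kill T (kx alpha rho n i) (kw alpha rho n i) (U N).
  move=> w0; elim: N => // N IH; rewrite ltnS leq_eqVlt => /predU1P[iN|/IH]; last exact: killS.
  rewrite -iN; apply: (kill_gain h0 hT (l0 i) (room i) (sU i) (@cU i)); exact: ann.
have evN (u : nat -> R) v i : (forall N, (i < N)%N -> u N = 0) -> u N @[N --> \oo] --> v -> v = 0.
  move=> u0 uv; apply: (cvg_unique _ uv) => //.
  by apply: cvg_near_cst; exists i.+1 => // N /= /u0.
have killf i : kw alpha rho n i != 0 -> kill T (kx alpha rho n i) (kw alpha rho n i) f.
  move=> w0 phi; apply: (evN _ _ i _ (lf _ (@cont_expcos R (kx alpha rho n i) (kw alpha rho n i) phi))) => N iN.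
  exact: (killU i N w0 iN phi).
have oddE j : odd j.*2.+1 by rewrite /= odd_double.
have halfE j : (j.*2.+1)./2 = j by rewrite /= uphalf_double.
have evE j : odd j.*2 = false by rewrite odd_double.
exists f, f'; split => //.
- by split=> // s sh; apply: sf; case: sh => h; [left|right]; lra.
- have := lf (fun=> 1) (@cst_continuous R R 1).
  under [in X in _ --> X -> _]eq_int0 => s _ do rewrite mulr1.
  have -> : (fun N => int0 T (fun s => Phi a1 a2 a3 l y N s * 1)) = cst 1.
    apply/funext => N; under eq_int0 => s _ do rewrite mulr1.
    rewrite fctE; elim: N => [|N IH] //=; rewrite -[RHS]IH.
    exact: (mass_op3 h0 hT (l0 N) (room N) (sU N) (@cU N) (aE N)).
  by move/(cvg_lim (@Rhausdorff R)) => <-; exact: lim_cst.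
- move=> j jn; split.
  + have := killf j.*2; rewrite /kw /kx evE doubleK; apply.
    have jn2 : (j.*2)./2 != n by rewrite doubleK.
    have : 0 < kw alpha rho n j.*2 by apply: kw_gt0 => //; exact: th0p.
    by rewrite /kw evE doubleK => /lt0r_neq0.
  + have := killf j.*2.+1; rewrite /kw /kx oddE halfE; apply.
    have jn2 : (j.*2.+1)./2 != n by rewrite halfE.
    have : 0 < kw alpha rho n j.*2.+1 by apply: kw_gt0 => //; exact: th0p.
    by rewrite /kw oddE halfE => /lt0r_neq0.
- move=> on; have := killf n.*2.+1; rewrite /kw /kx oddE halfE subrr.
  have -> : om n + om n = 2 * om n by ring.
  by apply; rewrite mulf_neq0// pnatr_eq0.
move=> j jn oj phi.
have on : om n != 0.
  have := om_gap alpha_ge0 alpha_lt1 rho_gt0 rho_le2 n j.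
  apply: contraTneq => ->; rewrite oj subrr normr0 -ltNge mulr_gt0 ?subr_gt0//.
  by rewrite dist_sqr exprn_gt0// ltr0n dist_gt0.
(* For a vanishing [om j] the steps [j.*2] and [j.*2.+1] aim at the same frequency [om n]: the first
   gives a simple zero, the second a double one. *)
have w1 : kw alpha rho n j.*2 = om n.
  by rewrite /kw evE doubleK oj sub0r normrN ger0_norm// om_ge0.
have w2 : kw alpha rho n j.*2.+1 = om n by rewrite /kw oddE halfE oj add0r.
have x1 : kx alpha rho n j.*2 = rr j - rr n by rewrite /kx doubleK.
have x2 : kx alpha rho n j.*2.+1 = rr j - rr n by rewrite /kx halfE.
have k1 N : (j.*2 < N)%N -> kill T (rr j - rr n) (om n) (U N).
  by move=> /(@killU j.*2 N); rewrite w1 x1; apply.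
have k2 N : (j.*2.+1 < N)%N -> kill2 T (rr j - rr n) (om n) (U N).
  elim: N => // N IH; rewrite ltnS leq_eqVlt => /predU1P[iN|iN].
    rewrite -iN -x2 -w2.
    apply: (kill2_gain h0 hT (l0 j.*2.+1) (room j.*2.+1) (sU j.*2.+1) (@cU j.*2.+1)).
      by apply: ann; rewrite w2.
    by rewrite w2 x2; exact: k1.
  apply: (kill2_op3 _ _ _ h0 hT (l0 N) (room N) (sU N) (@cU N)); last exact: IH.
  by apply: k1; exact: ltn_trans iN.
apply: (evN _ _ j.*2.+1 _ (lf _ (@cont_id_expcos R (rr j - rr n) (om n) phi))) => N iN.
exact: (k2 N iN phi).
Qed.

End WindowExists.

(** * A biorthogonal family *)

Section Biorthogonal.
Context {R : realType}.
Variables (T alpha rho : R).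
Hypotheses (T_gt0 : 0 < T) (alpha_ge0 : 0 <= alpha) (alpha_lt1 : alpha < 1).
Hypotheses (rho_gt0 : 0 < rho) (rho_le2 : rho <= 2).
Implicit Types (n m j i : nat) (f q : R -> R) (x w v s : R).
Local Notation rr := (rr alpha rho).
Local Notation om := (om alpha rho).

Definition revcos x v s : R := expR (x * s) * cos (v * (T - s)).
Definition revsin x v s : R := expR (x * s) * sin (v * (T - s)).
Definition revsinc x v s : R := expR (x * s) * sinc v (T - s).

Lemma cont_exp x : continuous (fun s : R => expR (x * s)).
Proof. by move=> s; exact: is_derive_cont (der_exp x s). Qed.

Lemma cont_revcos x v : continuous (revcos x v).
Proof. by apply: contM; [exact: cont_exp|apply: (@cont_rev R (fun u => cos (v * u)) T); exact: cont_coslin]. Qed.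

Lemma cont_revsinc x v : continuous (revsinc x v).
Proof. by apply: contM; [exact: cont_exp|apply: cont_rev; exact: cont_sinc]. Qed.

Lemma revsinE x v s : revsin x v s = v * revsinc x v s.
Proof. by rewrite /revsin /revsinc sin_sinc mulrCA. Qed.

Lemma cont_revsin x v : continuous (revsin x v).
Proof.
rewrite (_ : revsin x v = fun s => v * revsinc x v s); last by apply/funext => s; exact: revsinE.
by apply: contZ; exact: cont_revsinc.
Qed.

Lemma revcos_expcos x w s : revcos x w s = expcos x w (- (w * T)) s.
Proof. by rewrite /revcos /expcos -cosN; congr (_ * cos _); ring. Qed.

Lemma revsin_expcos x w s : revsin x w s = expcos x w (pi / 2 - w * T) s.
Proof. by rewrite /revsin /expcos -cosBpihalf -cosN; congr (_ * cos _); ring. Qed.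

Lemma kill_rev x v f : kill T x `|v| f ->
  int0 T (fun s => f s * revcos x v s) = 0 /\ int0 T (fun s => f s * revsin x v s) = 0.
Proof.
case: (ger0P v) => v0 kf.
  split; [under eq_int0 => s _ do rewrite revcos_expcos|under eq_int0 => s _ do rewrite revsin_expcos];
    exact: kf.
have cE s : revcos x v s = expcos x (- v) (v * T) s.
  by rewrite /revcos /expcos; congr (_ * cos _); ring.
have sE s : revsin x v s = expcos x (- v) (v * T - pi / 2) s.
  by rewrite /revsin /expcos -cosBpihalf; congr (_ * cos _); ring.
split; [under eq_int0 => s _ do rewrite cE|under eq_int0 => s _ do rewrite sE];
  exact: kf.
Qed.

(** [revsinc] contains a division by the frequency, hence the weight [m^2], which makes the sine
    moments comparable with the cosine ones. *)
Definition biorth n M qc qs := [/\ osc T M (Om alpha rho n) qc, osc T M (Om alpha rho n) qs &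
  forall j, [/\ int0 T (fun s => qc s * revcos (rr j) (om j) s) = (j == n)%:R,
    int0 T (fun s => qc s * revsinc (rr j) (om j) s) = 0,
    int0 T (fun s => qs s * revcos (rr j) (om j) s) = 0 &
    mode n ^+ 2 * int0 T (fun s => qs s * revsinc (rr j) (om j) s) = (j == n)%:R]].

Lemma biorth_M n M N qc qs : M <= N -> biorth n M qc qs -> biorth n N qc qs.
Proof.
by have T0 := ltW T_gt0; move=> MN [h1 h2 h3]; split=> //; exact: osc_M MN _.
Qed.

Lemma mulr_expN (r : R) : 0 <= r -> r * expR (- r) <= 1.
Proof.
move=> r0; rewrite expRN ler_pdivrMr ?expR_gt0// mul1r.
by apply: le_trans (expR_ge1Dx r); rewrite lerDr.
Qed.

(** On the support, which starts at [T / 2], [r e^(- r s) <= 1 / s <= 2 / T]: the variation is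
    bounded uniformly in the damping rate. *)
Lemma window_BV A r f f' b : 0 <= A -> 0 <= r -> nice A f f' -> supp (T / 2) b f ->
  BV T ((2 / T * A + A) + (2 / T * A + A) * T) (fun s => expR (- r * s) * f s).
Proof.
move=> A0 r0 nf sf; have T0 := ltW T_gt0.
have tA : 0 <= 2 / T * A by rewrite mulr_ge0// divr_ge0.
have [df cf'] := nice_C1 nf; have cf := nice_cont nf.
have T00 : 0 <= T <= T by rewrite T0 lexx.
apply: (@BV_C1 _ _ T_gt0 _ _ _ (fun s => (- r * expR (- r * s)) * f s + expR (- r * s) * f' s) T00).
- by rewrite addr_ge0.
- split; first by move=> s; apply: derM => //; exact: der_exp.
  apply: contD; apply: contM => //; last exact: cont_exp.
  by apply: contZ; exact: cont_exp.
- move=> s /andP[s0 sT]; rewrite normrM ger0_norm ?expR_ge0//.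
  apply: (@le_trans _ _ (1 * A)); last by rewrite mul1r lerDr.
  apply: ler_pM; rewrite ?expR_ge0 ?expR_mulN_le1//; by case: nf.
- move=> s /andP[s0 sT]; apply: (le_trans (ler_normD _ _)); apply: lerD; last first.
    rewrite normrM ger0_norm ?expR_ge0// -[leRHS]mul1r.
    apply: ler_pM; rewrite ?expR_ge0 ?expR_mulN_le1//; by case: nf.
  have [sh|hs] := leP s (T / 2); first by rewrite sf ?mulr0 ?normr0//; left.
  have e0 : 0 <= r * expR (- r * s) by rewrite mulr_ge0// expR_ge0.
  have -> : - r * expR (- r * s) * f s = - (r * expR (- r * s) * f s) by ring.
  rewrite normrN normrM (ger0_norm e0).
  apply: ler_pM => //; last by case: nf.
  have s1 : 0 < s by rewrite (lt_trans _ hs)// divr_gt0.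
  apply: (@le_trans _ _ (s^-1)).
    rewrite -[leRHS]mul1r ler_pdivlMr// mulrAC mulNr; apply: mulr_expN.
    by rewrite mulr_ge0.
  by rewrite -[leRHS]invrK lef_pV2 ?posrE ?invr_gt0 ?divr_gt0// invfM invrK mulrC ltW.
Qed.

Lemma osc_amp t M F w a : BV t M F -> osc t M w (fun s => F s * cos (w * s + a)).
Proof. by move=> bF; exists F => //; exists a. Qed.

Lemma osc_ext t M w f g : (forall s, f s = g s) -> osc t M w f -> osc t M w g.
Proof. by move=> /funext ->. Qed.

(** For the lowest mode the convention [Om 0 = 0] moves the cosine into the amplitude, where its
    frequency, at most 1, costs the factor [2 (1 + T)]. *)
Lemma osc_window n M F a : (om n = 0 -> n != 0%N) -> BV T M F ->
  osc T (2 * M * (1 + T)) (Om alpha rho n) (fun s => F s * cos (om n * s + a)).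
Proof.
move=> on bF; have T0 := ltW T_gt0; have M0 := BV_ge0 T0 bF.
have MM : M <= 2 * M * (1 + T).
  have := mulr_ge0 M0 T0; lra.
rewrite /Om; case: eqP => [n0|_]; last by apply: osc_M MM _ => //; exact: osc_amp.
have [_ o1] := mode0_le alpha_lt1 rho_gt0 rho_le2 n0.
have T00 : 0 <= T <= T by rewrite T0 lexx.
have bc : BV T (1 + 1 * T) (fun s => cos (om n * s + a)).
  apply: (@BV_C1 _ _ T_gt0 _ _ _ (fun s => - om n * sin (om n * s + a)) T00) => //.
  - split; first by move=> s; exact: der_cos.
    by apply: contZ; exact: cont_sin.
  - by move=> s _; exact: norm_cos_le1.
  - move=> s _; rewrite normrM normrN (ger0_norm (om_ge0 _ _ _)) -[leRHS]mulr1.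
    by apply: ler_pM; rewrite ?om_ge0 ?norm_sin_le1.
rewrite mul1r in bc; exists (fun s => F s * cos (om n * s + a)); first exact: BV_mul.
by exists 0 => s; rewrite mul0r addr0 cos0 mulr1.
Qed.

(** This and the next three formulas turn integrals against mode [j] into integrals of the window
    [f] with rate [r_j - r_n] and frequencies [om_j - om_n] and [om_j + om_n], which it annihilates
    for [j != n]. *)
Lemma prod_cc n j f s : 2 * (expR (- rr n * s) * f s) * cos (om n * (T - s)) * revcos (rr j) (om j) s =
  f s * revcos (rr j - rr n) (om j - om n) s + f s * revcos (rr j - rr n) (om j + om n) s.
Proof.
rewrite /revcos !(mulrBl (T - s)) !(mulrDl (om j)) cosB cosD !(mulrBl s) !expRD -(mulNr (rr n)); ring.
Qed.

Lemma prod_cs n j f s : 2 * (expR (- rr n * s) * f s) * cos (om n * (T - s)) * revsin (rr j) (om j) s =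
  f s * revsin (rr j - rr n) (om j - om n) s + f s * revsin (rr j - rr n) (om j + om n) s.
Proof.
rewrite /revsin !(mulrBl (T - s)) !(mulrDl (om j)) sinB sinD !(mulrBl s) !expRD -(mulNr (rr n)); ring.
Qed.

Lemma prod_sc n j f s : 2 * (expR (- rr n * s) * f s) * sin (om n * (T - s)) * revcos (rr j) (om j) s =
  f s * revsin (rr j - rr n) (om j + om n) s - f s * revsin (rr j - rr n) (om j - om n) s.
Proof.
rewrite /revsin /revcos !(mulrBl (T - s)) !(mulrDl (om j)) sinB sinD !(mulrBl s) !expRD -(mulNr (rr n)); ring.
Qed.

Lemma prod_ss n j f s : 2 * (expR (- rr n * s) * f s) * sin (om n * (T - s)) * revsin (rr j) (om j) s =
  f s * revcos (rr j - rr n) (om j - om n) s - f s * revcos (rr j - rr n) (om j + om n) s.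
Proof.
rewrite /revsin /revcos !(mulrBl (T - s)) !(mulrDl (om j)) cosB cosD !(mulrBl s) !expRD -(mulNr (rr n)); ring.
Qed.

End Biorthogonal.

(** * Biorthogonal pairs at nonzero frequency *)

Section BiorthExists.
Context {R : realType}.
Variables (T alpha rho : R).
Hypotheses (T_gt0 : 0 < T) (alpha_ge0 : 0 <= alpha) (alpha_lt1 : alpha < 1).
Hypotheses (rho_gt0 : 0 < rho) (rho_le2 : rho <= 2).
Implicit Types (n m j i : nat) (f q : R -> R) (x w v s : R).
Local Notation rr := (rr alpha rho).
Local Notation om := (om alpha rho).
Local Notation rcos := (revcos T).
Local Notation rsin := (revsin T).
Local Notation rsinc := (revsinc T).

Lemma revsincE x v s : v != 0 -> rsinc x v s = v^-1 * rsin x v s.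
Proof. by move=> v0; rewrite revsinE mulrA mulVf// mul1r. Qed.

(** The factor 2 in [qc] and [qs] offsets the product-to-sum formulas. Against [j = n] the sum
    frequency [2 om n] is annihilated, and the difference frequency 0 leaves the mass 1 of the
    window. *)
Lemma biorth_pos : exists M, forall n, om n != 0 -> exists qc qs, biorth T alpha rho n M qc qs.
Proof.
have T0 := ltW T_gt0.
have [A A0 W] := window_exists T_gt0 alpha_ge0 alpha_lt1 rho_gt0 rho_le2.
set M1 := (2 / T * A + A) + (2 / T * A + A) * T.
exists (2 * (2 * M1) * (1 + T)) => n on.
have [f [f' [[nf sf] f1 kf kn k2]]] := W n.
have r0 := rr_ge0 alpha rho_gt0 n; have cf := nice_cont nf.
have o0 := om_ge0 alpha rho n.
have m0 := mode_ge0 n (R := R); have m2 : 0 < mode n ^+ 2 :> R by rewrite exprn_gt0// mode_gt0.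
have bvF := window_BV T_gt0 A0 r0 nf sf.
have M10 := BV_ge0 T0 bvF.
have onn : om n = 0 -> n != 0%N by move=> o; rewrite o eqxx in on.
pose chi s := expR (- rr n * s) * f s.
pose qc s := 2 * chi s * cos (om n * (T - s)).
pose qs s := om n / mode n ^+ 2 * (2 * chi s * sin (om n * (T - s))).
have cc x v : continuous (fun s => f s * rcos x v s) by apply: contM => //; exact: cont_revcos.
have cs x v : continuous (fun s => f s * rsin x v s) by apply: contM => //; exact: cont_revsin.
have Kc j : j != n -> int0 T (fun s => f s * rcos (rr j - rr n) (om j - om n) s) = 0 /\
    int0 T (fun s => f s * rsin (rr j - rr n) (om j - om n) s) = 0.
  by move=> /kf[h _]; exact: kill_rev.
have Ks j : j != n -> int0 T (fun s => f s * rcos (rr j - rr n) (om j + om n) s) = 0 /\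
    int0 T (fun s => f s * rsin (rr j - rr n) (om j + om n) s) = 0.
  by move=> /kf[_ h]; apply: kill_rev; rewrite ger0_norm// addr_ge0// om_ge0.
have Kn : int0 T (fun s => f s * rcos (rr n - rr n) (om n + om n) s) = 0 /\
    int0 T (fun s => f s * rsin (rr n - rr n) (om n + om n) s) = 0.
  apply: kill_rev; rewrite subrr ger0_norm ?addr_ge0//.
  by have := kn on; rewrite mulr2n mulrDl mul1r.
have Kc0 : int0 T (fun s => f s * rcos (rr n - rr n) (om n - om n) s) = 1.
  by rewrite -f1; apply: eq_int0 => s _; rewrite /revcos !subrr !mul0r expR0 cos0 !mulr1.
have Ks0 : int0 T (fun s => f s * rsin (rr n - rr n) (om n - om n) s) = 0.
  rewrite -(int0_0 T); apply: eq_int0 => s _.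
  by rewrite /revsin !subrr !mul0r sin0 !mulr0.
have Icc j : int0 T (fun s => qc s * rcos (rr j) (om j) s) = (j == n)%:R.
  under eq_int0 => s _ do rewrite /qc /chi prod_cc.
  rewrite int0D//; case: eqP => [->|/eqP jn]; first by rewrite Kc0 Kn.1 addr0.
  by rewrite (Kc j jn).1 (Ks j jn).1 addr0.
have Ics j : int0 T (fun s => qc s * rsin (rr j) (om j) s) = 0.
  under eq_int0 => s _ do rewrite /qc /chi prod_cs.
  rewrite int0D//; case: (eqVneq j n) => [->|jn]; first by rewrite Ks0 Kn.2 addr0.
  by rewrite (Kc j jn).2 (Ks j jn).2 addr0.
pose qs' s := 2 * chi s * sin (om n * (T - s)).
have Isc j : int0 T (fun s => qs' s * rcos (rr j) (om j) s) = 0.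
  under eq_int0 => s _ do rewrite /qs' /chi prod_sc.
  rewrite int0B//; case: (eqVneq j n) => [->|jn]; first by rewrite Ks0 Kn.2 subr0.
  by rewrite (Kc j jn).2 (Ks j jn).2 subr0.
have Iss j : int0 T (fun s => qs' s * rsin (rr j) (om j) s) = (j == n)%:R.
  under eq_int0 => s _ do rewrite /qs' /chi prod_ss.
  rewrite int0B//; case: eqP => [->|/eqP jn]; first by rewrite Kc0 Kn.1 subr0.
  by rewrite (Kc j jn).1 (Ks j jn).1 subr0.
have cchi : continuous chi by apply: contM => //; exact: cont_exp.
have cqc : continuous qc.
  by apply: contM; [exact: contZ|apply: (@cont_rev R (fun u => cos (om n * u)) T); exact: cont_coslin].
have cqs' : continuous qs'.
  apply: contM; first exact: contZ.
  rewrite (_ : (fun s => _) = fun s => om n * sinc (om n) (T - s)); last by apply/funext => s; exact: sin_sinc.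
  by apply: contZ; apply: cont_rev; exact: cont_sinc.
(* Here the kernel is [(T - s) e^(r_j s)]: simple annihilation disposes of the part with [T], double
   annihilation of the part with [s]. *)
have deg j : om j = 0 -> int0 T (fun s => qc s * rsinc (rr j) (om j) s) = 0 /\
    int0 T (fun s => qs' s * rsinc (rr j) (om j) s) = 0.
  move=> oj; have jn : j != n by apply: contraNneq on => <-; rewrite oj.
  have := Ks j jn; rewrite oj add0r => -[kc ks].
  have k2j := k2 j jn oj.
  have ci (g : R -> R) : continuous g -> continuous (fun s => f s * (s * g s)).
    by move=> cg; apply: contM => //; apply: contM => // s; exact: cvg_id.
  have h g : continuous g -> int0 T (fun s => f s * g s) = 0 -> int0 T (fun s => f s * (s * g s)) = 0 ->
     int0 T (fun s => 2 * T * (f s * g s) + -2 * (f s * (s * g s))) = 0.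
    move=> cg i1 i2; have c1 := contM cf cg; have c2 := ci g cg.
    rewrite int0D; [|exact: contZ|exact: contZ].
    by rewrite !int0Z// i1 i2 !mulr0 addr0.
  split.
  - rewrite -[RHS](h _ (@cont_revcos _ T (rr j - rr n) (om n)) kc).
      apply: eq_int0 => s _; rewrite /qc /chi /revsinc /revcos /sinc eqxx.
      by rewrite (mulrBl s) expRD -(mulNr (rr n)); ring.
    by under eq_int0 => s _ do rewrite revcos_expcos; exact: k2j.
  - rewrite -[RHS](h _ (@cont_revsin _ T (rr j - rr n) (om n)) ks).
      apply: eq_int0 => s _; rewrite /qs' /chi /revsinc /revsin /sinc eqxx.
      by rewrite (mulrBl s) expRD -(mulNr (rr n)); ring.
    by under eq_int0 => s _ do rewrite revsin_expcos; exact: k2j.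
exists qc, qs; split.
- apply: (@osc_ext R T _ _ (fun s => 2 * chi s * cos (om n * s + - (om n * T)))).
    by move=> s; rewrite /qc -[in RHS]cosN; congr (_ * cos _); ring.
  apply: osc_window => //; have := BV_scale 2 T0 bvF; by rewrite ger0_norm.
- apply: (@osc_ext R T _ _ (fun s => (om n / mode n ^+ 2 * 2) * chi s * cos (om n * s + (pi / 2 - om n * T)))).
    move=> s; rewrite /qs -[in RHS]cosBpihalf -[in RHS]cosN !mulrA; congr (_ * cos _); ring.
  apply: osc_window => //; apply: BV_M (BV_scale (om n / mode n ^+ 2 * 2) T0 bvF) => //.
  rewrite ler_wpM2r// ger0_norm ?mulr_ge0 ?invr_ge0 ?sqr_ge0// ler_piMl//.
  by rewrite ler_pdivrMr// mul1r om_le.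
move=> j; split => //.
- case: (eqVneq (om j) 0) => [/deg[]//|oj].
  under eq_int0 => s _ do rewrite revsincE// mulrCA.
  rewrite int0Z ?Ics ?mulr0//; apply: contM => //; exact: cont_revsin.
- under eq_int0 => s _ do rewrite /qs -mulrA.
  rewrite int0Z ?Isc ?mulr0//; apply: contM => //; exact: cont_revcos.
- under eq_int0 => s _ do rewrite /qs -mulrA.
  rewrite int0Z; last by apply: contM => //; exact: cont_revsinc.
  case: (eqVneq (om j) 0) => [/[dup] oj /deg[_ ->]|oj].
    by rewrite !mulr0; case: eqP => // jn; move: on; rewrite -jn oj eqxx.
  under eq_int0 => s _ do rewrite revsincE// mulrCA.
  rewrite int0Z ?Iss; last by apply: contM => //; exact: cont_revsin.
  case: eqP => [->|_]; last by rewrite !mulr0.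
  by field; rewrite on gt_eqF.
Qed.

End BiorthExists.

(** * The critically damped lowest mode *)

Section BiorthDegenerate.
Context {R : realType}.
Variables (T alpha rho : R).
Hypotheses (T_gt0 : 0 < T) (alpha_ge0 : 0 <= alpha) (alpha_lt1 : alpha < 1).
Hypotheses (rho_gt0 : 0 < rho) (rho_le2 : rho <= 2).
Implicit Types (n m j i : nat) (f q : R -> R) (x w v s : R).
Local Notation rr := (rr alpha rho).
Local Notation om := (om alpha rho).
Local Notation rcos := (revcos T).
Local Notation rsin := (revsin T).
Local Notation rsinc := (revsinc T).

Lemma om_eq0 n : om n = 0 -> n = 0%N.
Proof.
move=> on; apply/eqP; rewrite -leqn0 leqNgt; apply/negP => n0.
by have [_] := om_lower alpha_ge0 alpha_lt1 rho_gt0 rho_le2 n0; rewrite on ltxx.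
Qed.

(** The kernels are [e^(r s)] and [(T - s) e^(r s)], so the mass and the first moment of the window
    must be prescribed. Two translates of one window give [a + b] and [(a + b) m1 - b T / 8], a
    solvable linear system in [a], [b]. *)
Lemma biorth_deg : om 0 = 0 -> exists M qc qs, biorth T alpha rho 0 M qc qs.
Proof.
move=> o0; have T0 := ltW T_gt0.
have [A A0 W] := window_exists T_gt0 alpha_ge0 alpha_lt1 rho_gt0 rho_le2.
have [f [f' [[nf sf] f1 kf _ _]]] := W 0%N.
have r0 := rr_ge0 alpha rho_gt0 0; have cf := nice_cont nf.
have e0 : 0 <= T / 8 by rewrite divr_ge0.
have e1 : T / 8 != 0 by rewrite gt_eqF// divr_gt0.
have h0 : 0 <= T / 2 by rewrite divr_ge0.
have TT := T_gt0; have hT : T / 2 <= T by lra.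
(* A window ending at [3 T / 4] leaves room for exactly the length [2 T / 8] allotted to [op3],
   although its last coefficient is 0 here. *)
have room : 3 / 4 * T + 2 * (T / 8) <= T by lra.
have cid : continuous (fun s : R => T - s).
  by move=> s; apply: cvgB; [exact: cvg_cst|exact: cvg_id].
pose m1 := int0 T (fun s => f s * (T - s)).
pose h a b := op3 a b 0 (T / 8) f.
pose q a b s := expR (- rr 0 * s) * h a b s.
have nh a b := nice_op3 a b 0 (T / 8) nf.
have ch a b : continuous (h a b) := nice_cont (nh a b).
have mass a b : int0 T (h a b) = a + b.
  have := int0_op3 a b 0 h0 hT e0 room sf cf (@cst_continuous R R 1).
  under eq_int0 => s _ do rewrite mulr1; move=> ->.
  under eq_int0 => s _ do rewrite !mulr1 addr0 mulrC.
  by rewrite int0Z// f1 mulr1.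
have mom a b : int0 T (fun s => h a b s * (T - s)) = (a + b) * m1 - b * (T / 8).
  rewrite (int0_op3 a b 0 h0 hT e0 room sf cf cid).
  transitivity (int0 T (fun s => (a + b) * (f s * (T - s)) - (b * (T / 8)) * f s)).
    by apply: eq_int0 => s _; ring.
  rewrite int0B; [|by apply: contZ; exact: contM|exact: contZ].
  by rewrite !int0Z ?f1 ?mulr1//; exact: contM.
have oscq a b : exists M, osc T M (Om alpha rho 0) (q a b).
  have sh : supp (T / 2) (3 / 4 * T + 2 * (T / 8)) (h a b) by apply: supp_op3.
  have Ah := le_trans (normr_ge0 _) (nice_bnd (nh a b) 0).
  have bv := window_BV T_gt0 Ah r0 (nh a b) sh.
  eexists; exists (q a b); first exact: bv.
  by exists 0 => s; rewrite /Om eqxx mul0r addr0 cos0 mulr1.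
have q0c a b : int0 T (fun s => q a b s * rcos (rr 0) (om 0) s) = a + b.
  rewrite -mass; apply: eq_int0 => s _; rewrite /q /revcos o0 mul0r cos0 mulr1.
  by rewrite mulrAC -expRD mulNr addNr expR0 mul1r.
have q0s a b : int0 T (fun s => q a b s * rsinc (rr 0) (om 0) s) = (a + b) * m1 - b * (T / 8).
  rewrite -mom; apply: eq_int0 => s _; rewrite /q /revsinc o0 /sinc eqxx.
  by rewrite mulrACA -expRD mulNr addNr expR0 mul1r.
have Kh a b j : j != 0%N -> kill T (rr j - rr 0) `|om j| (h a b).
  move=> /kf[k _]; rewrite o0 subr0 in k.
  exact: (kill_op3 a b 0 h0 hT e0 room sf cf k).
have qj a b j : j != 0%N -> int0 T (fun s => q a b s * rcos (rr j) (om j) s) = 0 /\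
   int0 T (fun s => q a b s * rsinc (rr j) (om j) s) = 0.
  move=> j0; have [kc ks] := kill_rev (Kh a b j j0).
  have oj : om j != 0 by apply: contraNneq j0 => /om_eq0 ->.
  split.
    rewrite -[RHS]kc; apply: eq_int0 => s _; rewrite /q /revcos.
    by rewrite (mulrBl s) expRD -(mulNr (rr 0)); ring.
  transitivity (int0 T (fun s => (om j)^-1 * (h a b s * rsin (rr j - rr 0) (om j) s))).
    apply: eq_int0 => s _; rewrite /q revsincE// /revsin.
    by rewrite (mulrBl s) expRD -(mulNr (rr 0)); ring.
  by rewrite int0Z ?ks ?mulr0//; apply: contM => //; exact: cont_revsin.
(* The solutions of the system for mass and first moment equal to [1, 0] and to [0, 1]. *)
pose b1 := m1 / (T / 8); pose b2 := - (T / 8)^-1.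
have [M1 O1] := oscq (1 - b1) b1; have [M2 O2] := oscq (- b2) b2.
have M10 := osc_ge0 T0 O1; have M20 := osc_ge0 T0 O2.
exists (M1 + M2), (q (1 - b1) b1), (q (- b2) b2); split.
- by apply: osc_M O1; rewrite ?lerDl.
- by apply: osc_M O2; rewrite ?lerDr.
move=> [|j].
  rewrite !q0c !q0s eqxx; split; rewrite ?subrK ?addNr//.
    by rewrite mul1r /b1 divfK// subrr.
  by rewrite mul0r sub0r /b2 mulNr opprK mulVf// mulr1 /mode expr1n.
have [c1 s1] := qj (1 - b1) b1 j.+1 isT; have [c2 s2] := qj (- b2) b2 j.+1 isT.
by rewrite c1 s1 c2 s2 mulr0.
Qed.

Lemma biorth_exists : exists M, forall n, exists qc qs, biorth T alpha rho n M qc qs.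
Proof.
have T0 := ltW T_gt0.
have [M1 H1] := biorth_pos T_gt0 alpha_ge0 alpha_lt1 rho_gt0 rho_le2.
case: (eqVneq (om 0) 0) => o0; last first.
  exists M1 => n; apply: H1; apply: contraNneq o0 => /[dup] on /om_eq0 n0.
  by rewrite -n0 on.
have [M2 [qc [qs B]]] := biorth_deg o0.
exists (Num.max M1 M2) => n; case: (eqVneq (om n) 0) => [/om_eq0 ->|/H1[qc' [qs' B']]].
  by exists qc, qs; apply: biorth_M B; rewrite // le_max lexx orbT.
by exists qc', qs'; apply: biorth_M B'; rewrite // le_max lexx.
Qed.

End BiorthDegenerate.

(** * The spectral scale and time regularity of modewise solutions *)

Section XDspaces.
Context {R : realType}.
Implicit Types (a b D : nat -> R) (p B e : R).

Lemma XDterms_ge0 p a n : 0 <= XDterms p a n.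
Proof. by rewrite /XDterms mulr_ge0 ?powR_ge0// exprn_ge0. Qed.

Lemma XDterms1 a n : XDterms 1 a n = (mode n * `|a n|) ^+ 2.
Proof. by rewrite /XDterms mulr1 powR_mulrn ?mode_ge0// exprMn. Qed.

Lemma XDtermsN1 a n : XDterms (-1) a n = (`|a n| / mode n) ^+ 2.
Proof.
rewrite /XDterms mulrN1 powRN powR_mulrn ?mode_ge0//.
by rewrite expr_div_n mulrC.
Qed.

Lemma in_XDP p a B : (forall N, \sum_(0 <= n < N) XDterms p a n <= B) -> in_XD p a.
Proof. by move=> H; apply: (sum_cvg (fun n => XDterms_ge0 p a n) H). Qed.

Lemma in_XD_dom p a D B : (forall N, \sum_(0 <= n < N) D n <= B) ->
  (forall n, XDterms p a n <= D n) -> in_XD p a.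
Proof.
move=> DB aD; apply: (in_XDP (B := B)) => N; apply: le_trans (DB N).
by apply: ler_sum.
Qed.

Lemma XDnorm_ge0 p a : 0 <= XDnorm p a.
Proof. exact: sqrtr_ge0. Qed.

Lemma XD_nondecr p a : nondecreasing_seq (series (XDterms p a)).
Proof.
by apply/nondecreasing_seqP => n; rewrite /series/= big_nat_recr//= lerDl// XDterms_ge0.
Qed.

Lemma XD_sum_le p a N : in_XD p a -> \sum_(0 <= n < N) XDterms p a n <= XDnorm p a ^+ 2.
Proof.
move=> ca; have h := nondecreasing_cvgn_le (@XD_nondecr p a) ca.
rewrite sqr_sqrtr; first exact: h.
by apply: le_trans (h 0%N); rewrite /series/= big_geq.
Qed.

Lemma XDnorm_le p a e : 0 <= e -> (forall N, \sum_(0 <= n < N) XDterms p a n <= e ^+ 2) ->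
  XDnorm p a <= e.
Proof.
move=> e0 H; have ca := in_XDP H.
have -> : e = Num.sqrt (e ^+ 2) by rewrite sqrtr_sqr ger0_norm.
by apply: ler_wsqrtr; apply: limr_le => //; apply: nearW.
Qed.

Lemma cvg_sum0 (I : Type) (F : set_system I) (FF : Filter F) (u : I -> nat -> R) N :
  (forall n, u s n @[s --> F] --> (0 : R)) ->
  \sum_(0 <= n < N) u s n @[s --> F] --> (0 : R).
Proof.
move=> uF; elim: N => [|N IH].
  under eq_fun do rewrite big_geq//; exact: cvg_cst.
have := cvgD IH (uF N); rewrite addr0.
have -> // : (fun s => \sum_(0 <= n < N) u s n) + u^~ N = (fun s => \sum_(0 <= n < N.+1) u s n).
by apply/funext => s; rewrite [RHS]big_nat_recr.
exact.
Qed.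

(** Dominated convergence: beyond [N0] the majorant is small, and below it finitely many terms tend
    to 0. *)
Lemma XD_dom_cvg (F : set_system R) (FF : Filter F) p (x : R -> nat -> R) D B :
  (forall n, 0 <= D n) -> (forall N, \sum_(0 <= n < N) D n <= B) ->
  (\forall s \near F, forall n, XDterms p (x s) n <= D n) ->
  (forall n, x s n @[s --> F] --> (0 : R)) ->
  XDnorm p (x s) @[s --> F] --> (0 : R).
Proof.
move=> D0 DB xD x0; apply/cvgrPdist_le => e e0.
have e2 : 0 < e ^+ 2 / 2 by rewrite divr_gt0// exprn_gt0.
have [N0 HN0] := sum_tail D0 DB e2.
have T0 n : XDterms p (x s) n @[s --> F] --> (0 : R).
  have h : `|x s n| @[s --> F] --> (0 : R) by have := @cvg_norm _ _ _ _ FF _ _ (x0 n); rewrite normr0.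
  have h2 : `|x s n| * `|x s n| @[s --> F] --> (0 : R) by have := @cvgM _ _ _ FF _ _ _ _ h h; rewrite mulr0.
  by have := @cvgM _ _ _ FF _ _ _ _ (cvg_cst (mode n `^ (2 * p))) h2; rewrite mulr0; apply.
have := cvg_sum0 FF N0 T0 => /cvgrPdist_le/(_ _ e2) H.
near=> s; rewrite sub0r normrN ger0_norm ?XDnorm_ge0//.
apply: XDnorm_le; first exact: ltW.
move=> N; have sD : forall n, XDterms p (x s) n <= D n by near: s.
have hN : \sum_(0 <= n < N0) XDterms p (x s) n <= e ^+ 2 / 2.
  apply: le_trans (ler_norm _) _; rewrite -normrN -[in leLHS]sub0r.
  by near: s.
apply: (@le_trans _ _ (\sum_(0 <= n < N0 + N) XDterms p (x s) n)).
  have NN : (N <= N0 + N)%N by rewrite leq_addl.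
  by rewrite [leRHS](big_cat_nat (leq0n N) NN)//= lerDl sumr_ge0// => *; exact: XDterms_ge0.
rewrite (big_cat_nat (leq0n N0) (leq_addr N N0))//=.
rewrite [leRHS](_ : _ = e ^+ 2 / 2 + e ^+ 2 / 2); last by field.
by apply: lerD => //; apply: (le_trans _ (HN0 N0 (N0 + N)%N (leqnn _))); apply: ler_sum.
Unshelve. all: by end_near.
Qed.

Lemma within_cvg0 T t (h : R -> R) :
  (forall e, 0 < e -> exists2 d, 0 < d & forall s, 0 <= s <= T -> `|s - t| < d -> `|h s| <= e) ->
  h s @[s --> within `[0, T] (nbhs t)] --> (0 : R).
Proof.
move=> H; apply/cvgrPdist_le => e /H[d d0 hd].
rewrite near_withinE; exists d => // s /= st; rewrite in_itv/= => sT.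
by rewrite sub0r normrN; apply: hd => //; rewrite distrC.
Qed.

Lemma dwithin_cvg0 T t (h : R -> R) :
  (forall e, 0 < e -> exists2 d, 0 < d &
    forall s, 0 <= s <= T -> s != t -> `|s - t| < d -> `|h s| <= e) ->
  h s @[s --> within `[0, T] t^'] --> (0 : R).
Proof.
move=> H; apply/cvgrPdist_le => e /H[d d0 hd].
rewrite near_withinE; exists d => // s /= st sx; rewrite in_itv/= => sT.
by rewrite sub0r normrN; apply: hd => //; rewrite distrC.
Qed.

End XDspaces.

(** * Differentiability through mean value inequalities *)

Section MeanValue.
Context {R : realType}.
Implicit Types (v : R -> R) (T s t b B e : R).

(* A form of [v' = dv/dt on [0, T]] that passes to uniform limits. *)
Definition MVI T v (v' : R -> R) := forall s t b B, 0 <= s <= T -> 0 <= t <= T ->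
  (forall x, 0 <= x <= T -> `|x - t| <= `|s - t| -> `|v' x - b| <= B) ->
  `|v s - v t - (s - t) * b| <= B * `|s - t|.

Definition cont0 T v := forall t e, 0 <= t <= T -> 0 < e ->
  exists2 d, 0 < d & forall s, 0 <= s <= T -> `|s - t| < d -> `|v s - v t| <= e.

Definition ulim T (vN : nat -> R -> R) v := forall e, 0 < e ->
  exists N0, forall N s, (N0 <= N)%N -> 0 <= s <= T -> `|vN N s - v s| <= e.

Lemma deriv_MVI T v v' : (forall x, 0 <= x <= T -> is_derive x 1 v (v' x)) -> MVI T v v'.
Proof.
move=> dv s t b B sT tT H.
suff [c [cT ct vE]] : exists c, [/\ 0 <= c <= T, `|c - t| <= `|s - t| & v s - v t = v' c * (s - t)].
  by rewrite vE mulrC -mulrBr normrM mulrC ler_wpM2r// H.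
have aux x y : 0 <= x <= T -> 0 <= y <= T -> x <= y ->
    exists2 c, x <= c <= y & v y - v x = v' c * (y - x).
  move=> /andP[x0 xT] /andP[y0 yT] xy; have [||c] := @MVT_segment R v v' x y xy.
  - by move=> z; rewrite in_itv/= => /andP[/ltW xz /ltW zy]; apply: dv; rewrite (le_trans x0)// (le_trans zy).
  - apply/subspace_continuousP => z /=; rewrite in_itv/= => /andP[xz zy].
    apply: cvg_within_filter; apply: (@is_derive_cont R v (v' z)).
    by apply: dv; rewrite (le_trans x0)// (le_trans zy).
  by rewrite in_itv/= => h1 h2; exists c.
case/andP: (sT) => s0 s1; case/andP: (tT) => t0 t1.
case: (leP t s) => st.
  have [c /andP[c1 c2] vE] := aux t s tT sT st; exists c; split => //.
    by rewrite (le_trans t0)// (le_trans c2).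
  by rewrite !ger0_norm ?subr_ge0//; lra.
have [c /andP[c1 c2] vE] := aux s t sT tT (ltW st); exists c; split => //.
- by rewrite (le_trans s0)// (le_trans c2).
- by rewrite distrC (distrC s) !ger0_norm ?subr_ge0 ?(ltW st)//; lra.
- by rewrite -opprB vE; ring.
Qed.

Lemma ulim_MVI T (vN vN' : nat -> R -> R) v v' : (forall N, MVI T (vN N) (vN' N)) ->
  ulim T vN v -> ulim T vN' v' -> MVI T v v'.
Proof.
move=> mN uv uv' s t b B sT tT H; apply/ler_addgt0Pr => e e0.
have e1 : 0 < e / (2 + `|s - t|) by rewrite divr_gt0// ltr_wpDr.
have [N1 H1] := uv _ e1; have [N2 H2] := uv' _ e1.
have m1 : (N1 <= maxn N1 N2)%N by rewrite leq_maxl.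
have m2 : (N2 <= maxn N1 N2)%N by rewrite leq_maxr.
set N := maxn N1 N2 in m1 m2; set e' := e / _ in H1 H2 e1.
have h : `|vN N s - vN N t - (s - t) * b| <= (B + e') * `|s - t|.
  apply: mN => // x xT xt; rewrite -(subrK (v' x) (vN' N x)) -addrA addrC.
  by apply: (le_trans (ler_normD _ _)); rewrite lerD// ?H// H2.
have -> : v s - v t - (s - t) * b = (vN N s - vN N t - (s - t) * b)
   + (vN N t - v t) - (vN N s - v s) by ring.
apply: (le_trans (ler_normB _ _)); apply: (le_trans (lerD (ler_normD _ _) (lexx _))).
apply: (le_trans (lerD (lerD h (H1 _ _ m1 tT)) (H1 _ _ m1 sT))).
have -> : e = e' * (2 + `|s - t|) by rewrite divfK// gt_eqF// ltr_wpDr.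
by rewrite le_eqVlt; apply/orP; left; apply/eqP; ring.
Qed.

Lemma ulim_cont0 T (vN : nat -> R -> R) v : (forall N, cont0 T (vN N)) -> ulim T vN v -> cont0 T v.
Proof.
move=> cN uv t e tT e0; have e3 : 0 < e / 3 by rewrite divr_gt0.
have [N /(_ N _ (leqnn _)) H] := uv _ e3; have [d d0 hd] := cN N t _ tT e3.
exists d => // s sT sd.
have -> : v s - v t = (vN N s - vN N t) + (vN N t - v t) - (vN N s - v s) by ring.
apply: (le_trans (ler_normB _ _)); apply: (le_trans (lerD (ler_normD _ _) (lexx _))).
apply: (le_trans (lerD (lerD (hd s sT sd) (H t tT)) (H s sT))); lra.
Qed.

Lemma continuous_cont0 T v : (forall t, 0 <= t <= T -> {for t, continuous v}) -> cont0 T v.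
Proof.
move=> cv t e tT e0; have := cv t tT => /cvgrPdist_le/(_ _ e0)[d d0 hd].
by exists d => // s _ sd; rewrite distrC; apply: hd; rewrite /= distrC.
Qed.

Lemma cont0_D T v1 v2 : cont0 T v1 -> cont0 T v2 -> cont0 T (fun t => v1 t + v2 t).
Proof.
move=> c1 c2 t e tT e0; have e2 : 0 < e / 2 by rewrite divr_gt0.
have [d1 d10 h1] := c1 t _ tT e2; have [d2 d20 h2] := c2 t _ tT e2.
exists (Num.min d1 d2) => [|s sT]; first by rewrite lt_min d10.
rewrite lt_min => /andP[s1 s2]; rewrite opprD addrACA.
apply: (le_trans (ler_normD _ _)); have := h1 s sT s1; have := h2 s sT s2; lra.
Qed.

Lemma cont0_Z T a v : cont0 T v -> cont0 T (fun t => a * v t).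
Proof.
move=> cv t e tT e0; have a1 : 0 < `|a| + 1 by rewrite ltr_wpDl.
have [d d0 hd] := cv t _ tT (divr_gt0 e0 a1); exists d => // s sT /(hd s sT) h.
rewrite -mulrBr normrM; apply: (le_trans (ler_wpM2l (normr_ge0 a) h)).
by rewrite mulrCA ger_pMr// ler_pdivrMr// mul1r lerDl.
Qed.

Lemma MVI_bnd T v v' B s t : MVI T v v' -> 0 <= s <= T -> 0 <= t <= T ->
  (forall x, 0 <= x <= T -> `|v' x| <= B) -> `|v s - v t| <= B * `|s - t|.
Proof.
move=> m sT tT vB; have := m s t 0 B sT tT; rewrite mulr0 subr0; apply => x xT _.
by rewrite subr0 vB.
Qed.

(** The mean value inequality with [b = v' t], on a neighbourhood where [v'] deviates from this
    value by at most [e]. *)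
Lemma MVI_deriv T v v' t e : MVI T v v' -> cont0 T v' -> 0 <= t <= T -> 0 < e ->
  exists2 d, 0 < d & forall s, 0 <= s <= T -> s != t -> `|s - t| < d ->
    `|(s - t)^-1 * (v s - v t) - v' t| <= e.
Proof.
move=> m c tT e0; have [d d0 hd] := c t e tT e0; exists d => // s sT st sd.
have := m s t (v' t) e sT tT (fun x xT xs => hd x xT (le_lt_trans xs sd)).
have st0 : s - t != 0 by rewrite subr_eq0.
have -> : v s - v t - (s - t) * v' t = (s - t) * ((s - t)^-1 * (v s - v t) - v' t).
  by rewrite mulrBr mulrA mulfV// mul1r.
by rewrite normrM mulrC ler_pM2r// normr_gt0.
Qed.

End MeanValue.

(** * Duhamel integrals with an L^2 datum *)

Section Response.
Context {R : realType}.
Implicit Types (k v : R -> R) (t A e : R).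

Definition L2lim t (g : R -> R) (G : nat -> R -> R) := forall e, 0 < e ->
  exists N0, forall N, (N0 <= N)%N -> (L2norm t (fun s => g s - G N s)%R <= e%:E)%E.

Definition conv k (g : R -> R) t : R := int0 t (fun s => k (t - s) * g s).

Variables (T r w : R).
Hypotheses (T_ge0 : 0 <= T) (r_ge0 : 0 <= r).

Lemma L2lim_t t g G : t <= T -> in_L2 T g -> (forall N, continuous (G N)) ->
  L2lim T g G -> L2lim t g G.
Proof.
move=> tT L2g cG H e e0; have [N0 HN0] := H e e0; exists N0 => N /HN0.
apply: L2norm_t => //; first exact: ltW.
apply: measurable_funB; [exact: in_L2_meas|exact: meas_cont].
Qed.

Lemma conv0 k g : conv k g 0 = 0.
Proof. by rewrite /conv /int0 set_itv_ge ?bnd_simp ?ltxx// Rintegral_set0. Qed.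

(** Cauchy-Schwarz, with a kernel norm at most [A (1 + T)] for every [t] in [[0, T]]; hence
    convergence is uniform in [t]. *)
Lemma conv_ulim k A g G : continuous k -> (forall x, 0 <= x <= T -> `|k x| <= A) ->
  in_L2 T g -> (forall N, continuous (G N)) -> L2lim T g G ->
  ulim T (fun N => conv k (G N)) (conv k g).
Proof.
move=> ck kA L2g cG H e e0; have TT := T_ge0.
have A0 : 0 <= A by apply: le_trans (normr_ge0 (k 0)) _; apply: kA; rewrite lexx.
have AT : 0 <= A * (1 + T) by rewrite mulr_ge0// addr_ge0.
have e1 : 0 < e / (A * (1 + T) + 1) by rewrite divr_gt0// ltr_wpDl.
have [N0 HN0] := H _ e1; exists N0 => N t /HN0 {}HN0 /andP[t0 tT].
have ckt : continuous (fun s => k (t - s)%R) by exact: cont_rev.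
have kn : (L2norm t (fun s => k (t - s)%R) <= (A * (1 + T))%:E)%E.
  apply: L2norm_le => //; rewrite sqI_cont// lee_fin.
  apply: (@le_trans _ _ (A ^+ 2 * t)).
    rewrite -int0_cst//; apply: le_int0 => [s|s|s /andP[s0 st]].
    - by apply: contM.
    - exact: cst_continuous.
    - by rewrite -real_normK ?num_real// ler_sqr ?nnegrE// kA//; lra.
  rewrite exprMn ler_wpM2l ?exprn_ge0//; nra.
have mg : measurable_fun `]0, t[ g by apply: in_L2_meas; exact: in_L2_t L2g.
have mG : measurable_fun `]0, t[ (G N) by exact: meas_cont.
have mgT : measurable_fun `]0, T[ (fun s => g s - G N s).
  by apply: measurable_funB; [exact: in_L2_meas|exact: meas_cont].
have hN := L2norm_t tT (ltW e1) mgT HN0.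
have [_] := L2norm_cauchy (meas_cont ckt) (measurable_funB mg mG) kn hN.
have L2kt := in_L2_cont t ckt; have L2gt := in_L2_t tT L2g; have L2Gt := in_L2_cont t (cG N).
under eq_int0 do rewrite mulrBr.
rewrite /int0 RintegralB//; try exact: in_L2_mul.
rewrite distrC /conv/int0 => /le_trans; apply.
have AT1 : 0 < A * (1 + T) + 1 by rewrite ltr_wpDl.
by rewrite mulrCA ger_pMr// ler_pdivrMr// mul1r; lra.
Qed.

Lemma cont0_ext v1 v2 : (forall t, 0 <= t <= T -> v1 t = v2 t) -> cont0 T v1 -> cont0 T v2.
Proof.
move=> e1 c t e tT e0; have [d d0 hd] := c t e tT e0; exists d => // s sT sd.
by rewrite -!e1// hd.
Qed.

(** By the addition formulas the convolutions agree on [[0, T]] with combinations of [SS t], [CC t]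
    and primitives. These extend differentiably across the end points, hence the auxiliary [v]. *)
Lemma conv_cont G : continuous G ->
  [/\ exists v dv, forall t, 0 <= t <= T ->
        [/\ is_derive t 1 v (dv t), v t = conv (SS r w) G t
          & dv t = conv (CC r w) G t - r * conv (SS r w) G t],
      cont0 T (conv (CC r w) G) & cont0 T (conv (SS r w) G)].
Proof.
move=> cG.
have cc : continuous (fun s => CC r w (0 - s) * G s) by apply: contM => //; apply: cont_rev; exact: cont_CC.
have cs : continuous (fun s => SS r w (0 - s) * G s) by apply: contM => //; apply: cont_rev; exact: cont_SS.
have [Fc dFc] := primitive (-1) cc; have [Fs dFs] := primitive (-1) cs.
have dFc' t : 0 <= t -> is_derive t 1 (fun s => Fc s - Fc 0) (CC r w (0 - t) * G t).
  move=> t0; have t1 : -1 < t by lra.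
  by have := derB (dFc t t1) (der_cst (Fc 0) t); rewrite subr0.
have dFs' t : 0 <= t -> is_derive t 1 (fun s => Fs s - Fs 0) (SS r w (0 - t) * G t).
  move=> t0; have t1 : -1 < t by lra.
  by have := derB (dFs t t1) (der_cst (Fs 0) t); rewrite subr0.
pose vS t := SS r w t * (Fc t - Fc 0) + CC r w t * (Fs t - Fs 0).
pose vC t := CC r w t * (Fc t - Fc 0) - w ^+ 2 * (SS r w t * (Fs t - Fs 0)).
have Ic t : 0 <= t -> int0 t (fun s => CC r w (0 - s) * G s) = Fc t - Fc 0.
  by move=> t0; apply: ftc2 => // x /andP[x0 _]; apply: dFc; lra.
have Is t : 0 <= t -> int0 t (fun s => SS r w (0 - s) * G s) = Fs t - Fs 0.
  by move=> t0; apply: ftc2 => // x /andP[x0 _]; apply: dFs; lra.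
have eS t : 0 <= t <= T -> vS t = conv (SS r w) G t.
  move=> /andP[t0 _]; rewrite /vS -Ic// -Is// -!int0Z// -int0D; [|by apply: contZ..].
  apply: eq_int0 => s _; have -> : t - s = t + (0 - s) by ring.
  rewrite SSD; ring.
have eC t : 0 <= t <= T -> vC t = conv (CC r w) G t.
  move=> /andP[t0 _]; rewrite /vC -Ic// -Is// -!int0Z//; last exact: contZ.
  rewrite -int0B; [|exact: contZ|by apply: contZ; exact: contZ].
  apply: eq_int0 => s _; have -> : t - s = t + (0 - s) by ring.
  rewrite CCD; ring.
have dS t : 0 <= t -> is_derive t 1 vS (vC t - r * vS t).
  move=> t0; have := derD (derM (der_SS r w t) (dFc' t t0)) (derM (der_CC r w t) (dFs' t t0)).
  (* The terms containing [G t] itself add up to [G t * SS 0], which is 0. *)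
  congr is_derive; have := SSD r w t (0 - t); rewrite addrC subrK SS0 /vC /vS => h.
  have {h} : G t * (SS r w t * CC r w (0 - t) + CC r w t * SS r w (0 - t)) = 0 by rewrite -h mulr0.
  by move=> h; apply/eqP; rewrite -subr_eq0; apply/eqP; rewrite -[RHS]h; ring.
have dC t : 0 <= t -> exists d, is_derive t 1 vC d.
  move=> t0; eexists; exact: (derB (derM (der_CC r w t) (dFc' t t0)) (derZ _ (derM (der_SS r w t) (dFs' t t0)))).
split.
- exists vS, (fun t => vC t - r * vS t) => t tT; rewrite -eS// -eC//; split => //.
  by apply: dS; case/andP: tT.
- apply: (cont0_ext eC); apply: continuous_cont0 => t /andP[/dC[d dd] _]; exact: is_derive_cont dd.
- apply: (cont0_ext eS); apply: continuous_cont0 => t /andP[/dS dd _]; exact: is_derive_cont dd.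
Qed.

(** With [g] only in L^2 the integrand has no pointwise continuity to differentiate. The mean value
    inequality holds for continuous approximants and survives uniform limits; the smooth part [F] of
    the solution is carried along. *)
Lemma conv_L2 g G : in_L2 T g -> (forall N, continuous (G N)) -> L2lim T g G ->
  [/\ forall (F dF : R -> R) (c : R), (forall x : R, is_derive x 1 F (dF x)) ->
        MVI T (fun t => F t + c * conv (SS r w) g t)
          (fun t => dF t + c * (conv (CC r w) g t - r * conv (SS r w) g t)),
      cont0 T (conv (CC r w) g) & cont0 T (conv (SS r w) g)].
Proof.
move=> L2g cG gG.
have uC : ulim T (fun N => conv (CC r w) (G N)) (conv (CC r w) g).
  by apply: (@conv_ulim _ 1) => //; [exact: cont_CC|move=> x /andP[x0 _]; exact: CC_le1].
have uS : ulim T (fun N => conv (SS r w) (G N)) (conv (SS r w) g).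
  apply: (@conv_ulim _ T) => //; [exact: cont_SS|move=> x /andP[x0 xT]].
  by apply: le_trans xT; exact: SS_le.
split; [|exact: (ulim_cont0 (fun N => let: And3 _ h _ := conv_cont (cG N) in h) uC)|
  exact: (ulim_cont0 (fun N => let: And3 _ _ h := conv_cont (cG N) in h) uS)].
move=> F dF c dFE.
have /choice[v /choice[dv Hv]] : forall N, exists v dv, forall t, 0 <= t <= T ->
    [/\ is_derive t 1 v (dv t), v t = conv (SS r w) (G N) t
      & dv t = conv (CC r w) (G N) t - r * conv (SS r w) (G N) t].
  by move=> N; have [] := conv_cont (cG N).
apply: (@ulim_MVI _ T (fun N t => F t + c * v N t) (fun N t => dF t + c * dv N t)).
- move=> N; apply: deriv_MVI => x /(Hv N)[dvx _ _]; exact: derD (dFE x) (derZ c dvx).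
- move=> e e0; have c1 : 0 < `|c| + 1 by rewrite ltr_wpDl.
  have [N0 H0] := uS _ (divr_gt0 e0 c1); exists N0 => N t /H0 {}H0 tT.
  have [_ -> _] := Hv N t tT; rewrite opprD addrACA subrr add0r -mulrBr normrM.
  apply: (le_trans (ler_wpM2l (normr_ge0 c) (H0 _ tT))).
  by rewrite mulrCA ger_pMr// ler_pdivrMr// mul1r lerDl.
- move=> e e0; have c1 : 0 < (`|c| + 1) * (1 + r) by rewrite mulr_gt0// ltr_wpDr// ltr_wpDl.
  have e1 := divr_gt0 e0 c1.
  have [N1 H1] := uC _ e1; have [N2 H2] := uS _ e1; exists (maxn N1 N2) => N t.
  rewrite geq_max => /andP[/H1 {}H1 /H2 {}H2] tT; have [_ _ ->] := Hv N t tT.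
  have -> : dF t + c * (conv (CC r w) (G N) t - r * conv (SS r w) (G N) t)
      - (dF t + c * (conv (CC r w) g t - r * conv (SS r w) g t))
    = c * ((conv (CC r w) (G N) t - conv (CC r w) g t) - r * (conv (SS r w) (G N) t - conv (SS r w) g t)) by ring.
  rewrite normrM; set d := _ / _ in H1 H2 e1.
  apply: (@le_trans _ _ (`|c| * (d * (1 + r)))).
    rewrite ler_wpM2l//; apply: (le_trans (ler_normB _ _)); rewrite normrM (ger0_norm r_ge0).
    by rewrite mulrDr mulr1 [d * r]mulrC lerD ?H1// ler_wpM2l// H2.
  rewrite [leRHS](_ : e = (`|c| + 1) * (d * (1 + r))).
    by rewrite ler_wpM2r ?lerDl// mulr_ge0 ?ltW// ltr_wpDr.
  by rewrite mulrCA /d divfK// gt_eqF.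
Qed.

End Response.

(** * Boundary derivatives of the eigenfunctions *)

Section BoundaryTrace.
Context {R : realType}.

Lemma derive1_phi n : derive1 (phi n) pi = Num.sqrt (2 / pi) * (mode n * cos (mode n * pi)) :> R.
Proof.
rewrite derive1E; apply: (@derive_val _ _ _ _ _ _ _ _).
have := derZ (Num.sqrt (2 / pi)) (der_sin (mode n) 0 (pi : R)).
by rewrite addr0; apply: is_derive_ext => s; rewrite /phi addr0.
Qed.

Lemma norm_derive1_phi n : `|derive1 (phi n) pi| = Num.sqrt (2 / pi) * mode n :> R.
Proof.
rewrite derive1_phi !normrM (ger0_norm (sqrtr_ge0 _)) (ger0_norm (mode_ge0 n)).
suff -> : `|cos (mode n * pi)| = 1 :> R by rewrite mulr1.
rewrite /mode; elim: n => [|n IH]; first by rewrite mul1r cospi normrN normr1.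
by rewrite -natr1 mulrDl mul1r cosDpi normrN.
Qed.

Lemma sqrt2pi_gt0 : 0 < Num.sqrt (2 / pi) :> R.
Proof. by rewrite sqrtr_gt0 divr_gt0// pi_gt0. Qed.

Lemma derive1_phi_neq0 n : derive1 (phi n) pi != 0 :> R.
Proof. by rewrite -normr_gt0 norm_derive1_phi mulr_gt0 ?sqrt2pi_gt0 ?mode_gt0. Qed.

End BoundaryTrace.

(** * A summable majorant over the modes *)

Section WeightedSum.
Context {R : realType}.
Variables (b : nat -> R) (B : R).
Hypothesis bB : forall N, \sum_(0 <= k < N) b k ^+ 2 <= B.

(** Up to a constant, it bounds the squared response of mode [n] to a control with coefficients of
    size [b]. *)
Definition wsum n : R := limn (series (fun k => wt n k * b k ^+ 2)).

Lemma wsum_term_ge0 n k : 0 <= wt n k * b k ^+ 2.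
Proof. by rewrite mulr_ge0 ?wt_ge0 ?sqr_ge0. Qed.

Lemma wt_le1 n k : wt n k <= 1 :> R.
Proof. by rewrite /wt invf_le1 ?lerDl ?sqr_ge0// ltr_wpDr// sqr_ge0. Qed.

Lemma wsum_cvg n : cvgn (series (fun k => wt n k * b k ^+ 2)).
Proof.
apply: (@sum_cvg _ _ B) => [k|N]; first exact: wsum_term_ge0.
apply: le_trans (bB N); apply: ler_sum => k _.
by rewrite ler_piMl ?wt_le1 ?sqr_ge0.
Qed.

Lemma wsum_ge n P : \sum_(0 <= k < P) wt n k * b k ^+ 2 <= wsum n.
Proof.
have nd : nondecreasing_seq (series (fun k => wt n k * b k ^+ 2)).
  by apply/nondecreasing_seqP => m; rewrite /series/= big_nat_recr//= lerDl wsum_term_ge0.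
exact: (nondecreasing_cvgn_le nd (@wsum_cvg n) P).
Qed.

Lemma wsum_ge0 n : 0 <= wsum n.
Proof. by apply: le_trans (wsum_ge n 0); rewrite big_geq. Qed.

(** The sums are exchanged for a finite truncation [P] in [k], where the column sums of the weight
    are at most 6; then [P] tends to infinity. *)
Lemma sum_wsum N : \sum_(0 <= n < N) wsum n <= 6 * B.
Proof.
have H : \sum_(0 <= n < N) (series (fun k => wt n k * b k ^+ 2) P - wsum n) @[P --> \oo] --> (0 : R).
  apply: cvg_sum0 => n; have := cvgB (@wsum_cvg n) (cvg_cst (wsum n)).
  by rewrite subrr; apply.
apply/ler_addgt0Pr => e e0; move/cvgrPdist_le : H => /(_ e e0)[P _ /(_ P (leqnn P))].
rewrite sub0r normrN sumrB => /ler_normlP[+ _]; rewrite opprB lerBlDl => /le_trans; apply.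
rewrite lerD2r /series/= exchange_big/=.
apply: (@le_trans _ _ (6 * \sum_(0 <= k < P) b k ^+ 2)); last by rewrite ler_wpM2l.
rewrite mulr_sumr; apply: ler_sum => k _; rewrite -mulr_suml ler_wpM2r ?sqr_ge0//.
by under eq_bigr do rewrite wtC; exact: sum_wt.
Qed.

End WeightedSum.

(** * The moment problem *)

Section Moments.
Context {R : realType}.

Lemma sum_delta (n N : nat) (c : nat -> R) : (n < N)%N ->
  \sum_(0 <= k < N) (n == k)%:R * c k = c n.
Proof.
move=> nN; rewrite big_mkord (bigD1 (Ordinal nN))//= eqxx mul1r big1 ?addr0// => i.
by rewrite -val_eqE/= eq_sym => /negPf ->; rewrite mul0r.
Qed.

Lemma cvg_eventually (u : nat -> R) a c n : u N @[N --> \oo] --> a ->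
  (forall N, (n < N)%N -> u N = c) -> a = c.
Proof.
move=> ua uc; apply: (cvg_unique _ ua) => //; apply: cvg_near_cst.
by exists n.+1 => // N /= /uc ->.
Qed.

Variables (T alpha rho : R).
Hypotheses (T_gt0 : 0 < T) (alpha_ge0 : 0 <= alpha) (alpha_lt1 : alpha < 1)
  (rho_gt0 : 0 < rho) (rho_le2 : rho <= 2).

Local Notation r n := (rr alpha rho n).
Local Notation w n := (om alpha rho n).
Local Notation gK := (gramK T alpha).

Lemma CC_revcos x v s : CC x v (T - s) = expR (- x * T) * revcos T x v s.
Proof. by rewrite /CC /revcos mulrA -expRD; congr (expR _ * _); ring. Qed.

Lemma SS_revsinc x v s : SS x v (T - s) = expR (- x * T) * revsinc T x v s.
Proof. by rewrite /SS /revsinc mulrA -expRD; congr (expR _ * _); ring. Qed.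

(** Cauchy-Schwarz with the weights [wt n k], of total at most 6, gives a bound independent of [P]
    and of the time [t]. *)
Lemma osc_sum_le M N0 b (psi : nat -> R -> R) B t n f P : 0 <= t <= T -> 0 <= N0 ->
  (forall N, \sum_(0 <= k < N) b k ^+ 2 <= B) ->
  (forall k, continuous (psi k)) ->
  (forall k, `|int0 t (fun s => f s * psi k s)| <= gK * wt n k * M * (N0 * b k)) ->
  continuous f -> 
  int0 t (fun s => f s * \sum_(0 <= k < P) psi k s) ^+ 2 <= 6 * (gK * M * N0) ^+ 2 * wsum b n.
Proof.
move=> tT N00 bB cpsi H cf.
under eq_int0 do rewrite mulr_sumr.
rewrite int0_sum; last by move=> k; exact: contM.
have h : `|\sum_(0 <= k < P) int0 t (fun s => f s * psi k s)| <=
    (gK * M * N0) * \sum_(0 <= k < P) wt n k * b k.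
  apply: (le_trans (ler_norm_sum _ _ _)); rewrite mulr_sumr; apply: ler_sum => k _.
  by apply: (le_trans (H k)); rewrite le_eqVlt; apply/orP; left; apply/eqP; ring.
rewrite -real_normK ?num_real//.
apply: (@le_trans _ _ (((gK * M * N0) * \sum_(0 <= k < P) wt n k * b k) ^+ 2)).
  by rewrite ler_sqr ?nnegrE//; exact: le_trans h.
rewrite exprMn [leRHS](_ : _ = (gK * M * N0) ^+ 2 * (6 * wsum b n)); last by ring.
apply: ler_wpM2l; first exact: sqr_ge0.
apply: (le_trans (sum_cauchy _ _ (fun k => wt_ge0 n k))).
apply: ler_pM => //.
- by apply: sumr_ge0 => k _; exact: wt_ge0.
- by apply: sumr_ge0 => k _; exact: wsum_term_ge0.
- exact: sum_wt.
- exact: wsum_ge bB _ _.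
Qed.

Lemma osc_comb M t n A f q1 q2 a b k : 0 <= t <= T -> osc t A (Om alpha rho n) f ->
  osc t M (Om alpha rho k) q1 -> osc t M (Om alpha rho k) q2 ->
  `|int0 t (fun s => f s * (a * q1 s + b * q2 s))| <= gK * wt n k * A * (M * (`|a| + `|b|)).
Proof.
move=> tT fo o1 o2.
have cf := osc_cont fo; have c1 := osc_cont o1; have c2 := osc_cont o2.
have -> : int0 t (fun s => f s * (a * q1 s + b * q2 s)) =
    a * int0 t (fun s => f s * q1 s) + b * int0 t (fun s => f s * q2 s).
  rewrite -!int0Z; [|by apply: contM..].
  rewrite -int0D; [|by apply: contZ; apply: contM..].
  by apply: eq_int0 => s _; ring.
have h1 := osc_gram T_gt0 alpha_ge0 alpha_lt1 rho_gt0 rho_le2 tT fo o1.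
have h2 := osc_gram T_gt0 alpha_ge0 alpha_lt1 rho_gt0 rho_le2 tT fo o2.
apply: (le_trans (ler_normD _ _)); rewrite !normrM.
apply: (le_trans (lerD (ler_wpM2l (normr_ge0 _) h1) (ler_wpM2l (normr_ge0 _) h2))).
by rewrite le_eqVlt; apply/orP; left; apply/eqP; ring.
Qed.

Lemma gram_comb M t (y x : nat -> R) (q1 q2 : nat -> R -> R) : 0 <= t <= T ->
  (forall n, osc t M (Om alpha rho n) (q1 n)) -> (forall n, osc t M (Om alpha rho n) (q2 n)) ->
  forall n m, `|int0 t (fun s => (y n * q1 n s + x n * q2 n s) * (y m * q1 m s + x m * q2 m s))|
    <= gK * M ^+ 2 * wt n m * (`|y n| + `|x n|) * (`|y m| + `|x m|).
Proof.
move=> tT o1 o2 n m.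
have c1 k : continuous (q1 k) by exact: osc_cont (o1 k).
have c2 k : continuous (q2 k) by exact: osc_cont (o2 k).
have cm : continuous (fun s => y m * q1 m s + x m * q2 m s) by apply: contD; exact: contZ.
have -> : int0 t (fun s => (y n * q1 n s + x n * q2 n s) * (y m * q1 m s + x m * q2 m s)) =
    y n * int0 t (fun s => q1 n s * (y m * q1 m s + x m * q2 m s))
    + x n * int0 t (fun s => q2 n s * (y m * q1 m s + x m * q2 m s)).
  rewrite -!int0Z; [|by apply: contM..].
  rewrite -int0D; [|by apply: contZ; apply: contM..].
  by apply: eq_int0 => s _; ring.
have h1 := osc_comb (y m) (x m) tT (o1 n) (o1 m) (o2 m).
have h2 := osc_comb (y m) (x m) tT (o2 n) (o1 m) (o2 m).
apply: (le_trans (ler_normD _ _)); rewrite !normrM.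
apply: (le_trans (lerD (ler_wpM2l (normr_ge0 _) h1) (ler_wpM2l (normr_ge0 _) h2))).
by rewrite le_eqVlt; apply/orP; left; apply/eqP; ring.
Qed.

(** The factor [e^(- r_n T)] relates the kernels at time [T] to [revcos] and [revsinc], for which
    the family is biorthogonal. The summable [D] dominates the responses at all times at once, as
    continuity in [X_D^p] requires. *)
Lemma moments : exists2 M, 0 <= M & forall (y x : nat -> R) B,
  (forall N, \sum_(0 <= k < N) (`|y k| + `|x k|) ^+ 2 <= B) ->
  exists g G, [/\ in_L2 T g, (forall N, continuous (G N)), L2lim T g G,
    (L2norm T g <= (Num.sqrt (6 * (gK * M ^+ 2) * B))%:E)%E &
    (forall n, conv (CC (r n) (w n)) g T = expR (- r n * T) * y n /\
      mode n ^+ 2 * conv (SS (r n) (w n)) g T = expR (- r n * T) * x n) /\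
    exists D, [/\ forall n, 0 <= D n, exists B', forall N, \sum_(0 <= n < N) D n <= B',
      forall n t, 0 <= t <= T -> conv (CC (r n) (w n)) g t ^+ 2 <= D n &
      forall n t, 0 <= t <= T -> (mode n ^+ 2 * conv (SS (r n) (w n)) g t) ^+ 2 <= D n]].
Proof.
have TT := ltW T_gt0; have gK0 : 0 <= gK by exact: gramK_ge0.
have [M HM] := biorth_exists T_gt0 alpha_ge0 alpha_lt1 rho_gt0 rho_le2.
have [qc /choice[qs Hq]] := choice HM; exists M => [|y x B yxB].
  by have [h _ _] := Hq 0%N; exact: osc_ge0 h.
have M0 : 0 <= M by have [h _ _] := Hq 0%N; exact: osc_ge0 h.
pose b k := `|y k| + `|x k|; pose psi k s := y k * qc k s + x k * qs k s.
have cqc k : continuous (qc k) by have [h _ _] := Hq k; exact: osc_cont h.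
have cqs k : continuous (qs k) by have [_ h _] := Hq k; exact: osc_cont h.
have cpsi k : continuous (psi k) by apply: contD; exact: contZ.
have osci t n A f : 0 <= t <= T -> osc t A (Om alpha rho n) f ->
    forall k, `|int0 t (fun s => f s * psi k s)| <= gK * wt n k * A * (M * b k).
  move=> /[dup] tT /andP[t0 t1] fo k; have [oc os _] := Hq k.
  exact: (osc_comb _ _ tT fo (osc_t t1 oc) (osc_t t1 os)).
have gram n m : `|int0 T (fun s => psi n s * psi m s)| <= gK * M ^+ 2 * wt n m * b n * b m.
  have tT : 0 <= T <= T by rewrite TT lexx.
  by apply: (gram_comb y x tT) => k; have [] := Hq k.
have b0 k : 0 <= b k by rewrite addr_ge0.
have gKM : 0 <= gK * M ^+ 2 by rewrite mulr_ge0// exprn_ge0.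
have [g [L2g gG gn]] := series_L2 cpsi gKM b0 gram yxB.
pose G N s := \sum_(0 <= k < N) psi k s.
have cG N : continuous (G N) by exact: cont_sum.
have L2G t N : in_L2 t (G N) by exact: in_L2_cont.
exists g, G; split => //; split.
  move=> n; have [_ _ _] := Hq n.
  have ck : continuous (fun s => CC (r n) (w n) (T - s)) by apply: cont_rev; exact: cont_CC.
  have cs : continuous (fun s => SS (r n) (w n) (T - s)) by apply: cont_rev; exact: cont_SS.
  have lc := int0_mul_lim L2g (in_L2_cont T ck) (L2G T) gG.
  have ls := int0_mul_lim L2g (in_L2_cont T cs) (L2G T) gG.
  have crc := @cont_revcos _ T (r n) (w n); have crs := @cont_revsinc _ T (r n) (w n).
  split.
    (* Only the term [k = n] has a nonzero moment, so the partial sums give a constant sequence once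
       [N > n]. *)
    apply: (cvg_eventually (n := n) lc) => N nN; rewrite /G.
    under eq_int0 => s _ do rewrite mulr_sumr.
    rewrite int0_sum; last by move=> k; apply: contM.
    rewrite -(sum_delta y nN) mulr_sumr; apply: eq_bigr => k _.
    have [_ _ /(_ n)[h1 _ h3 _]] := Hq k.
    transitivity (expR (- r n * T) * (y k * int0 T (fun s => qc k s * revcos T (r n) (w n) s)
       + x k * int0 T (fun s => qs k s * revcos T (r n) (w n) s))).
      rewrite -!int0Z; [|by apply: contM..].
      rewrite -int0D; [|by apply: contZ; apply: contM..].
      rewrite -int0Z; last by apply: contD; apply: contZ; apply: contM.
      by apply: eq_int0 => s _; rewrite CC_revcos /psi; ring.
    by rewrite h1 h3; ring.
  apply: (cvg_eventually (n := n) (cvgM (cvg_cst (mode n ^+ 2)) ls)) => N nN; rewrite /G /=.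
  under eq_int0 => s _ do rewrite mulr_sumr.
  rewrite int0_sum; last by move=> k; apply: contM.
  rewrite -(sum_delta x nN) !mulr_sumr; apply: eq_bigr => k _.
  have [_ _ /(_ n)[_ h2 _ h4]] := Hq k.
  transitivity (expR (- r n * T) * (mode n ^+ 2 * (y k * int0 T (fun s => qc k s * revsinc T (r n) (w n) s)
     + x k * int0 T (fun s => qs k s * revsinc T (r n) (w n) s)))).
    rewrite -!int0Z; [|by apply: contM..].
    rewrite -int0D; [|by apply: contZ; apply: contM..].
    rewrite -!int0Z; [|by apply: contZ; apply: contD; apply: contZ; apply: contM
      |by apply: contD; apply: contZ; apply: contM].
    by apply: eq_int0 => s _; rewrite SS_revsinc /psi; ring.
  have mk : mode k ^+ 2 != 0 :> R by rewrite expf_neq0// gt_eqF// mode_gt0.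
  rewrite h2; case: (eqVneq n k) h4 => [-> h4|nk /eqP].
    by rewrite mul1r -[X in _ = _ * X]mulr1 -[X in _ = _ * (_ * X)]h4; ring.
  by rewrite mulf_eq0 (negPf mk)/= => /eqP ->; ring.
pose KD := 6 * (gK * modeM T alpha * M) ^+ 2.
have KD0 : 0 <= KD by rewrite mulr_ge0// sqr_ge0.
have bnd n t f : 0 <= t <= T -> osc t (modeM T alpha) (Om alpha rho n) f ->
    int0 t (fun s => f s * g s) ^+ 2 <= KD * wsum b n.
  move=> /[dup] tT /andP[t0 t1] fo; have cf := osc_cont fo.
  have l := int0_mul_lim (in_L2_t t1 L2g) (in_L2_cont t cf) (L2G t) (L2lim_t t1 L2g cG gG).
  have l2 : int0 t (fun s => f s * G N s) * int0 t (fun s => f s * G N s) @[N --> \oo]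
      --> int0 t (fun s => f s * g s) * int0 t (fun s => f s * g s) by apply: cvgM; exact: l.
  rewrite expr2.
  rewrite -(cvg_lim _ l2)//; apply: limr_le; first by apply/cvg_ex; eexists; exact: l2.
  apply: nearW => N; rewrite /= -expr2.
  by apply: osc_sum_le => //; exact: osci.
exists (fun n => KD * wsum b n); split.
- by move=> n; rewrite mulr_ge0// (wsum_ge0 yxB).
- by exists (KD * (6 * B)) => N; rewrite -mulr_sumr ler_wpM2l// (sum_wsum yxB).
- by move=> n t tT; apply: bnd => //; exact: osc_CC.
- move=> n t /[dup] tT /andP[_ t1].
  have cs : continuous (fun s => SS (r n) (w n) (t - s)) by apply: cont_rev; exact: cont_SS.
  rewrite /conv /int0 -RintegralZl//; last exact: in_L2_mul (in_L2_t t1 L2g) (in_L2_cont t cs).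
  rewrite -/(int0 t _); under eq_int0 => s _ do rewrite mulrA.
  by apply: bnd => //; exact: osc_SS.
Qed.

End Moments.

(** * From regularity of each mode to regularity in X_D^p *)

Section ModewiseC1.
Context {R : realType}.
Variables (T B : R) (u u' : R -> nat -> R) (D : nat -> R).
Hypotheses (uE : forall n, MVI T (u^~ n) (u'^~ n)).
Hypotheses (cu : forall n, cont0 T (u^~ n)) (cu' : forall n, cont0 T (u'^~ n)).
Hypothesis DB : forall N, \sum_(0 <= n < N) D n <= B.
Hypothesis uD : forall n t, 0 <= t <= T -> (mode n * `|u t n|) ^+ 2 <= D n.
Hypothesis u'D : forall n t, 0 <= t <= T -> (`|u' t n| / mode n) ^+ 2 <= D n.

Lemma sqr_norm_subr (c x y d : R) : 0 <= c -> (c * `|x|) ^+ 2 <= d -> (c * `|y|) ^+ 2 <= d ->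
  (c * `|x - y|) ^+ 2 <= 4 * d.
Proof.
move=> c0; rewrite !exprMn !real_normK ?num_real// => xd yd.
have := mulr_ge0 (sqr_ge0 c) (sqr_ge0 (x + y)); nra.
Qed.

Lemma XD_continuous_modewise p (v : R -> nat -> R) : (forall n, cont0 T (v^~ n)) ->
  (forall n t, 0 <= t <= T -> XDterms p (v t) n <= D n) -> XD_continuous p T v.
Proof.
move=> cv vD t; rewrite in_itv/= => tT; split.
  by apply: in_XD_dom DB _ => n; exact: vD.
have D0 n : 0 <= D n by apply: le_trans (vD n t tT); exact: XDterms_ge0.
apply: (@XD_dom_cvg _ _ _ _ _ (fun n => 4 * D n) (4 * B)).
- by move=> n; rewrite mulr_ge0.
- by move=> N; rewrite -mulr_sumr ler_wpM2l.
- rewrite near_withinE; apply: nearW => s /=; rewrite in_itv/= => sT n.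
  have := vD n s sT; have := vD n t tT; rewrite /XDterms => h1 h2.
  have E x : mode n `^ (2 * p) * x ^+ 2 = (mode n `^ p * x) ^+ 2 :> R.
    rewrite exprMn -(powR_mulrn 2 (powR_ge0 (mode n) p)) -powRrM; congr (_ `^ _ * _); ring.
  by move: h1 h2; rewrite !E => h1 h2; apply: sqr_norm_subr => //; exact: powR_ge0.
- move=> n; apply: within_cvg0 => e e0; exact: cv.
Qed.

(** The mean value inequality bounds the difference quotients of a mode by the bound on its
    derivative, so the same majorant [4 D] serves values, derivatives and quotients. *)
Lemma XD_C1_modewise : XD_continuous 1 T u /\ XD_C1 (-1) T u u'.
Proof.
have uD1 n t : 0 <= t <= T -> XDterms 1 (u t) n <= D n by rewrite XDterms1; exact: uD.
have u'D1 n t : 0 <= t <= T -> XDterms (-1) (u' t) n <= D n by rewrite XDtermsN1; exact: u'D.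
split; first exact: XD_continuous_modewise; split.
- apply: XD_continuous_modewise => // n t tT; apply: le_trans (uD1 n t tT).
  rewrite XDterms1 XDtermsN1 ler_sqr ?nnegrE ?mulr_ge0 ?invr_ge0 ?mode_ge0// mulrC.
  by rewrite ler_wpM2r// (@le_trans _ _ 1)// ?mode_ge1// invf_le1 ?mode_gt0// mode_ge1.
- exact: XD_continuous_modewise.
move=> t; rewrite in_itv/= => tT.
have D0 n : 0 <= D n by apply: le_trans (uD1 n t tT); exact: XDterms_ge0.
apply: (@XD_dom_cvg _ _ _ _ _ (fun n => 4 * D n) (4 * B)).
- by move=> n; rewrite mulr_ge0.
- by move=> N; rewrite -mulr_sumr ler_wpM2l.
- rewrite near_withinE; near=> s; rewrite /= in_itv/= => sT n.
  have st : s != t by near: s; exact: nbhs_dnbhs_neq.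
  have mn := mode_gt0 n : 0 < mode n :> R.
  have aD x : 0 <= x <= T -> `|u' x n| <= mode n * Num.sqrt (D n).
    move=> xT; rewrite mulrC -ler_pdivrMr//.
    have := ler_wsqrtr (@u'D n _ xT); rewrite sqrtr_sqr ger0_norm// divr_ge0// mode_ge0.
  have := MVI_bnd (@uE n) sT tT aD => h.
  have st0 : 0 < `|s - t| by rewrite normr_gt0 subr_eq0.
  rewrite XDtermsN1 mulrC; apply: sqr_norm_subr; first by rewrite invr_ge0 ltW.
    rewrite normrM normfV -[leRHS]sqr_sqrtr// ler_sqr ?nnegrE ?mulr_ge0 ?invr_ge0 ?sqrtr_ge0 ?mode_ge0//.
    by rewrite ler_pdivrMl// ler_pdivrMl// mulrC.
  by rewrite mulrC u'D.
- by move=> n; apply: dwithin_cvg0 => e e0; exact: (MVI_deriv (@uE n) (@cu' n) tT e0).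
Unshelve. all: by end_near.
Qed.

End ModewiseC1.

(** * The controlled solution *)

Section Solution.
Context {R : realType}.
Variables (alpha rho : R).

Local Notation r n := (rr alpha rho n).
Local Notation w n := (om alpha rho n).
Local Notation c n := (derive1 (phi n) pi).
Local Notation kappa := (Num.sqrt (2 / pi : R)).

(* Duhamel's formula: the boundary datum acts on mode [n] as the force
   [phi_n'(pi) g]. *)
Definition sol (u0 u1 : nat -> R) (g : R -> R) t n : R :=
  u0 n * (CC (r n) (w n) t + r n * SS (r n) (w n) t) + u1 n * SS (r n) (w n) t
  + c n * conv (SS (r n) (w n)) g t.

Definition dsol (u0 u1 : nat -> R) (g : R -> R) t n : R :=
  u1 n * (CC (r n) (w n) t - r n * SS (r n) (w n) t)
  - mode n ^+ 4 * u0 n * SS (r n) (w n) t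
  + c n * (conv (CC (r n) (w n)) g t - r n * conv (SS (r n) (w n)) g t).

Lemma sol0 u0 u1 g : sol u0 u1 g 0 = u0.
Proof. by apply/funext => n; rewrite /sol CC0 SS0 conv0 !mulr0 !addr0 mulr1. Qed.

Lemma dsol0 u0 u1 g : dsol u0 u1 g 0 = u1.
Proof. by apply/funext => n; rewrite /dsol CC0 SS0 !conv0; ring. Qed.

Variable T : R.
Hypotheses (T_gt0 : 0 < T) (alpha_ge0 : 0 <= alpha) (alpha_lt1 : alpha < 1)
  (rho_gt0 : 0 < rho) (rho_le2 : rho <= 2).

Lemma mode_SS_le n t : 0 <= t <= T -> mode n ^+ 2 * `|SS (r n) (w n) t| <= modeM T alpha.
Proof.
move=> tT; have h := osc_SS T_gt0 alpha_ge0 alpha_lt1 rho_gt0 rho_le2 n tT.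
have t0 : 0 <= (0 : R) <= t by rewrite lexx; case/andP: tT.
have := osc_bnd h t0; rewrite subr0 normrM ger0_norm// exprn_ge0//; exact: mode_ge0.
Qed.

Lemma rr_SS_le n t : 0 <= t <= T -> r n * `|SS (r n) (w n) t| <= modeM T alpha.
Proof.
move=> tT; apply: le_trans (mode_SS_le n tT); apply: ler_wpM2r => //.
exact: rr_le.
Qed.

Lemma sqr4_le (L X a b d e : R) : 0 <= X -> X <= L * (a + b + d + e) ->
  X ^+ 2 <= 4 * L ^+ 2 * (a ^+ 2 + b ^+ 2 + (d ^+ 2 + e ^+ 2)).
Proof.
move=> X0 XL; apply: (@le_trans _ _ ((L * (a + b + d + e)) ^+ 2)).
  by rewrite ler_sqr ?nnegrE//; exact: le_trans XL.
rewrite exprMn [leRHS](_ : _ = L ^+ 2 * (4 * (a ^+ 2 + b ^+ 2 + (d ^+ 2 + e ^+ 2)))); last by ring.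
rewrite ler_wpM2l ?sqr_ge0//.
have := sqr_ge0 (a - b); have := sqr_ge0 (a - d); have := sqr_ge0 (a - e).
have := sqr_ge0 (b - d); have := sqr_ge0 (b - e); have := sqr_ge0 (d - e); nra.
Qed.

Variables (u0 u1 : nat -> R) (g : R -> R).

(** [m |phi_n'(pi)|] is of order [m^2], exactly the weight under which the convolution with [SS] is
    square summable. *)
Lemma sol_le n t : 0 <= t <= T -> mode n * `|sol u0 u1 g t n| <=
  (1 + modeM T alpha + kappa) * (mode n * `|u0 n| + `|u1 n| / mode n
   + `|conv (CC (r n) (w n)) g t| + mode n ^+ 2 * `|conv (SS (r n) (w n)) g t|).
Proof.
move=> tT; have m0 := mode_gt0 n : 0 < mode n :> R; have k0 := sqrt2pi_gt0 : 0 < kappa.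
have r0 := rr_ge0 alpha rho_gt0 n; have S1 := mode_SS_le n tT; have S2 := rr_SS_le n tT.
have C1 : `|CC (r n) (w n) t| <= 1 by apply: CC_le1 => //; case/andP: tT.
set V := conv (SS _ _) g t; set W := conv (CC _ _) g t.
have CS : `|CC (r n) (w n) t + r n * SS (r n) (w n) t| <= 1 + modeM T alpha.
  by apply: (le_trans (ler_normD _ _)); rewrite [`|r n * _|]normrM (ger0_norm r0) lerD.
have M0 : 0 <= modeM T alpha.
  by apply: le_trans S1; rewrite mulr_ge0// exprn_ge0// ltW.
have := ler_normD (u0 n * (CC (r n) (w n) t + r n * SS (r n) (w n) t) + u1 n * SS (r n) (w n) t) (c n * V).
have := ler_normD (u0 n * (CC (r n) (w n) t + r n * SS (r n) (w n) t)) (u1 n * SS (r n) (w n) t).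
rewrite -/(sol u0 u1 g t n) [`|u0 n * _|]normrM [`|u1 n * _|]normrM [`|c n * _|]normrM norm_derive1_phi => h1 h2.
have h : `|sol u0 u1 g t n| <= `|u0 n| * (1 + modeM T alpha) + `|u1 n| * `|SS (r n) (w n) t|
    + kappa * mode n * `|V|.
  by apply: (le_trans h2); rewrite lerD2r; apply: (le_trans h1); rewrite lerD2r ler_wpM2l.
apply: (le_trans (ler_wpM2l (ltW m0) h)).
set a := mode n * `|u0 n|; set b := `|u1 n| / mode n; set e := mode n ^+ 2 * `|V|.
have a0 : 0 <= a by rewrite mulr_ge0// ltW.
have b0 : 0 <= b by rewrite divr_ge0// ltW.
have e0 : 0 <= e by rewrite mulr_ge0// exprn_ge0// ltW.
have d0 := normr_ge0 W.
rewrite [leLHS](_ : _ = a * (1 + modeM T alpha) + b * (mode n ^+ 2 * `|SS (r n) (w n) t|) + kappa * e); last first.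
  by rewrite /a /b /e; field; rewrite gt_eqF.
have := ler_wpM2l b0 S1; have k0' := ltW k0; have := mulr_ge0 a0 k0'; have := mulr_ge0 b0 k0'.
have := mulr_ge0 d0 k0'; have := mulr_ge0 M0 d0; have := mulr_ge0 M0 e0.
clear -a0 b0 e0 d0; nra.
Qed.

Lemma dsol_le n t : 0 <= t <= T -> `|dsol u0 u1 g t n| / mode n <=
  (1 + modeM T alpha + kappa) * (mode n * `|u0 n| + `|u1 n| / mode n
   + `|conv (CC (r n) (w n)) g t| + mode n ^+ 2 * `|conv (SS (r n) (w n)) g t|).
Proof.
move=> tT; have m0 := mode_gt0 n : 0 < mode n :> R; have k0 := sqrt2pi_gt0 : 0 < kappa.
have r0 := rr_ge0 alpha rho_gt0 n; have S1 := mode_SS_le n tT; have S2 := rr_SS_le n tT.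
have C1 : `|CC (r n) (w n) t| <= 1 by apply: CC_le1 => //; case/andP: tT.
set V := conv (SS _ _) g t; set W := conv (CC _ _) g t.
have CS : `|CC (r n) (w n) t - r n * SS (r n) (w n) t| <= 1 + modeM T alpha.
  by apply: (le_trans (ler_normB _ _)); rewrite [`|r n * _|]normrM (ger0_norm r0) lerD.
have VW : `|W - r n * V| <= `|W| + mode n ^+ 2 * `|V|.
  apply: (le_trans (ler_normB _ _)); rewrite [`|r n * _|]normrM (ger0_norm r0) lerD2l.
  by apply: ler_wpM2r => //; exact: rr_le.
have M0 : 0 <= modeM T alpha.
  by apply: le_trans S1; rewrite mulr_ge0// exprn_ge0// ltW.
have := ler_normD (u1 n * (CC (r n) (w n) t - r n * SS (r n) (w n) t)
  - mode n ^+ 4 * u0 n * SS (r n) (w n) t) (c n * (W - r n * V)).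
have := ler_normB (u1 n * (CC (r n) (w n) t - r n * SS (r n) (w n) t)) (mode n ^+ 4 * u0 n * SS (r n) (w n) t).
rewrite -/(dsol u0 u1 g t n) [`|u1 n * _|]normrM [`|_ * u0 n * _|]normrM [`|_ * u0 n|]normrM
  [`|c n * _|]normrM norm_derive1_phi (ger0_norm (exprn_ge0 4 (ltW m0))) => h1 h2.
have h : `|dsol u0 u1 g t n| <= `|u1 n| * (1 + modeM T alpha) + mode n ^+ 4 * `|u0 n| * `|SS (r n) (w n) t|
    + kappa * mode n * (`|W| + mode n ^+ 2 * `|V|).
  apply: (le_trans h2); apply: lerD; last by apply: ler_wpM2l VW; rewrite mulr_ge0 ?ltW.
  by apply: (le_trans h1); rewrite lerD2r ler_wpM2l.
rewrite ler_pdivrMr//; apply: (le_trans h).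
set a := mode n * `|u0 n|; set b := `|u1 n| / mode n; set e := mode n ^+ 2 * `|V|.
have a0 : 0 <= a by rewrite mulr_ge0// ltW.
have b0 : 0 <= b by rewrite divr_ge0// ltW.
have e0 : 0 <= e by rewrite mulr_ge0// exprn_ge0// ltW.
have d0 := normr_ge0 W.
rewrite [leLHS](_ : _ = (b * (1 + modeM T alpha) + a * (mode n ^+ 2 * `|SS (r n) (w n) t|)
    + kappa * (`|W| + e)) * mode n); last first.
  by rewrite /a /b /e; field; rewrite gt_eqF.
apply: ler_wpM2r; first exact: ltW.
have := ler_wpM2l a0 S1; have k0' := ltW k0; have := mulr_ge0 a0 k0'; have := mulr_ge0 b0 k0'.
have := mulr_ge0 M0 d0; have := mulr_ge0 M0 e0.
clear -a0 b0 e0 d0; nra.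
Qed.

Lemma sol_C1 G D B : in_XD 1 u0 -> in_XD (-1) u1 ->
  in_L2 T g -> (forall N, continuous (G N)) -> L2lim T g G ->
  (forall n, 0 <= D n) -> (forall N, \sum_(0 <= n < N) D n <= B) ->
  (forall n t, 0 <= t <= T -> conv (CC (r n) (w n)) g t ^+ 2 <= D n) ->
  (forall n t, 0 <= t <= T -> (mode n ^+ 2 * conv (SS (r n) (w n)) g t) ^+ 2 <= D n) ->
  XD_continuous 1 T (sol u0 u1 g) /\ XD_C1 (-1) T (sol u0 u1 g) (dsol u0 u1 g).
Proof.
move=> Xu0 Xu1 L2g cG gG D0 DB VCD VSD.
have TT := ltW T_gt0.
set L := 1 + modeM T alpha + kappa.
pose Du n := 4 * L ^+ 2 * (XDterms 1 u0 n + XDterms (-1) u1 n + 2 * D n).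
have Dle n t X : 0 <= t <= T -> 0 <= X -> X <= L * (mode n * `|u0 n| + `|u1 n| / mode n
   + `|conv (CC (r n) (w n)) g t| + mode n ^+ 2 * `|conv (SS (r n) (w n)) g t|) -> X ^+ 2 <= Du n.
  move=> tT X0 /(sqr4_le X0) /le_trans; apply; rewrite /Du -XDterms1 -XDtermsN1.
  apply: ler_wpM2l; first by rewrite mulr_ge0 ?sqr_ge0.
  rewrite lerD2l [2 * _]mulrDl mul1r.
  apply: lerD; first by rewrite real_normK ?num_real// VCD.
  have := VSD n t tT; rewrite !exprMn real_normK ?num_real//.
have rn n : 0 <= r n by exact: rr_ge0.
have cdat n := conv_L2 (w n) TT (rn n) L2g cG gG.
apply: (@XD_C1_modewise _ T (4 * L ^+ 2 * (XDnorm 1 u0 ^+ 2 + XDnorm (-1) u1 ^+ 2 + 2 * B)) _ _ Du).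
- move=> n; have [m _ _] := cdat n.
  apply: (m (fun t => u0 n * (CC (r n) (w n) t + r n * SS (r n) (w n) t) + u1 n * SS (r n) (w n) t)
    (fun t => u1 n * (CC (r n) (w n) t - r n * SS (r n) (w n) t) - mode n ^+ 4 * u0 n * SS (r n) (w n) t)).
  move=> x; have dC := der_CC (r n) (w n) x; have dS := der_SS (r n) (w n) x.
  have := derD (derZ (u0 n) (derD dC (derZ (r n) dS))) (derZ (u1 n) dS).
  by congr is_derive; rewrite om2//; ring.
- move=> n; have [_ _ cS] := cdat n; apply: cont0_D; last exact: cont0_Z.
  by apply: continuous_cont0 => t _; apply: contD;
    apply: contZ; [apply: contD; [exact: cont_CC|apply: contZ; exact: cont_SS]|exact: cont_SS].
- move=> n; have [_ cC cS] := cdat n; apply: cont0_D.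
    by apply: continuous_cont0 => t _; apply: contB;
      apply: contZ; [apply: contB; [exact: cont_CC|apply: contZ; exact: cont_SS]|exact: cont_SS].
  have := cont0_Z (c n) (cont0_D cC (cont0_Z (- r n) cS)).
  by apply: cont0_ext => s _; rewrite mulNr.
- move=> N; rewrite -mulr_sumr; apply: ler_wpM2l; first by rewrite mulr_ge0 ?sqr_ge0.
  rewrite !big_split/= -mulr_sumr.
  by apply: lerD; [apply: lerD; exact: XD_sum_le|rewrite ler_wpM2l].
- move=> n t tT; apply: (Dle n t) => //; last exact: sol_le.
  by rewrite mulr_ge0// mode_ge0.
- move=> n t tT; apply: (Dle n t) => //; last exact: dsol_le.
  by rewrite divr_ge0// mode_ge0.
Qed.

End Solution.

(** * The control *)

Section Control.
Context {R : realType}.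
Variables (T alpha rho : R).
Hypotheses (T_gt0 : 0 < T) (alpha_ge0 : 0 <= alpha) (alpha_lt1 : alpha < 1)
  (rho_gt0 : 0 < rho) (rho_le2 : rho <= 2).

Local Notation r n := (rr alpha rho n).
Local Notation w n := (om alpha rho n).
Local Notation c n := (derive1 (phi n) pi).
Local Notation kappa := (Num.sqrt (2 / pi : R)).

(** [ycoef] and [xcoef] come from solving [sol T = 0] and [dsol T = 0] for the two moments and
    dividing by the common factor [e^(- r_n T)]; no exponential in [n] remains. *)
Definition ycoef (u0 u1 : nat -> R) n : R :=
  ((w n) ^+ 2 * sinc (w n) T * u0 n - cos (w n * T) * (u1 n + r n * u0 n)) / c n.

Definition xcoef (u0 u1 : nat -> R) n : R :=
  - (mode n ^+ 2 * (cos (w n * T) * u0 n + sinc (w n) T * (u1 n + r n * u0 n))) / c n.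

Lemma mode_sinc_le n : mode n ^+ 2 * `|sinc (w n) T| <= 2 / (1 - alpha) + T.
Proof.
have TT := ltW T_gt0; have a1 : 0 < 1 - alpha by rewrite subr_gt0.
have a2 : 0 <= 2 / (1 - alpha) by rewrite divr_ge0// ltW.
case: n => [|n].
  rewrite /mode expr1n mul1r; apply: (le_trans (sinc_le _ TT)); by rewrite lerDr.
have [h w0] := om_lower alpha_ge0 alpha_lt1 rho_gt0 rho_le2 (ltn0Sn n).
rewrite /sinc gt_eqF// normrM normfV (ger0_norm (ltW w0)).
have h1 := norm_sin_le1 (w n.+1 * T).
apply: (@le_trans _ _ (mode n.+1 ^+ 2 / w n.+1)).
  by rewrite mulrA ler_wpM2r ?invr_ge0 ?(ltW w0)// ler_piMr// exprn_ge0// mode_ge0.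
by apply: (le_trans h); rewrite lerDl.
Qed.

(** The numerators are of order [m^2 |u0| + |u1|], and [phi_n'(pi)] in the denominator has size
    proportional to [m]: the quotient is the energy of the mode. *)
Lemma coef_le u0 u1 n : `|ycoef u0 u1 n| + `|xcoef u0 u1 n| <=
  (3 + (2 / (1 - alpha) + T)) / kappa * (mode n * `|u0 n| + `|u1 n| / mode n).
Proof.
have m0 := mode_gt0 n : 0 < mode n :> R; have k0 := sqrt2pi_gt0 : 0 < kappa.
have S1 := mode_sinc_le n; set Ms := 2 / _ + T in S1 *.
have C1 := norm_cos_le1 (w n * T); set C := cos _ in C1 *.
set S := sinc _ _ in S1 *.
have m2 : 0 <= mode n ^+ 2 :> R by rewrite exprn_ge0// ltW.
have q1 : `|u1 n + r n * u0 n| <= `|u1 n| + mode n ^+ 2 * `|u0 n|.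
  apply: (le_trans (ler_normD _ _)); rewrite normrM (ger0_norm (rr_ge0 _ rho_gt0 _)) lerD2l.
  by apply: ler_wpM2r => //; exact: rr_le.
set q := u1 n + _ in q1 *.
have wS : `|w n ^+ 2 * S| <= mode n ^+ 2.
  rewrite expr2 -mulrA -sin_sinc normrM (ger0_norm (om_ge0 _ _ _)).
  apply: (le_trans (ler_piMr (om_ge0 _ _ _) (norm_sin_le1 _))); exact: om_le.
have cn : `|c n| = kappa * mode n by exact: norm_derive1_phi.
rewrite /ycoef /xcoef -/S -/C -/q.
rewrite [`|_ / _|]normrM [`|(- _) / _|]normrM normfV cn normrN [`|mode n ^+ 2 * _|]normrM (ger0_norm m2).
have hy : `|w n ^+ 2 * S * u0 n - C * q| <= mode n ^+ 2 * `|u0 n| + (`|u1 n| + mode n ^+ 2 * `|u0 n|).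
  apply: (le_trans (ler_normB _ _)); apply: lerD; first by rewrite normrM ler_wpM2r.
  by rewrite normrM; apply: le_trans q1; rewrite ler_piMl.
have hx : `|C * u0 n + S * q| <= `|u0 n| + `|S| * (`|u1 n| + mode n ^+ 2 * `|u0 n|).
  apply: (le_trans (ler_normD _ _)); apply: lerD; first by rewrite normrM ler_piMl.
  by rewrite normrM ler_wpM2l.
set a := mode n * `|u0 n|; set b := `|u1 n| / mode n.
have a0 : 0 <= a by rewrite mulr_ge0// ltW.
have b0 : 0 <= b by rewrite divr_ge0// ltW.
apply: (@le_trans _ _ (((2 * a + b) + (a + (mode n ^+ 2 * `|S|) * (b + a))) / kappa)).
  rewrite [leRHS](_ : _ = (mode n ^+ 2 * `|u0 n| + (`|u1 n| + mode n ^+ 2 * `|u0 n|)) / (kappa * mode n)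
    + mode n ^+ 2 * (`|u0 n| + `|S| * (`|u1 n| + mode n ^+ 2 * `|u0 n|)) / (kappa * mode n)); last first.
    by rewrite /a /b; field; rewrite !gt_eqF.
  have ki : 0 <= (kappa * mode n)^-1 by rewrite invr_ge0 mulr_ge0 ?ltW.
  by apply: lerD; apply: ler_wpM2r => //; exact: ler_wpM2l.
rewrite [leRHS]mulrAC; apply: ler_wpM2r; first by rewrite invr_ge0 ltW.
have := ler_wpM2r (addr_ge0 b0 a0) S1; clear -a0 b0; nra.
Qed.

Lemma sol_T u0 u1 g n : 
  conv (CC (r n) (w n)) g T = expR (- r n * T) * ycoef u0 u1 n ->
  mode n ^+ 2 * conv (SS (r n) (w n)) g T = expR (- r n * T) * xcoef u0 u1 n ->
  sol alpha rho u0 u1 g T n = 0 /\ dsol alpha rho u0 u1 g T n = 0.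
Proof.
have c0 := derive1_phi_neq0 n : c n != 0 :> R.
have m0 : mode n ^+ 2 != 0 :> R by rewrite expf_neq0// gt_eqF// mode_gt0.
move=> hC hS; have {}hC : c n * conv (CC (r n) (w n)) g T =
   (w n) ^+ 2 * SS (r n) (w n) T * u0 n - CC (r n) (w n) T * (u1 n + r n * u0 n).
  by rewrite hC /ycoef /SS /CC; field.
have {}hS : c n * conv (SS (r n) (w n)) g T =
   - (CC (r n) (w n) T * u0 n + SS (r n) (w n) T * (u1 n + r n * u0 n)).
  by apply: (mulfI m0); rewrite mulrCA hS /xcoef /SS /CC; field.
split; first by rewrite /sol hS; ring.
rewrite /dsol [c n * (_ - _)]mulrBr hC [c n * (r n * _)]mulrCA hS om2//; ring.
Qed.

Lemma control : exists2 C, 0 <= C & forall u0 u1, in_XD 1 u0 -> in_XD (-1) u1 ->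
  exists g, [/\ in_L2 T g, (L2norm T g <= (C * (XDnorm 1 u0 + XDnorm (-1) u1))%:E)%E,
    XD_continuous 1 T (sol alpha rho u0 u1 g),
    XD_C1 (-1) T (sol alpha rho u0 u1 g) (dsol alpha rho u0 u1 g) &
    sol alpha rho u0 u1 g T = 0 /\ dsol alpha rho u0 u1 g T = 0].
Proof.
have [M M0 HM] := moments T_gt0 alpha_ge0 alpha_lt1 rho_gt0 rho_le2.
set K := (3 + (2 / (1 - alpha) + T)) / kappa.
(* [2 K^2] comes from squaring [coef_le] with [(a + b)^2 <= 2 (a^2 + b^2)]; the rest is the constant
   of [moments]. *)
pose A := 6 * (gramK T alpha * M ^+ 2) * (2 * K ^+ 2).
exists (Num.sqrt A) => [|u0 u1 Xu0 Xu1]; first exact: sqrtr_ge0.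
set X := XDnorm 1 u0; set Y := XDnorm (-1) u1.
have X0 : 0 <= X by exact: XDnorm_ge0.
have Y0 : 0 <= Y by exact: XDnorm_ge0.
have [|g [G [L2g cG gG gn [Hm [D [D0 [B DB] hC hS]]]]]] :=
    HM (ycoef u0 u1) (xcoef u0 u1) (2 * K ^+ 2 * (X + Y) ^+ 2).
  move=> N; apply: (@le_trans _ _ (\sum_(0 <= k < N) 2 * K ^+ 2 * (XDterms 1 u0 k + XDterms (-1) u1 k))).
    apply: ler_sum => k _; rewrite XDterms1 XDtermsN1.
    have h := coef_le u0 u1 k; rewrite -/K in h.
    set a := mode k * _ in h *; set b := _ / mode k in h *.
    apply: (@le_trans _ _ ((K * (a + b)) ^+ 2)).
      have h0 : 0 <= `|ycoef u0 u1 k| + `|xcoef u0 u1 k| by rewrite addr_ge0.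
      by rewrite ler_sqr ?nnegrE//; exact: le_trans h.
    rewrite exprMn [leRHS](_ : _ = K ^+ 2 * (2 * (a ^+ 2 + b ^+ 2))); last by ring.
    apply: ler_wpM2l; first exact: sqr_ge0.
    have := sqr_ge0 (a - b); nra.
  rewrite -mulr_sumr big_split/=; apply: ler_wpM2l; first by rewrite mulr_ge0 ?sqr_ge0.
  apply: (le_trans (lerD (XD_sum_le N Xu0) (XD_sum_le N Xu1))); rewrite -/X -/Y.
  by have := mulr_ge0 X0 Y0; nra.
exists g; split => //.
- apply: (le_trans gn); rewrite lee_fin.
  rewrite (_ : 6 * _ * _ = A * (X + Y) ^+ 2); last by rewrite /A; ring.
  rewrite sqrtrM; first by rewrite sqrtr_sqr ger0_norm// addr_ge0.
  have gK := gramK_ge0 T_gt0 alpha_lt1.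
  by apply: mulr_ge0; [apply: mulr_ge0 => //; apply: mulr_ge0; rewrite ?sqr_ge0|apply: mulr_ge0; rewrite ?sqr_ge0].
- by have [] := sol_C1 T_gt0 alpha_ge0 alpha_lt1 rho_gt0 rho_le2 Xu0 Xu1 L2g cG gG D0 DB hC hS.
- by have [] := sol_C1 T_gt0 alpha_ge0 alpha_lt1 rho_gt0 rho_le2 Xu0 Xu1 L2g cG gG D0 DB hC hS.
- by split; apply/funext => n; have [h1 h2] := Hm n; have [] := sol_T h1 h2.
Qed.

End Control.

(** * The adjoint problem and the weak formulation *)

Section Adjoint.
Context {R : realType}.
Variables (alpha rho : R).
Hypotheses (alpha_lt1 : alpha < 1) (rho_gt0 : 0 < rho) (rho_le2 : rho <= 2).

Local Notation r n := (rr alpha rho n).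
Local Notation w n := (om alpha rho n).

(** In the reversed time [tau - t] the adjoint equation is the damped oscillator itself, with
    initial data [w0] and [- w1]. *)
Definition adjw (w0 w1 : nat -> R) tau t n : R :=
  w0 n * CC (r n) (w n) (tau - t) + (r n * w0 n - w1 n) * SS (r n) (w n) (tau - t).

Definition dadjw (w0 w1 : nat -> R) tau t n : R :=
  w1 n * (CC (r n) (w n) (tau - t) - r n * SS (r n) (w n) (tau - t))
  + mode n ^+ 4 * w0 n * SS (r n) (w n) (tau - t).

Lemma rho_mode n : rho * mode n `^ (2 * alpha) = 2 * r n.
Proof. by rewrite /rr; field. Qed.

Lemma der_adj w0 w1 tau n (t : R) : is_derive t 1 (fun s => adjw w0 w1 tau s n) (dadjw w0 w1 tau t n).
Proof.
have dC := der_rev (der_CC (r n) (w n) (tau - t)).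
have dS := der_rev (der_SS (r n) (w n) (tau - t)).
have := derD (derZ (w0 n) dC) (derZ (r n * w0 n - w1 n) dS).
by congr is_derive; rewrite /dadjw om2//; ring.
Qed.

Lemma der_dadj w0 w1 tau n (t : R) : is_derive t 1 (fun s => dadjw w0 w1 tau s n)
  (2 * r n * dadjw w0 w1 tau t n - mode n ^+ 4 * adjw w0 w1 tau t n).
Proof.
have dC := der_rev (der_CC (r n) (w n) (tau - t)).
have dS := der_rev (der_SS (r n) (w n) (tau - t)).
have := derD (derZ (w1 n) (derB dC (derZ (r n) dS))) (derZ (mode n ^+ 4 * w0 n) dS).
by congr is_derive; rewrite /dadjw /adjw om2//; ring.
Qed.

Lemma cont_adj w0 w1 tau n : continuous (fun s => adjw w0 w1 tau s n).
Proof. by move=> s; exact: is_derive_cont (der_adj w0 w1 tau n s). Qed.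

Lemma cont_dadj w0 w1 tau n : continuous (fun s => dadjw w0 w1 tau s n).
Proof. by move=> s; exact: is_derive_cont (der_dadj w0 w1 tau n s). Qed.

Lemma adj_tau w0 w1 tau : adjw w0 w1 tau tau = w0.
Proof. by apply/funext => n; rewrite /adjw subrr CC0 SS0; ring. Qed.

Lemma dadj_tau w0 w1 tau : dadjw w0 w1 tau tau = w1.
Proof. by apply/funext => n; rewrite /dadjw subrr CC0 SS0; ring. Qed.

Lemma adjoint_solution_adj w0 w1 tau :
  adjoint_solution alpha rho tau w0 w1 (adjw w0 w1 tau) (dadjw w0 w1 tau).
Proof.
move=> n; split.
- by apply: continuous_subspaceT; exact: cont_adj.
- by apply: continuous_subspaceT; exact: cont_dadj.
- move=> t _; have d2 := der_dadj w0 w1 tau n t; split; [exact: der_adj|by case: d2|].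
  by rewrite derive1E (@derive_val _ _ _ _ _ _ _ d2) rho_mode; ring.
- by rewrite adj_tau.
- by rewrite dadj_tau.
Qed.

(* Lagrange's identity: [(dz - 2 r z) y - z dy] is constant in time. *)
Lemma lagrange tau n t (z dz y dy : R -> R) : 0 <= t <= tau ->
  {within `[0, tau], continuous z} -> {within `[0, tau], continuous dz} ->
  (forall s : R, 0 < s < tau -> is_derive s 1 z (dz s) /\
     is_derive s 1 dz (2 * r n * dz s - mode n ^+ 4 * z s)) ->
  (forall s : R, is_derive s 1 y (dy s)) ->
  (forall s : R, is_derive s 1 dy (- (2 * r n * dy s) - mode n ^+ 4 * y s)) ->
  z tau = 0 -> dz tau = 0 -> (dz t - 2 * r n * z t) * y t = z t * dy t.
Proof.
move=> /andP[t0 tt] cz cdz dzE dyE ddyE z0 dz0.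
pose F s := (dz s - 2 * r n * z s) * y s - z s * dy s.
have [||x _] := @MVT_segment R F (fun=> 0) t tau tt.
- move=> s; rewrite in_itv/= => /andP[ts st].
  have [d1 d2] := dzE s ltac:(by rewrite (le_lt_trans t0 ts) st).
  have := derB (derM (derB d2 (derZ (2 * r n) d1)) (dyE s)) (derM d1 (ddyE s)).
  by congr is_derive; ring.
- have sub : `[t, tau] `<=` `[0, tau] by move=> x /=; rewrite !in_itv/= => /andP[/(le_trans t0) -> ->].
  have cy : continuous y by move=> s; exact: is_derive_cont (dyE s).
  have cdy : continuous dy by move=> s; exact: is_derive_cont (ddyE s).
  have {}cz := continuous_subspaceW sub cz; have {}cdz := continuous_subspaceW sub cdz.
  have {}cy : {within `[t, tau], continuous y} by exact: continuous_subspaceT.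
  have {}cdy : {within `[t, tau], continuous dy} by exact: continuous_subspaceT.
  move=> s; apply: cvgB; apply: cvgM; [|exact: cy|exact: cz|exact: cdy].
  by apply: cvgB; [exact: cdz|apply: cvgM; [exact: cvg_cst|exact: cz]].
by rewrite mul0r /F z0 dz0 !mulr0 subr0 !mul0r subr0 => /eqP; rewrite sub0r oppr_eq0 subr_eq0 => /eqP.
Qed.

(** Lagrange's identity pairs the difference of two solutions with the forward solutions issued at
    time [t] with data [(0, 1)] and [(1, 0)]; the first gives [z t = 0], the second then
    [dz t = 0]. *)
Lemma adjoint_unique w0 w1 tau v dv : adjoint_solution alpha rho tau w0 w1 v dv ->
  forall t n, 0 <= t <= tau -> v t n = adjw w0 w1 tau t n /\ dv t n = dadjw w0 w1 tau t n.
Proof.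
move=> H t n tt; have [cv cdv vE vt dvt] := H n.
pose z s := v s n - adjw w0 w1 tau s n; pose dz s := dv s n - dadjw w0 w1 tau s n.
have ca : {within `[0, tau], continuous (fun s => adjw w0 w1 tau s n)}.
  by apply: continuous_subspaceT; exact: cont_adj.
have cad : {within `[0, tau], continuous (fun s => dadjw w0 w1 tau s n)}.
  by apply: continuous_subspaceT; exact: cont_dadj.
have cz : {within `[0, tau], continuous z}.
  move=> s; apply: cvgB; [exact: cv|]. exact: ca.
have cdz : {within `[0, tau], continuous dz}.
  move=> s; apply: cvgB; [exact: cdv|]. exact: cad.
have zE s : 0 < s < tau -> is_derive s 1 z (dz s) /\
     is_derive s 1 dz (2 * r n * dz s - mode n ^+ 4 * z s).
  move=> st; have [|d1 d2 d3] := vE s; first by rewrite in_itv.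
  split; first exact: derB d1 (der_adj w0 w1 tau n s).
  have d2' : is_derive s 1 (fun s => dv s n) (2 * r n * dv s n - mode n ^+ 4 * v s n).
    apply: DeriveDef => //; rewrite -derive1E.
    by apply/eqP; rewrite -subr_eq0; apply/eqP; rewrite -[RHS]d3 rho_mode; ring.
  have := derB d2' (der_dadj w0 w1 tau n s); congr is_derive; rewrite /dz /z; ring.
have zt : z tau = 0 by rewrite /z adj_tau vt subrr.
have dzt : dz tau = 0 by rewrite /dz dadj_tau dvt subrr.
have shift F (d s : R) : is_derive (s - t) 1 F d -> is_derive s 1 (fun s => F (s - t)) d.
  move=> dF; have h := derB (is_derive_id s (1 : R)) (der_cst t s).
  by have := @der_comp R F (fun u => u - t) s d (1 - 0) dF h; rewrite subr0 mulr1.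
have dS (s : R) : is_derive s 1 (fun s => SS (r n) (w n) (s - t))
    (CC (r n) (w n) (s - t) - r n * SS (r n) (w n) (s - t)) by apply: shift; exact: der_SS.
have dC (s : R) : is_derive s 1 (fun s => CC (r n) (w n) (s - t))
    (- r n * CC (r n) (w n) (s - t) - w n ^+ 2 * SS (r n) (w n) (s - t)) by apply: shift; exact: der_CC.
have z0 : z t = 0.
  have ddS (s : R) : is_derive s 1 (fun s => CC (r n) (w n) (s - t) - r n * SS (r n) (w n) (s - t))
    (- (2 * r n * (CC (r n) (w n) (s - t) - r n * SS (r n) (w n) (s - t)))
     - mode n ^+ 4 * SS (r n) (w n) (s - t)).
    have := derB (dC s) (derZ (r n) (dS s)).
    by congr is_derive; rewrite om2//; ring.
  by have := lagrange tt cz cdz zE dS ddS zt dzt; rewrite subrr CC0 SS0 !mulr0 subr0 mulr1.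
have dy (s : R) : is_derive s 1 (fun s => CC (r n) (w n) (s - t) + r n * SS (r n) (w n) (s - t))
    (- mode n ^+ 4 * SS (r n) (w n) (s - t)).
  by have := derD (dC s) (derZ (r n) (dS s)); congr is_derive; rewrite om2//; ring.
have ddy (s : R) : is_derive s 1 (fun s => - mode n ^+ 4 * SS (r n) (w n) (s - t))
    (- (2 * r n * (- mode n ^+ 4 * SS (r n) (w n) (s - t)))
     - mode n ^+ 4 * (CC (r n) (w n) (s - t) + r n * SS (r n) (w n) (s - t))).
  by have := derZ (- mode n ^+ 4) (dS s); congr is_derive; ring.
have dz0 : dz t = 0.
  have := lagrange tt cz cdz zE dy ddy zt dzt.
  by rewrite subrr CC0 SS0 z0 !mulr0 addr0 mulr1 subr0.
by split; apply/eqP; rewrite -subr_eq0; apply/eqP.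
Qed.

End Adjoint.

(** * Duality pairings and integrals against L^2 functions *)

Section Pairing.
Context {R : realType}.
Implicit Types (a b v : nat -> R) (K t : R).

Lemma eq_L2norm t (f h : R -> R) : (forall s, 0 < s < t -> f s = h s) -> L2norm t f = L2norm t h.
Proof.
move=> fh; suff E : f \_ `]0, t[ = h \_ `]0, t[ by rewrite /L2norm E.
apply/funext => s; rewrite /patch; case: ifPn => // /set_mem/=.
by rewrite in_itv/= => /fh.
Qed.

Definition energy a b n := mode n * `|a n| + `|b n| / mode n.

Lemma energy_ge0 a b n : 0 <= energy a b n.
Proof. by rewrite /energy addr_ge0// mulr_ge0 ?invr_ge0 ?mode_ge0. Qed.

Lemma sum_energy a b N : in_XD 1 a -> in_XD (-1) b ->
  \sum_(0 <= n < N) energy a b n ^+ 2 <= 2 * (XDnorm 1 a ^+ 2 + XDnorm (-1) b ^+ 2).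
Proof.
move=> Xa Xb; apply: le_trans (ler_wpM2l _ (lerD (XD_sum_le N Xa) (XD_sum_le N Xb))) => //.
rewrite -big_split/= mulr_sumr; apply: ler_sum => n _; rewrite XDterms1 XDtermsN1 /energy.
set x := mode n * _; set y := _ / mode n; have := sqr_ge0 (x - y); nra.
Qed.

Lemma sqr_le_mono (x y : R) : 0 <= x -> x <= y -> x ^+ 2 <= y ^+ 2.
Proof. by move=> x0 xy; rewrite ler_sqr ?nnegrE// (le_trans x0). Qed.

Lemma in_XD_energy p v K a b : in_XD 1 a -> in_XD (-1) b ->
  (forall n, XDterms p v n <= (K * energy a b n) ^+ 2) -> in_XD p v.
Proof.
move=> Xa Xb H; apply: (@in_XD_dom _ _ _ (fun n => (K * energy a b n) ^+ 2)
  (K ^+ 2 * (2 * (XDnorm 1 a ^+ 2 + XDnorm (-1) b ^+ 2)))) => // N.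
under eq_bigr do rewrite exprMn; rewrite -mulr_sumr; apply: ler_wpM2l; first exact: sqr_ge0.
exact: sum_energy.
Qed.

Lemma in_XD1_energy v K a b : in_XD 1 a -> in_XD (-1) b ->
  (forall n, mode n * `|v n| <= K * energy a b n) -> in_XD 1 v.
Proof.
move=> Xa Xb H; apply: (in_XD_energy (K := K) Xa Xb) => n; rewrite XDterms1.
by apply: sqr_le_mono => //; rewrite mulr_ge0 ?mode_ge0.
Qed.

Lemma in_XDN1_energy v K a b : in_XD 1 a -> in_XD (-1) b ->
  (forall n, `|v n| / mode n <= K * energy a b n) -> in_XD (-1) v.
Proof.
move=> Xa Xb H; apply: (in_XD_energy (K := K) Xa Xb) => n; rewrite XDtermsN1.
by apply: sqr_le_mono => //; rewrite divr_ge0 ?mode_ge0.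
Qed.

(** [|a_n b_n|] is the product of [m |a_n|] and [|b_n| / m], both square summable. Since [pairing]
    is a total limit, its value is meaningful only with this convergence. *)
Lemma pairing_cvg a b : in_XD 1 a -> in_XD (-1) b ->
  \sum_(0 <= n < N) a n * b n @[N --> \oo] --> pairing a b.
Proof.
move=> Xa Xb; suff : cvgn (series (fun n => a n * b n)) by [].
apply: normed_cvg; apply: (@sum_cvg _ _ (XDnorm 1 a ^+ 2 + XDnorm (-1) b ^+ 2)) => [n|N]; first exact: normr_ge0.
apply: le_trans (lerD (XD_sum_le N Xa) (XD_sum_le N Xb)).
rewrite -big_split/=; apply: ler_sum => n _; rewrite XDterms1 XDtermsN1 normrM.
have m0 := mode_gt0 n : 0 < mode n :> R.
have -> : `|a n| * `|b n| = (mode n * `|a n|) * (`|b n| / mode n) by field; rewrite gt_eqF.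
set x := mode n * _; set y := _ / mode n; have := sqr_ge0 (x - y); have := sqr_ge0 (x + y); nra.
Qed.

Lemma pairingC a b : pairing a b = pairing b a.
Proof. by rewrite /pairing; congr (limn (series _)); apply/funext => n; rewrite mulrC. Qed.

Lemma pairing_cvgC a b : in_XD (-1) a -> in_XD 1 b ->
  \sum_(0 <= n < N) a n * b n @[N --> \oo] --> pairing a b.
Proof.
move=> Xa Xb; rewrite pairingC; under eq_fun do under eq_bigr do rewrite mulrC.
exact: pairing_cvg.
Qed.

Lemma int0_mul_lin t g (f1 f2 : R -> R) x y : in_L2 t g -> continuous f1 -> continuous f2 ->
  int0 t (fun s => g s * (x * f1 s + y * f2 s)) =
  x * int0 t (fun s => f1 s * g s) + y * int0 t (fun s => f2 s * g s).
Proof.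
move=> L2g c1 c2.
have i1 := in_L2_mul L2g (in_L2_cont t c1); have i2 := in_L2_mul L2g (in_L2_cont t c2).
have c1' : continuous (fun s => x * f1 s) by exact: contZ.
have c2' : continuous (fun s => y * f2 s) by exact: contZ.
have i1' := in_L2_mul L2g (in_L2_cont t c1'); have i2' := in_L2_mul L2g (in_L2_cont t c2').
rewrite /int0 -!RintegralZl// -RintegralD//.
- by apply: eq_Rintegral => s _; ring.
- by apply: eq_integrable i1' => // s _ /=; rewrite mulrA.
- by apply: eq_integrable i2' => // s _ /=; rewrite mulrA.
Qed.

Lemma int0_mul_sum t g (psi : nat -> R -> R) N : in_L2 t g -> (forall n, continuous (psi n)) ->
  int0 t (fun s => g s * \sum_(0 <= n < N) psi n s) = \sum_(0 <= n < N) int0 t (fun s => g s * psi n s).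
Proof.
move=> L2g cpsi; elim: N => [|N IH].
  by rewrite big_geq//; under eq_int0 do rewrite big_geq// mulr0; exact: int0_0.
rewrite big_nat_recr//= -IH.
have c1 : continuous (fun s => \sum_(0 <= n < N) psi n s) by exact: cont_sum.
have := int0_mul_lin 1 1 L2g c1 (cpsi N); rewrite !mul1r.
under eq_int0 do rewrite !mul1r -big_nat_recr//=.
move=> ->; congr (_ + _); apply: eq_int0 => s _; exact: mulrC.
Qed.

End Pairing.

(** * The weak identity for the explicit solution *)

Section WeakIdentity.
Context {R : realType}.
Variables (T alpha rho : R).
Hypotheses (T_gt0 : 0 < T) (alpha_ge0 : 0 <= alpha) (alpha_lt1 : alpha < 1)
  (rho_gt0 : 0 < rho) (rho_le2 : rho <= 2).

Local Notation r n := (rr alpha rho n).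
Local Notation w n := (om alpha rho n).
Local Notation c n := (derive1 (phi n) pi).
Local Notation kappa := (Num.sqrt (2 / pi : R)).
Local Notation adj := (adjw alpha rho).
Local Notation dadj := (dadjw alpha rho).
Local Notation usol := (sol alpha rho).
Local Notation dusol := (dsol alpha rho).
Local Notation Ms := (modeM T alpha).

(** With the closed forms of [sol] and [adjw] every term is linear in [CC], [SS] at [tau] and in the
    two convolutions, and the coefficients cancel; no integration by parts in time is involved. *)
Lemma mode_identity w0 w1 u0 u1 g tau n : in_L2 tau g ->
  (w1 n - 2 * r n * w0 n) * usol u0 u1 g tau n - w0 n * dusol u0 u1 g tau n
  - (dadj w0 w1 tau 0 n - 2 * r n * adj w0 w1 tau 0 n) * u0 n + adj w0 w1 tau 0 n * u1 n
  + int0 tau (fun s => g s * (c n * adj w0 w1 tau s n)) = 0.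
Proof.
move=> L2g; have cC : continuous (fun s => CC (r n) (w n) (tau - s)) by apply: cont_rev; exact: cont_CC.
have cS : continuous (fun s => SS (r n) (w n) (tau - s)) by apply: cont_rev; exact: cont_SS.
have -> : int0 tau (fun s => g s * (c n * adj w0 w1 tau s n)) =
    int0 tau (fun s => g s * ((c n * w0 n) * CC (r n) (w n) (tau - s)
       + (c n * (r n * w0 n - w1 n)) * SS (r n) (w n) (tau - s))).
  by apply: eq_int0 => s _; rewrite /adjw; ring.
rewrite int0_mul_lin// /adjw /dadjw /sol /dsol subr0 /conv; ring.
Qed.

Lemma rr_norm_le n (x : R) : r n * `|x| / mode n <= mode n * `|x|.
Proof.
rewrite ler_pdivrMr ?mode_gt0// [leRHS]mulrAC; apply: ler_wpM2r => //.
by rewrite -expr2; exact: rr_le.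
Qed.

Lemma init_le (w0 w1 : nat -> R) n :
  mode n * `|w0 n| <= energy w0 w1 n /\ `|w1 n| / mode n <= energy w0 w1 n.
Proof. by rewrite /energy lerDl lerDr !mulr_ge0 ?invr_ge0 ?mode_ge0. Qed.

Lemma adj_le w0 w1 tau t n : 0 <= t -> t <= tau -> tau <= T ->
  mode n * `|adj w0 w1 tau t n| <= (1 + Ms) * energy w0 w1 n.
Proof.
move=> t0 tt tT; have sT : 0 <= tau - t <= T by lra.
have m0 := mode_gt0 n : 0 < mode n :> R.
have S1 := mode_SS_le T_gt0 alpha_ge0 alpha_lt1 rho_gt0 rho_le2 n sT.
have C1 : `|CC (r n) (w n) (tau - t)| <= 1 by apply: CC_le1; [exact: rr_ge0|case/andP: sT].
rewrite /adjw; set S := SS _ _ _ in S1 *; set C := CC _ _ _ in C1 *.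
have q : `|r n * w0 n - w1 n| <= mode n * energy w0 w1 n.
  apply: (le_trans (ler_normB _ _)); rewrite normrM (ger0_norm (rr_ge0 _ rho_gt0 _)).
  rewrite [leRHS](_ : _ = mode n ^+ 2 * `|w0 n| + `|w1 n|); last by rewrite /energy; field; rewrite gt_eqF.
  by rewrite lerD2r ler_wpM2r//; exact: rr_le.
apply: (@le_trans _ _ (mode n * (`|w0 n| + mode n * energy w0 w1 n * `|S|))).
  apply: ler_wpM2l; first exact: ltW.
  apply: (le_trans (ler_normD _ _)); apply: lerD; first by rewrite normrM ler_piMr.
  by rewrite normrM ler_wpM2r.
rewrite [leLHS](_ : _ = mode n * `|w0 n| + (mode n ^+ 2 * `|S|) * energy w0 w1 n); last by ring.
rewrite mulrDl mul1r; apply: lerD; first by have [] := init_le w0 w1 n.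
by apply: ler_wpM2r S1; exact: energy_ge0.
Qed.

Lemma dadj_le w0 w1 tau t n : 0 <= t -> t <= tau -> tau <= T ->
  `|dadj w0 w1 tau t n| / mode n <= (1 + Ms) * energy w0 w1 n.
Proof.
move=> t0 tt tT; have sT : 0 <= tau - t <= T by lra.
have m0 := mode_gt0 n : 0 < mode n :> R.
have S1 := mode_SS_le T_gt0 alpha_ge0 alpha_lt1 rho_gt0 rho_le2 n sT.
have S2 := rr_SS_le T_gt0 alpha_ge0 alpha_lt1 rho_gt0 rho_le2 n sT.
have C1 : `|CC (r n) (w n) (tau - t)| <= 1 by apply: CC_le1; [exact: rr_ge0|case/andP: sT].
rewrite /dadjw; set S := SS _ _ _ in S1 S2 *; set C := CC _ _ _ in C1 *.
have CS : `|C - r n * S| <= 1 + Ms.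
  by apply: (le_trans (ler_normB _ _)); rewrite [`|r n * _|]normrM (ger0_norm (rr_ge0 _ rho_gt0 _)) lerD.
rewrite ler_pdivrMr//.
apply: (@le_trans _ _ (`|w1 n| * (1 + Ms) + mode n ^+ 4 * `|w0 n| * `|S|)).
  apply: (le_trans (ler_normD _ _)); apply: lerD; first by rewrite normrM ler_wpM2l.
  by rewrite [`|_ * S|]normrM [`|_ * w0 n|]normrM (ger0_norm (exprn_ge0 4 (ltW m0))).
have a0 : 0 <= mode n * `|w0 n| by rewrite mulr_ge0// ltW.
rewrite [leLHS](_ : _ = (`|w1 n| / mode n * (1 + Ms) + mode n * `|w0 n| * (mode n ^+ 2 * `|S|)) * mode n); last first.
  by field; rewrite gt_eqF.
apply: ler_wpM2r; first exact: ltW.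
have := ler_wpM2l a0 S1; rewrite /energy.
set A := mode n * `|w0 n| in a0 *; set B := _ / mode n; set q := A * (_ * _).
move=> h; rewrite -subr_ge0 (_ : _ - _ = A + (A * Ms - q)); last by ring.
by rewrite addr_ge0// subr_ge0.
Qed.

Lemma rhoAD (w0 : nat -> R) n : (rho *: AD alpha w0) n = 2 * r n * w0 n.
Proof. by rewrite -rho_mode -mulrA. Qed.

Lemma in_XD_adj w0 w1 tau : 0 <= tau <= T -> in_XD 1 w0 -> in_XD (-1) w1 ->
  [/\ in_XD 1 (adj w0 w1 tau 0), in_XD (-1) (w1 - rho *: AD alpha w0)
    & in_XD (-1) (dadj w0 w1 tau 0 - rho *: AD alpha (adj w0 w1 tau 0))].
Proof.
move=> /andP[t0 tT] X0 X1.
have a1 n := adj_le w0 w1 n (lexx 0) t0 tT; have a2 n := dadj_le w0 w1 n (lexx 0) t0 tT.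
have sub (x y : nat -> R) n : `|(x - rho *: AD alpha y) n| / mode n <= `|x n| / mode n + 2 * (mode n * `|y n|).
  rewrite -[X in X <= _]/(`|x n - (rho *: AD alpha y) n| / mode n) rhoAD.
  apply: (le_trans (ler_wpM2r _ (ler_normB _ _))); first by rewrite invr_ge0 mode_ge0.
  rewrite mulrDl lerD2l -mulrA normrM (ger0_norm (ler0n _ 2)) -mulrA ler_wpM2l//.
  by rewrite normrM (ger0_norm (rr_ge0 _ rho_gt0 _)); exact: rr_norm_le.
split; first exact: (in_XD1_energy (K := 1 + Ms) X0 X1).
- apply: (in_XDN1_energy (K := 3) X0 X1) => n; apply: (le_trans (sub _ _ _)).
  have [h1 h2] := init_le w0 w1 n; apply: (le_trans (lerD h2 (ler_wpM2l (ler0n _ 2) h1))).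
  by rewrite le_eqVlt; apply/orP; left; apply/eqP; ring.
- apply: (in_XDN1_energy (K := 3 * (1 + Ms)) X0 X1) => n; apply: (le_trans (sub _ _ _)).
  apply: (le_trans (lerD (a2 n) (ler_wpM2l (ler0n _ 2) (a1 n)))).
  by rewrite le_eqVlt; apply/orP; left; apply/eqP; ring.
Qed.

(** Hidden regularity: [phi_n'(pi)] has size proportional to [m], so the coefficients against [CC]
    and [m^2 SS] are bounded by the energy of mode [n], and almost orthogonality sums the trace in
    L^2. *)
Lemma adj_trace w0 w1 tau : 0 <= tau <= T -> in_XD 1 w0 -> in_XD (-1) w1 ->
  exists2 h, in_L2 tau h & L2lim tau h (fun N s => \sum_(0 <= n < N) c n * adj w0 w1 tau s n).
Proof.
move=> tT X0 X1.
pose y n := c n * w0 n; pose x n := c n * (r n * w0 n - w1 n) / mode n ^+ 2.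
pose qc n s := CC (r n) (w n) (tau - s); pose qs n s := mode n ^+ 2 * SS (r n) (w n) (tau - s).
have oc n : osc tau Ms (Om alpha rho n) (qc n) by exact: osc_CC.
have os n : osc tau Ms (Om alpha rho n) (qs n) by exact: osc_SS.
pose psi n s := y n * qc n s + x n * qs n s.
have cpsi n : continuous (psi n).
  by apply: contD; apply: contZ; [exact: osc_cont (oc n)|exact: osc_cont (os n)].
have gK0 : 0 <= gramK T alpha * Ms ^+ 2 by rewrite mulr_ge0 ?sqr_ge0//; exact: gramK_ge0 T_gt0 alpha_lt1.
have xy n : `|y n| + `|x n| <= 2 * kappa * energy w0 w1 n.
  have m0 := mode_gt0 n : 0 < mode n :> R; have k0 := sqrt2pi_gt0 : 0 < kappa.
  rewrite /y /x !normrM norm_derive1_phi normfV (ger0_norm (exprn_ge0 2 (ltW m0))).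
  have q : `|r n * w0 n - w1 n| <= mode n ^+ 2 * `|w0 n| + `|w1 n|.
    apply: (le_trans (ler_normB _ _)); rewrite normrM (ger0_norm (rr_ge0 _ rho_gt0 _)) lerD2r.
    by rewrite ler_wpM2r//; exact: rr_le.
  apply: (@le_trans _ _ (kappa * mode n * `|w0 n| + kappa * mode n * (mode n ^+ 2 * `|w0 n| + `|w1 n|) / mode n ^+ 2)).
    rewrite lerD2l; apply: ler_wpM2r; first by rewrite invr_ge0 exprn_ge0// ltW.
    by apply: ler_wpM2l q; rewrite mulr_ge0 ?ltW.
  rewrite [leLHS](_ : _ = kappa * (2 * (mode n * `|w0 n|) + `|w1 n| / mode n)); last first.
    by field; rewrite gt_eqF.
  rewrite [leRHS](_ : _ = kappa * (2 * energy w0 w1 n)); last by ring.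
  apply: ler_wpM2l; first exact: ltW.
  by rewrite /energy mulrDr lerD2l ler_peMl ?ler1n// divr_ge0// ltW.
have [|h [L2h hl _]] := series_L2 cpsi gK0 (fun n => addr_ge0 (normr_ge0 (y n)) (normr_ge0 (x n)))
    (gram_comb T_gt0 alpha_ge0 alpha_lt1 rho_gt0 rho_le2 y x tT oc os)
    (B := (2 * kappa) ^+ 2 * (2 * (XDnorm 1 w0 ^+ 2 + XDnorm (-1) w1 ^+ 2))).
  move=> N; apply: (@le_trans _ _ (\sum_(0 <= n < N) (2 * kappa * energy w0 w1 n) ^+ 2)).
    by apply: ler_sum => n _; apply: sqr_le_mono => //; rewrite addr_ge0.
  under eq_bigr do rewrite exprMn; rewrite -mulr_sumr; apply: ler_wpM2l; first exact: sqr_ge0.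
  exact: sum_energy.
exists h => // e /hl[N0 HN0]; exists N0 => N /HN0.
rewrite (@eq_L2norm _ _ _ (fun s => h s - \sum_(0 <= n < N) c n * adj w0 w1 tau s n))// => s _.
congr (_ - _); apply: eq_bigr => n _; rewrite /psi /y /x /qc /qs /adjw.
have m0 := mode_gt0 n : 0 < mode n :> R; field; rewrite gt_eqF//.
Qed.

(** The partial sums of the five terms add up to a sum of mode identities, that is, to 0, and each
    of them converges. *)
Lemma weak_identity u0 u1 g w0 w1 tau h : 0 <= tau <= T -> in_L2 tau g ->
  in_XD 1 u0 -> in_XD (-1) u1 -> in_XD 1 (usol u0 u1 g tau) -> in_XD (-1) (dusol u0 u1 g tau) ->
  in_XD 1 w0 -> in_XD (-1) w1 -> in_L2 tau h ->
  L2lim tau h (fun N s => \sum_(0 <= n < N) c n * adj w0 w1 tau s n) ->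
  0 = pairing (w1 - rho *: AD alpha w0) (usol u0 u1 g tau) - pairing w0 (dusol u0 u1 g tau)
   - pairing (dadj w0 w1 tau 0 - rho *: AD alpha (adj w0 w1 tau 0)) u0
   + pairing (adj w0 w1 tau 0) u1 + int0 tau (fun t => h t * g t).
Proof.
move=> tT L2g Xu0 Xu1 Xu Xdu X0 X1 L2h hl; have [Xa Xw Xda] := in_XD_adj tT X0 X1.
have ca n : continuous (fun s => c n * adj w0 w1 tau s n) by apply: contZ; exact: cont_adj.
have cG N : in_L2 tau (fun s => \sum_(0 <= n < N) c n * adj w0 w1 tau s n).
  by apply: in_L2_cont; exact: cont_sum.
have l5 := int0_mul_lim L2h L2g cG hl.
have l : (\sum_(0 <= n < N) (w1 - rho *: AD alpha w0) n * usol u0 u1 g tau n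
    - \sum_(0 <= n < N) w0 n * dusol u0 u1 g tau n
    - \sum_(0 <= n < N) (dadj w0 w1 tau 0 - rho *: AD alpha (adj w0 w1 tau 0)) n * u0 n
    + \sum_(0 <= n < N) adj w0 w1 tau 0 n * u1 n
    + int0 tau (fun s => g s * \sum_(0 <= n < N) c n * adj w0 w1 tau s n)) @[N --> \oo] -->
    pairing (w1 - rho *: AD alpha w0) (usol u0 u1 g tau) - pairing w0 (dusol u0 u1 g tau)
   - pairing (dadj w0 w1 tau 0 - rho *: AD alpha (adj w0 w1 tau 0)) u0
   + pairing (adj w0 w1 tau 0) u1 + int0 tau (fun t => g t * h t).
  apply: cvgD l5; apply: cvgD (pairing_cvg Xa Xu1); apply: cvgB (pairing_cvgC Xda Xu0).
  by apply: cvgB (pairing_cvgC Xw Xu) (pairing_cvg X0 Xdu).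
have -> : int0 tau (fun t => h t * g t) = int0 tau (fun t => g t * h t).
  by apply: eq_int0 => s _; rewrite mulrC.
symmetry; apply: (cvg_eventually (n := 0%N) l) => N _.
rewrite int0_mul_sum// -!sumrB -!big_split/= big1// => n _.
rewrite -[RHS](mode_identity w0 w1 u0 u1 n L2g); congr (_ * _ - _ - _ * _ + _ + _).
- by rewrite -[LHS]/(w1 n - (rho *: AD alpha w0) n) rhoAD.
- by rewrite -[LHS]/(dadj w0 w1 tau 0 n - (rho *: AD alpha (adj w0 w1 tau 0)) n) rhoAD.
Qed.

End WeakIdentity.

(** * Weak solutions and their values at time T *)

Section NullControl.
Context {R : realType}.

Lemma L2norm_cvg0P t (f : nat -> R -> R) :
  L2norm t (f N) @[N --> \oo] --> (0 : \bar R)%E <->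
  forall e, 0 < e -> exists N0, forall N, (N0 <= N)%N -> (L2norm t (f N) <= e%:E)%E.
Proof.
have fin N e : (L2norm t (f N) <= e%:E)%E -> L2norm t (f N) \is a fin_num.
  by move=> h; rewrite ge0_fin_numE ?L2norm_ge0// (le_lt_trans h)// ltry.
split=> [/fine_cvgP[[N1 _ H1] /cvgrPdist_le H2] e e0|H].
  have [N2 _ {}H2] := H2 e e0; exists (maxn N1 N2) => N; rewrite geq_max => /andP[/H1 h1 /H2].
  by rewrite sub0r normrN /= ger0_norm ?fine_ge0 ?L2norm_ge0// -[X in _ -> (X <= _)%E]fineK.
apply/fine_cvgP; split.
  by have [N0 HN0] := H 1 ltr01; exists N0 => // N /= /HN0/fin.
apply/cvgrPdist_le => e /H[N0 HN0]; exists N0 => // N /= /HN0 h.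
rewrite sub0r normrN ger0_norm ?fine_ge0 ?L2norm_ge0//.
by rewrite -lee_fin fineK//; exact: fin h.
Qed.

Lemma sum_single (f : nat -> R) k N : (forall n, n != k -> f n = 0) ->
  \sum_(0 <= n < N) f n = if (k < N)%N then f k else 0.
Proof.
move=> f0; case: ltnP => kN.
  rewrite -(sum_delta f kN); apply: eq_bigr => n _.
  by case: (eqVneq k n) => [_|]; rewrite ?mul1r// eq_sym mul0r => /f0.
rewrite big_nat_cond big1// => n /andP[/andP[_ nN] _]; apply: f0.
by rewrite neq_ltn (leq_trans nN).
Qed.

Lemma pairing_single (a b : nat -> R) k : (forall n, n != k -> a n = 0) -> pairing a b = a k * b k.
Proof.
move=> a0; apply: cvg_lim => //; apply: cvg_near_cst; exists k.+1 => // N /= kN.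
by rewrite /series/= (sum_single (k := k)) ?kN// => n /a0 ->; rewrite mul0r.
Qed.

Lemma in_XD_single p (a : nat -> R) k : (forall n, n != k -> a n = 0) -> in_XD p a.
Proof.
move=> a0; apply: (in_XDP (B := XDterms p a k)) => N; rewrite (sum_single (k := k)).
  by case: ifP => // _; exact: XDterms_ge0.
by move=> n /a0; rewrite /XDterms => ->; rewrite normr0 expr0n mulr0.
Qed.

Variables (T alpha rho : R).
Hypotheses (T_gt0 : 0 < T) (alpha_ge0 : 0 <= alpha) (alpha_lt1 : alpha < 1)
  (rho_gt0 : 0 < rho) (rho_le2 : rho <= 2).

Local Notation r n := (rr alpha rho n).
Local Notation c n := (derive1 (phi n) pi).
Local Notation adj := (adjw alpha rho).
Local Notation dadj := (dadjw alpha rho).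
Local Notation usol := (sol alpha rho).
Local Notation dusol := (dsol alpha rho).

(** The weak formulation admits any adjoint solution; [adjoint_unique] replaces it by the explicit
    one on [[0, tau]]. *)
Lemma weak_solution_sol u0 u1 g : in_XD 1 u0 -> in_XD (-1) u1 -> in_L2 T g ->
  XD_continuous 1 T (usol u0 u1 g) -> XD_C1 (-1) T (usol u0 u1 g) (dusol u0 u1 g) ->
  weak_solution alpha rho T g u0 u1 (usol u0 u1 g) (dusol u0 u1 g).
Proof.
move=> Xu0 Xu1 L2g cu cdu; split => //; [exact: sol0|exact: dsol0|].
move=> tau /andP[tau0 tauT] w0 w1 X0 X1 w dw H.
have tT : 0 <= tau <= T by rewrite ltW.
have L2gt := in_L2_t tauT L2g.
have wE := adjoint_unique alpha_lt1 rho_gt0 rho_le2 H.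
have [h L2h hl] := adj_trace T_gt0 alpha_ge0 alpha_lt1 rho_gt0 rho_le2 tT X0 X1.
have [Xu _] : in_XD 1 (usol u0 u1 g tau) /\ True by split => //; have [|] := cu tau; rewrite ?in_itv.
have Xdu : in_XD (-1) (dusol u0 u1 g tau) by have [_ + _] := cdu; case/(_ tau); rewrite ?in_itv.
have i0 : 0 <= (0 : R) <= tau by rewrite lexx ltW.
have w00 : w 0 = adj w0 w1 tau 0 by apply/funext => n; have [] := wE _ n i0.
have dw00 : dw 0 = dadj w0 w1 tau 0 by apply/funext => n; have [] := wE _ n i0.
exists h; last first.
  rewrite w00 dw00; exact: (weak_identity T_gt0 alpha_ge0 alpha_lt1 rho_gt0 rho_le2 tT L2gt).
split=> //; apply/L2norm_cvg0P => e /hl[N0 HN0]; exists N0 => N /HN0.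
rewrite (@eq_L2norm _ _ _ (fun t => h t - \sum_(n < N) c n * w t n))// => s /andP[s0 st].
rewrite big_mkord; congr (_ - _); apply: eq_bigr => n _; congr (_ * _).
by have [] := wE s n; rewrite ?ltW.
Qed.

(** The explicit solution satisfies the same single-mode identity with vanishing terms at time [T];
    comparison leaves only the terms in [u T] and [u' T]. *)
Lemma weak_solution_null u0 u1 g u u' : in_L2 T g ->
  usol u0 u1 g T = 0 -> dusol u0 u1 g T = 0 ->
  weak_solution alpha rho T g u0 u1 u u' -> u T = 0 /\ u' T = 0.
Proof.
move=> L2g s0 ds0 [_ _ _ _ H].
(* The data [(a, b) = (0, 1)] isolate [u T]; [(1, 2 r)] make its coefficient vanish and isolate
   [u' T]. *)
suff key k a b : (b - 2 * r k * a) * u T k - a * u' T k = 0.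
  split; apply/funext => k.
    by have := key k 0 1; rewrite !mulr0 subr0 mul1r mul0r subr0.
  by have := key k 1 (2 * r k); rewrite mulr1 subrr mul0r mul1r sub0r => /eqP; rewrite oppr_eq0 => /eqP.
pose w0 n : R := if n == k then a else 0; pose w1 n : R := if n == k then b else 0.
have w0k n : n != k -> w0 n = 0 by rewrite /w0 => /negPf ->.
have w1k n : n != k -> w1 n = 0 by rewrite /w1 => /negPf ->.
have tT : 0 < T <= T by rewrite T_gt0 lexx.
have ak t n : n != k -> adj w0 w1 T t n = 0 by move=> nk; rewrite /adjw w0k// w1k//; ring.
have dak t n : n != k -> dadj w0 w1 T t n = 0 by move=> nk; rewrite /dadjw w0k// w1k//; ring.
have X0 : in_XD 1 w0 by apply: (in_XD_single (k := k)).
have X1 : in_XD (-1) w1 by apply: (in_XD_single (k := k)).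
have [h [L2h /L2norm_cvg0P hl]] := H T tT w0 w1 X0 X1 _ _
  (adjoint_solution_adj alpha_lt1 rho_gt0 rho_le2 w0 w1 T).
have rAD v n : (rho *: AD alpha v) n = 2 * r n * v n by exact: rhoAD.
have subE (x y : nat -> R) n : (x - y) n = x n - y n by [].
rewrite (@pairing_single _ _ k); last by move=> n nk; rewrite subE rAD w0k// w1k// mulr0 subr0.
rewrite (@pairing_single _ _ k)//.
rewrite (@pairing_single _ _ k); last by move=> n nk; rewrite subE rAD ak// dak// mulr0 subr0.
rewrite (@pairing_single _ _ k); last by move=> n nk; exact: ak.
rewrite !subE !rAD.
(* The trace [h] is known only as an L^2 limit. For a single mode the partial sums are constant from
   [N = k.+1] on, which identifies the integral of [h] against [g]. *)
have -> : \int[lebesgue_measure]_(t in `]0, T[) (h t * g t) =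
    int0 T (fun s => g s * (c k * adj w0 w1 T s k)).
  have ca : continuous (fun s => c k * adj w0 w1 T s k) by apply: contZ; exact: cont_adj.
  have hk e : 0 < e -> (L2norm T (fun s => h s - c k * adj w0 w1 T s k)%R <= e%:E)%E.
    move=> /hl[N0 HN0]; have := HN0 (maxn N0 k.+1) (leq_maxl _ _).
    rewrite (@eq_L2norm _ _ _ (fun s => h s - c k * adj w0 w1 T s k))// => s _.
    rewrite -(big_mkord xpredT (fun n => c n * adj w0 w1 T s n)) (sum_single (k := k)).
      by rewrite leq_maxr.
    by move=> n /ak ->; rewrite mulr0.
  have l := int0_mul_lim L2h L2g (fun=> in_L2_cont T ca) _.
  have {}l := l (fun e e0 => ex_intro _ 0%N (fun N _ => hk e e0)).
  rewrite -(cvg_eventually (n := 0%N) l (fun _ _ => erefl)).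
  by apply: eq_int0 => s _; rewrite mulrC.
move=> E; have := mode_identity alpha rho w0 w1 u0 u1 k L2g; rewrite s0 ds0 !mulr0 => E2.
have w0kk : w0 k = a by rewrite /w0 eqxx.
have w1kk : w1 k = b by rewrite /w1 eqxx.
rewrite w0kk w1kk in E E2; lra.
Qed.

End NullControl.

Theorem theorem9 (R : realType) (T alpha rho : R)
    (T_gt0 : 0 < T) (alpha_ge0 : 0 <= alpha) (alpha_lt1 : alpha < 1)
    (rho_gt0 : 0 < rho) (rho_le2 : rho <= 2) :
  exists C : R, forall u0 u1 : nat -> R, in_XD 1 u0 -> in_XD (-1) u1 ->
  exists g : R -> R,
    [/\ in_L2 T g,
        exists u u' : R -> nat -> R, weak_solution alpha rho T g u0 u1 u u',
        forall u u' : R -> nat -> R, weak_solution alpha rho T g u0 u1 u u' ->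
          u T = 0 /\ u' T = 0 &
        (L2norm T g <= (C * (XDnorm 1 u0 + XDnorm (-1) u1))%:E)%E].
Proof.
have [C _ HC] := control T_gt0 alpha_ge0 alpha_lt1 rho_gt0 rho_le2.
exists C => u0 u1 Xu0 Xu1; have [g [L2g gC cu cdu [uT duT]]] := HC u0 u1 Xu0 Xu1.
exists g; split => //.
  by exists (sol alpha rho u0 u1 g), (dsol alpha rho u0 u1 g); exact: weak_solution_sol.
by move=> u u'; exact: weak_solution_null.
Qed.
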